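(* With $A_\infty,B_\infty$ as defined in the context, let $\mathfrak A_\infty^{(1)}$ and $\mathfrak B_\infty^{(1)}$ be the components in $D^1\mathfrak p_{\mathbb C}/D^2\mathfrak p_{\mathbb C}\cong\mathbb C[[\mathsf U,\mathsf V]]$ of the images of $\log A_\infty$ and $\log B_\infty$ in $\mathfrak p_{\mathbb C}/D^2\mathfrak p_{\mathbb C}=(\mathbb C\mathsf a\oplus\mathbb C\mathsf b)\oplus\mathbb C[[\mathsf U,\mathsf V]]$. Then $$\mathfrak A_\infty^{(1)}=2\pi i\Big(c(\mathsf U)-\frac{2\pi i}{4}\mathsf V+\sum_{n\ge 3,\ n\ \mathrm{odd}}\zeta(n)\mathsf V^n\Big),$$ $$\mathfrak B_\infty^{(1)}=-2\pi i\big(c(2\pi i\mathsf V)+\mathsf U\,c(\mathsf U)\,c(2\pi i\mathsf V)\big)+\sum_{n\ge 3,\ n\ \mathrm{odd}}\zeta(n)\,\mathsf U\mathsf V^{n-1},$$ where $c(x)=\frac1{e^x-1}+\frac12-\frac1x=\sum_{k\ge2}\frac{B_k}{k!}x^{k-1}$ ($B_k$ the Bernoulli numbers, $\zeta$ the Riemann zeta function).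
   Context: **Lie algebra.** $\mathfrak p_{\mathbb C}$ is the completion, with respect to the lower central series, of the free Lie algebra over $\mathbb C$ on $\mathsf a,\mathsf b$. $D^1\mathfrak p_{\mathbb C}=[\mathfrak p_{\mathbb C},\mathfrak p_{\mathbb C}]$ and $D^2\mathfrak p_{\mathbb C}=[D^1\mathfrak p_{\mathbb C},D^1\mathfrak p_{\mathbb C}]$ (closed ideals). As a vector space $\mathfrak p_{\mathbb C}/D^2\mathfrak p_{\mathbb C}=(\mathbb C\mathsf a\oplus\mathbb C\mathsf b)\oplus D^1\mathfrak p_{\mathbb C}/D^2\mathfrak p_{\mathbb C}$, and $D^1\mathfrak p_{\mathbb C}/D^2\mathfrak p_{\mathbb C}$ is identified with $\mathbb C[[\mathsf U,\mathsf V]]$ (commuting variables) by $\mathrm{ad}^k(\mathsf a)\mathrm{ad}^l(\mathsf b)([\mathsf a,\mathsf b])\mapsto\mathsf U^k\mathsf V^l$. **Drinfeld associator.** $\Phi(\mathsf x_0,\mathsf x_1)\in\mathbb R\langle\langle\mathsf x_0,\mathsf x_1\rangle\rangle$ is the group-like series $\Phi=G_1^{-1}G_0$, where $G_0,G_1$ are the solutions on $(0,1)$ of $G'(z)=\big(\frac{\mathsf x_0}{z}+\frac{\mathsf x_1}{z-1}\big)G(z)$ with $G_0(z)\sim z^{\mathsf x_0}$ as $z\to0^+$ and $G_1(z)\sim(1-z)^{\mathsf x_1}$ as $z\to1^-$. In this normalization (standard fact), modulo the commutator subalgebra of the ideal generated by $\mathsf x_1$ in the completed free Lie algebra on $\mathsf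 x_0,\mathsf x_1$, one has $\log\Phi\equiv-\sum_{n\ge2}\zeta(n)\mathrm{ad}^{n-1}(\mathsf x_0)(\mathsf x_1)$. **The series $A_\infty,B_\infty$.** Let $\iota$ be the continuous Lie algebra morphism from the completed free Lie algebra on $\mathsf x_0,\mathsf x_1$ to $\mathfrak p_{\mathbb C}$ with $\iota(\mathsf x_0)=\frac{\mathrm{ad}(\mathsf a)}{e^{\mathrm{ad}(\mathsf a)}-1}(\mathsf b)=\sum_{k\ge0}\frac{B_k}{k!}\mathrm{ad}^k(\mathsf a)(\mathsf b)$ (with $B_1=-\frac12$) and $\iota(\mathsf x_1)=[\mathsf a,\mathsf b]$; put $\mathsf x_\infty=-\mathsf x_0-\mathsf x_1$. Then, in $\exp\mathfrak p_{\mathbb C}$, $$A_\infty=e^{\pi i\,\iota(\mathsf x_1)}\,\Phi(\iota(\mathsf x_0),\iota(\mathsf x_1))\,e^{2\pi i\,\iota(\mathsf x_0)}\,\Phi(\iota(\mathsf x_0),\iota(\mathsf x_1))^{-1},$$ $$B_\infty=\Phi(\iota(\mathsf x_\infty),\iota(\mathsf x_1))\,e^{\mathsf a}\,\Phi(\iota(\mathsf x_0),\iota(\mathsf x_1))^{-1}.$$ *)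

(* Defs.v *)
From HB Require Import structures.
From mathcomp Require Import all_boot all_order all_algebra.
From mathcomp Require Import all_classical all_reals all_analysis.
From mathcomp Require Import complex.

Set Implicit Arguments.
Unset Strict Implicit.
Unset Printing Implicit Defensive.

Import Order.TTheory GRing.Theory Num.Theory.
Import numFieldNormedType.Exports.

Local Open Scope classical_set_scope.
Local Open Scope ring_scope.

Lemma sum_triangle (V : nmodType) (n : nat) (F : nat -> nat -> V) :
  \sum_(i < n.+1) \sum_(j < (n - i).+1) F i (i + j)%N =
  \sum_(m < n.+1) \sum_(i < m.+1) F i m.
Proof.
transitivity (\sum_(i < n.+1) \sum_(m < n.+1 | (i <= m)%N) F i m).
  apply: eq_bigr => i _; rewrite -(big_mkord xpredT (fun j => F i (i + j)%N)).
  rewrite -(big_geq_mkord i n.+1 xpredT (fun m => F i m)) /=.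
  have -> : \sum_(i <= m < n.+1) F i m = \sum_(0 <= j < n.+1 - i) F i (j + i)%N.
    by rewrite -{1}[i : nat]add0n big_addn.
  rewrite subSn; last by rewrite -ltnS.
  by apply: eq_bigr => j _; rewrite addnC.
rewrite (exchange_big_dep xpredT) //=; apply: eq_bigr => m _.
rewrite (big_ord_widen n.+1 (fun i => F i m) (ltn_ord m)).
by apply: eq_bigl => i; rewrite ltnS.
Qed.

(** * Formal power series in one variable; [K[[U,V]]] is [{fps {fps K}}] *)

Record fps (K : Type) := FPS { fpscoef : nat -> K }.

Notation "{ 'fps' K }" := (fps K) (at level 0, format "{ 'fps'  K }").

HB.instance Definition _ (K : Type) := gen_eqMixin {fps K}.
HB.instance Definition _ (K : Type) := gen_choiceMixin {fps K}.

Lemma fpsP (K : Type) (f g : {fps K}) :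
  (forall n, fpscoef f n = fpscoef g n) -> f = g.
Proof. by case: f => f; case: g => g /= fg; congr FPS; apply/funext. Qed.

Section FpsRing.
Variable K : comNzRingType.
Implicit Types f g h : {fps K}.

Definition fps_zero : {fps K} := FPS (fun=> 0).
Definition fps_opp f : {fps K} := FPS (fun n => - fpscoef f n).
Definition fps_add f g : {fps K} := FPS (fun n => fpscoef f n + fpscoef g n).
Definition fps_one : {fps K} := FPS (fun n => (n == 0%N)%:R).
Definition fps_mul f g : {fps K} :=
  FPS (fun n => \sum_(i < n.+1) fpscoef f i * fpscoef g (n - i)).

Let addA : associative fps_add.
Proof. by move=> f g h; apply: fpsP => n /=; rewrite addrA. Qed.
Let addC : commutative fps_add.
Proof. by move=> f g; apply: fpsP => n /=; rewrite addrC. Qed.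
Let add0 : left_id fps_zero fps_add.
Proof. by move=> f; apply: fpsP => n /=; rewrite add0r. Qed.
Let addN : left_inverse fps_zero fps_opp fps_add.
Proof. by move=> f; apply: fpsP => n /=; rewrite addNr. Qed.

HB.instance Definition _ := GRing.isZmodule.Build {fps K} addA addC add0 addN.

Let mulA : associative fps_mul.
Proof.
move=> f g h; apply: fpsP => n /=.
pose F i m := fpscoef f i * fpscoef g (m - i) * fpscoef h (n - m).
transitivity (\sum_(i < n.+1) \sum_(j < (n - i).+1) F i (i + j)%N).
  apply: eq_bigr => i _; rewrite mulr_sumr; apply: eq_bigr => j _.
  by rewrite /F addKn mulrA subnDA.
rewrite sum_triangle; apply: eq_bigr => m _.
by rewrite mulr_suml; apply: eq_bigr.
Qed.
Let mulC : commutative fps_mul.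
Proof.
move=> f g; apply: fpsP => n /=; rewrite (reindex_inj rev_ord_inj) /=.
apply: eq_bigr => i _; rewrite mulrC subSS.
by rewrite subKn // -ltnS.
Qed.
Let mul1 : left_id fps_one fps_mul.
Proof.
move=> f; apply: fpsP => n /=.
by rewrite big_ord_recl /= mul1r subn0 big1 ?addr0 // => i _; rewrite mul0r.
Qed.
Let mulDl : left_distributive fps_mul fps_add.
Proof.
move=> f g h; apply: fpsP => n /=; rewrite -big_split /=.
by apply: eq_bigr => i _; rewrite mulrDl.
Qed.
Let one_neq0 : fps_one != 0 :> {fps K}.
Proof.
by apply/eqP => /(congr1 (fun f => fpscoef f 0%N)) /eqP; rewrite /= oner_eq0.
Qed.

HB.instance Definition _ :=
  GRing.Zmodule_isComNzRing.Build {fps K} mulA mulC mul1 mulDl one_neq0.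

Definition fpsC (c : K) : {fps K} := FPS (fun n => if n == 0%N then c else 0).
Definition fpsX : {fps K} := FPS (fun n => (n == 1%N)%:R).
(* [fps_scalevar c f] is f(c x). *)
Definition fps_scalevar (c : K) f : {fps K} :=
  FPS (fun n => c ^+ n * fpscoef f n).

End FpsRing.

Arguments fpsX {K}.

(* The outer variable is U and the inner one is V: the coefficient of
   U^k V^l in f is [coefUV f k l]. *)
Section TwoVariables.
Variable K : comNzRingType.

Definition coefUV (f : {fps {fps K}}) (k l : nat) : K := fpscoef (fpscoef f k) l.
Definition constUV (c : K) : {fps {fps K}} := fpsC (fpsC c).
Definition inU (f : {fps K}) : {fps {fps K}} :=
  FPS (fun k => fpsC (fpscoef f k)).
Definition inV (f : {fps K}) : {fps {fps K}} := fpsC f.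
Definition varU : {fps {fps K}} := inU fpsX.
Definition varV : {fps {fps K}} := inV fpsX.

End TwoVariables.

(** * Bernoulli and zeta numbers *)

(* [bernoulli_nums n] lists B_0, ..., B_(n-1), computed from
   \sum_(k <= n) 'C(n.+1, k) B_k = 0 for n > 0; in particular B_1 = -1/2. *)
Fixpoint bernoulli_nums (n : nat) : seq rat :=
  if n is m.+1 then
    let s := bernoulli_nums m in
    rcons s (if m == 0%N then 1
             else - (m.+1%:R)^-1 * \sum_(k < m) 'C(m.+1, k)%:R * s`_k)
  else [::].

Definition bernoulli_num (n : nat) : rat := (bernoulli_nums n.+1)`_n.

Lemma size_bernoullis n : size (bernoulli_nums n) = n.
Proof. by elim: n => //= n IHn; rewrite size_rcons IHn. Qed.

Lemma nth_bernoullis n k : (k < n)%N -> (bernoulli_nums n)`_k = bernoulli_num k.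
Proof.
elim: n => // n IHn; rewrite ltnS leq_eqVlt => /predU1P[-> //|kn] /=.
by rewrite nth_rcons size_bernoullis kn IHn.
Qed.

Lemma bernoulli_sum n :
  \sum_(k < n.+1) 'C(n.+1, k)%:R * bernoulli_num k = (n == 0%N)%:R.
Proof.
have Bn : bernoulli_num n = if n == 0%N then 1
    else - (n.+1%:R)^-1 * \sum_(k < n) 'C(n.+1, k)%:R * bernoulli_num k.
  rewrite {1}/bernoulli_num /= nth_rcons size_bernoullis ltnn eqxx.
  case: eqP => // _; congr (_ * _); apply: eq_bigr => k _.
  by rewrite nth_bernoullis.
rewrite big_ord_recr /= Bn; case: eqP => [->|_].
  by rewrite big_ord0 add0r bin0 mulr1.
rewrite binSn mulrA mulrN mulfV ?pnatr_eq0 // mulN1r.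
exact: addrN.
Qed.

(* (e^x - 1)/x * \sum_k B_k/k! x^k = 1. *)
Lemma bernoulli_gen :
  FPS (fun n => (n.+1)`!%:R^-1) * FPS (fun k => bernoulli_num k / k`!%:R) = 1
    :> {fps rat}.
Proof.
rewrite mulrC; apply: fpsP => n /=.
have nf m : (m`!)%:R != 0 :> rat by rewrite pnatr_eq0 -lt0n fact_gt0.
apply: (mulfI (nf n.+1)); rewrite mulr_sumr.
transitivity (\sum_(k < n.+1) 'C(n.+1, k)%:R * bernoulli_num k).
  apply: eq_bigr => k _.
  have kn : (k <= n.+1)%N by apply: ltnW.
  have -> : (n.+1)`!%:R =
      'C(n.+1, k)%:R * (k`!%:R * (n - k).+1`!%:R) :> rat.
    by rewrite -2!natrM -subSn ?bin_fact // -ltnS.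
  rewrite -!mulrA; congr (_ * _).
  by rewrite -invfM mulrA mulrCA divff ?mulr1 // mulf_neq0.
rewrite bernoulli_sum; case: eqP => [->|_]; last by rewrite mulr0.
by rewrite mulr1.
Qed.

(* c(x) = 1/(e^x - 1) + 1/2 - 1/x = \sum_(k >= 2) B_k/k! x^(k-1). *)
Definition cseries (F : fieldType) : {fps F} :=
  FPS (fun m => if m == 0%N then 0 else ratr (bernoulli_num m.+1) / (m.+1)`!%:R).

Definition zeta (R : realType) (n : nat) : R :=
  limn (series (fun k => (k.+1%:R ^+ n)^-1 : R)).

(* \sum_(n >= 3, n odd) zeta(n) x^(n - d) *)
Definition odd_zeta_series (R : realType) (d : nat) : {fps R[i]} :=
  FPS (fun m => let n := (m + d)%N in
    if (3 <= n)%N && odd n then (zeta R n)%:C%C else 0).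

(** * Noncommutative formal power series in two letters *)

(* [false] is the letter x_0 (or a), [true] is the letter x_1 (or b). *)
Record ncseries (K : Type) := NCSeries { nccoef : seq bool -> K }.

HB.instance Definition _ (K : Type) := gen_eqMixin (ncseries K).
HB.instance Definition _ (K : Type) := gen_choiceMixin (ncseries K).

Lemma ncseriesP (K : Type) (f g : ncseries K) :
  (forall w, nccoef f w = nccoef g w) -> f = g.
Proof. by case: f => f; case: g => g /= fg; congr NCSeries; apply/funext. Qed.

Section NCSeriesAlgebra.
Variable K : comNzRingType.
Implicit Types f g h : ncseries K.

Definition nc_zero : ncseries K := NCSeries (fun=> 0).
Definition nc_opp f := NCSeries (fun w => - nccoef f w).
Definition nc_add f g := NCSeries (fun w => nccoef f w + nccoef g w).
Definition nc_one : ncseries K := NCSeries (fun w => (w == [::])%:R).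
Definition nc_mul f g := NCSeries (fun w =>
  \sum_(i < (size w).+1) nccoef f (take i w) * nccoef g (drop i w)).
Definition nc_scale (c : K) f := NCSeries (fun w => c * nccoef f w).

Let addA : associative nc_add.
Proof. by move=> f g h; apply: ncseriesP => n /=; rewrite addrA. Qed.
Let addC : commutative nc_add.
Proof. by move=> f g; apply: ncseriesP => n /=; rewrite addrC. Qed.
Let add0 : left_id nc_zero nc_add.
Proof. by move=> f; apply: ncseriesP => n /=; rewrite add0r. Qed.
Let addN : left_inverse nc_zero nc_opp nc_add.
Proof. by move=> f; apply: ncseriesP => n /=; rewrite addNr. Qed.

HB.instance Definition _ :=
  GRing.isZmodule.Build (ncseries K) addA addC add0 addN.

Let mulA : associative nc_mul.
Proof.
move=> f g h; apply: ncseriesP => w /=.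
pose F i m := nccoef f (take i w) * nccoef g (drop i (take m w))
              * nccoef h (drop m w).
transitivity (\sum_(i < (size w).+1) \sum_(j < (size w - i).+1) F i (i + j)%N).
  apply: eq_bigr => i _; rewrite mulr_sumr size_drop; apply: eq_bigr => j _.
  by rewrite /F mulrA take_drop drop_drop addnC.
rewrite sum_triangle; apply: eq_bigr => m _.
rewrite mulr_suml size_takel -1?ltnS //; apply: eq_bigr => i _.
by rewrite take_takel // -ltnS.
Qed.
Let mul1 : left_id nc_one nc_mul.
Proof.
move=> f; apply: ncseriesP => w /=.
rewrite big_ord_recl take0 drop0 /= mul1r big1 ?addr0 // => i _.
by rewrite -size_eq0 size_takel ?mul0r // ltn_ord.
Qed.
Let mulr1 : right_id nc_one nc_mul.
Proof.
move=> f; apply: ncseriesP => w /=.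
rewrite big_ord_recr /= take_size drop_size /= mulr1 big1 ?add0r // => i _.
rewrite -size_eq0 size_drop subn_eq0 leqNgt ltn_ord.
by rewrite mulr0.
Qed.
Let mulDl : left_distributive nc_mul nc_add.
Proof.
move=> f g h; apply: ncseriesP => n /=; rewrite -big_split /=.
by apply: eq_bigr => i _; rewrite mulrDl.
Qed.
Let mulDr : right_distributive nc_mul nc_add.
Proof.
move=> f g h; apply: ncseriesP => n /=; rewrite -big_split /=.
by apply: eq_bigr => i _; rewrite mulrDr.
Qed.
Let one_neq0 : nc_one != 0 :> ncseries K.
Proof.
by apply/eqP => /(congr1 (fun f => nccoef f [::])) /eqP; rewrite /= oner_eq0.
Qed.

HB.instance Definition _ := GRing.Zmodule_isNzRing.Build (ncseries K)
  mulA mul1 mulr1 mulDl mulDr one_neq0.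

Let scaleA c d f : nc_scale c (nc_scale d f) = nc_scale (c * d) f.
Proof. by apply: ncseriesP => w /=; rewrite mulrA. Qed.
Let scale1 : left_id 1 nc_scale.
Proof. by move=> f; apply: ncseriesP => w /=; rewrite mul1r. Qed.
Let scaleDr : right_distributive nc_scale +%R.
Proof. by move=> c f g; apply: ncseriesP => w /=; rewrite mulrDr. Qed.
Let scaleDl f : {morph nc_scale^~ f : c d / c + d}.
Proof. by move=> c d; apply: ncseriesP => w /=; rewrite mulrDl. Qed.

HB.instance Definition _ := GRing.Zmodule_isLmodule.Build K (ncseries K)
  scaleA scale1 scaleDr scaleDl.

Let scaleAl c f g : c *: (f * g) = (c *: f) * g.
Proof.
apply: ncseriesP => w /=; rewrite mulr_sumr.
by apply: eq_bigr => i _; rewrite mulrA.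
Qed.

HB.instance Definition _ :=
  GRing.Lmodule_isLalgebra.Build K (ncseries K) scaleAl.

Let scaleAr c f g : c *: (f * g) = f * (c *: g).
Proof.
apply: ncseriesP => w /=; rewrite mulr_sumr.
by apply: eq_bigr => i _; rewrite mulrCA.
Qed.

HB.instance Definition _ :=
  GRing.Lalgebra_isAlgebra.Build K (ncseries K) scaleAr.

Definition letter (x : bool) : ncseries K := NCSeries (fun w => (w == [:: x])%:R).

Definition lie f g := f * g - g * f.

(* The infinite sum \sum_n u_n of a family such that u_n has no term of degree
   < n, so that only the indices n <= size w contribute at the word w. All the
   infinite sums below are of this kind as soon as the series that are
   exponentiated or substituted have zero constant term, and those whose
   logarithm or inverse is taken have constant term 1. *)
Definition ncsum (u : nat -> ncseries K) : ncseries K :=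
  NCSeries (fun w => \sum_(n < (size w).+1) nccoef (u n) w).

Definition ncinv f := ncsum (fun n => (1 - f) ^+ n).

(* [ncsubst f y z] is f(y, z). *)
Definition ncsubst f (y z : ncseries K) := ncsum (fun n =>
  \sum_(w : n.-tuple bool) nccoef f w *: \prod_(x <- w) (if x then z else y)).

End NCSeriesAlgebra.

Section ExpLog.
Variable F : fieldType.
Implicit Types f : ncseries F.

Definition ncexp f := ncsum (fun n => (n`!%:R)^-1 *: f ^+ n).
(* The term n = 0 vanishes because 0^-1 = 0. *)
Definition nclog f :=
  ncsum (fun n => ((-1) ^+ n.+1 / n%:R) *: (f - 1) ^+ n).

End ExpLog.

(** * The Lie algebra p and its derived series *)

Section DerivedSeries.
Variable K : comNzRingType.

(* The free Lie algebra on the two letters, realised as the Lie subalgebra they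
   generate in the free associative algebra. *)
Inductive free_lie : ncseries K -> Prop :=
| free_lie_letter x : free_lie (letter K x)
| free_lie_0 : free_lie 0
| free_lie_D f g : free_lie f -> free_lie g -> free_lie (f + g)
| free_lie_Z c f : free_lie f -> free_lie (c *: f)
| free_lie_br f g : free_lie f -> free_lie g -> free_lie (lie f g).

Inductive lie_span (P : set (ncseries K)) : ncseries K -> Prop :=
| lie_span_0 : lie_span P 0
| lie_span_br f g : P f -> P g -> lie_span P (lie f g)
| lie_span_D f g : lie_span P f -> lie_span P g -> lie_span P (f + g)
| lie_span_Z c f : lie_span P f -> lie_span P (c *: f).

(* Closure for the topology of the degree filtration, which induces on the free
   Lie algebra the topology of its lower central series. *)
Definition degree_closure (P : set (ncseries K)) : set (ncseries K) :=
  [set f | forall N : nat, exists2 g, P g &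
     forall w, (size w < N)%N -> nccoef f w = nccoef g w].

Definition p_lie : set (ncseries K) := degree_closure free_lie.
Definition derived_closure (P : set (ncseries K)) := degree_closure (lie_span P).
Definition D1p := derived_closure p_lie.
Definition D2p := derived_closure D1p.

(* \sum_(k, l) f_(k, l) ad^k(a) ad^l(b) ([a, b]) *)
Definition D1_repr (f : {fps {fps K}}) : ncseries K :=
  let a := letter K false in let b := letter K true in
  ncsum (fun n => \sum_(k < n.+1)
    coefUV f k (n - k) *: iter k (lie a) (iter (n - k) (lie b) (lie a b))).

(* [f] is the component in D^1 p / D^2 p = K[[U,V]] of the image of [X] in
   p / D^2 p = (K a + K b) + D^1 p / D^2 p. *)
Definition D1_component (X : ncseries K) (f : {fps {fps K}}) : Prop :=
  p_lie X /\ exists alpha beta : K,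
    D2p (X - (alpha *: letter K false + beta *: letter K true + D1_repr f)).

End DerivedSeries.

(** * The Drinfeld associator *)

Section Associator.
Variable R : realType.
Implicit Types (G : R -> ncseries R) (Phi : ncseries R).

Definition KZ_solution G : Prop :=
  forall z : R, 0 < z < 1 -> forall w,
    is_derive z 1 (fun t => nccoef (G t) w)
      (nccoef ((z^-1 *: letter R false + (z - 1)^-1 *: letter R true) * G z) w).

(* z^x = exp(x log z) *)
Definition ncpow (z : R) (x : ncseries R) : ncseries R := ncexp (ln z *: x).

(* G_0(z) ~ z^(x_0) as z -> 0+, and G_1(z) ~ (1-z)^(x_1) as z -> 1-, mean that
   G_0(z) z^(-x_0) and G_1(z) (1-z)^(-x_1) tend to 1 coefficientwise. *)
Definition asymptotic0 G : Prop :=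
  forall w, nccoef (G z * ncinv (ncpow z (letter R false))) w @[z --> 0^'+]
            --> nccoef (1 : ncseries R) w.

Definition asymptotic1 G : Prop :=
  forall w, nccoef (G z * ncinv (ncpow (1 - z) (letter R true))) w @[z --> 1^'-]
            --> nccoef (1 : ncseries R) w.

Definition drinfeld_associator Phi : Prop :=
  exists G0 G1 : R -> ncseries R,
    [/\ KZ_solution G0, KZ_solution G1, asymptotic0 G0, asymptotic1 G1 &
        forall z : R, 0 < z < 1 -> Phi = ncinv (G1 z) * G0 z].

End Associator.

(** * The series A_oo and B_oo *)

Section AB.
Variable R : realType.
Local Notation C := (R[i]).
Local Notation x0 := (letter C false).
Local Notation x1 := (letter C true).
Local Notation a := (letter C false).
Local Notation b := (letter C true).

Definition pii : C := (pi : R)%:C%C * 'i.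

Definition to_C (f : ncseries R) : ncseries C :=
  NCSeries (fun w => (nccoef f w)%:C%C).

(* The continuous morphism iota, extended to the completed free associative
   algebras: x_0 |-> \sum_k B_k/k! ad^k(a)(b) and x_1 |-> [a, b]. *)
Definition iota_x0 : ncseries C :=
  ncsum (fun k => (ratr (bernoulli_num k) / k`!%:R) *: iter k (lie a) b).
Definition iota_p (f : ncseries C) : ncseries C := ncsubst f iota_x0 (lie a b).

Definition xoo : ncseries C := - x0 - x1.

Variable Phi : ncseries R.

Definition A_oo : ncseries C :=
  ncexp (pii *: iota_p x1) * ncsubst (to_C Phi) (iota_p x0) (iota_p x1)
  * ncexp ((2 * pii) *: iota_p x0)
  * ncinv (ncsubst (to_C Phi) (iota_p x0) (iota_p x1)).

Definition B_oo : ncseries C :=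
  ncsubst (to_C Phi) (iota_p xoo) (iota_p x1) * ncexp a
  * ncinv (ncsubst (to_C Phi) (iota_p x0) (iota_p x1)).

End AB.

(* Main.v *)
Require Import Defs.
From HB Require Import structures.
From mathcomp Require Import all_boot all_order all_algebra.
From mathcomp Require Import all_classical all_reals all_analysis.
From mathcomp Require Import complex.
From mathcomp Require Import ring lra zify.

Set Implicit Arguments.
Unset Strict Implicit.
Unset Printing Implicit Defensive.

Import Order.TTheory GRing.Theory Num.Theory.
Import numFieldNormedType.Exports.

Local Open Scope ring_scope.

(* Write p(X) for the abelianisation of a series X in C[[U,V]] and q(X) for its
   Fox derivative with respect to b. Since q kills D^2 p, is injective on D^1 p
   modulo D^2 p and satisfies q(XY) = p(X) q(Y) + q(X) Y([]), the component f of
   X in p is read off q(X) = X(b) + U f; conversely every X in p is congruent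
   modulo D^2 p to the element with that component. One has
   q(e^Z) = (e^(pZ) - 1)/(pZ) q(Z), and for y, z in p with p(z) = 0 the value of
   q at Phi(y, z) is \sum_n Phi(x_0^n x_1) p(y)^n q(z), so the components of
   log A_oo and log B_oo are explicit in the coefficients Phi(x_0^n x_1).

   A product of exponentials of Lie series, or a group-like series evaluated at
   Lie series, has logarithmic degree derivative in p, and solving that equation
   degree by degree puts its logarithm in p; this replaces the
   Baker-Campbell-Hausdorff and Ree theorems.

   On the analytic side, G_0 and G_1 are group-like because the shuffle defect
   has zero derivative, by induction on the length, and tends to 0. The
   coefficient of x_0^n x_1 in G_0 is -Li_(n+1), its limit at 1 is
   -zeta(n+1) for n > 0, and the one in G_1 tends to 0. The even zeta values cancel
   against Bernoulli numbers by Euler's formula, proved from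
   zeta(2) = pi^2/6 (halving identity for 1/sin^2) and from Williams' recurrence
   \sum_j zeta(2j) zeta(2m-2j) = (m + 1/2) zeta(2m), which the Riccati equation
   of x/(e^x - 1) gives for Bernoulli numbers too. *)

(** * Noncommutative series up to a given degree *)

(** The quotient p/D^2 p is the free metabelian Lie algebra and (p, q) is its Magnus embedding;
    q([a,b]) = U accounts for the factor U in front of every component. Only the coefficients
    Phi(x_0^n x_1) matter because p(iota x_1) = 0: q differentiates the last letter of a word and
    abelianises the others, so an x_1 anywhere earlier kills the word. The stated formulas result
    from cancellations. In A_oo, conjugation by Phi contributes the sum of all zeta(n) V^n with n >=
    2, and the even terms are absorbed by half of the Bernoulli series at 2 pi i V. That half comes
    from e^(pi i x_1), whose remaining U/2 removes the term B_1 = -1/2 of iota(x_0). In B_oo, the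
    two copies of Phi have first arguments abelianising to -V and V, which separates the even zeta
    values, turned into Bernoulli numbers, from the odd ones. Membership of the logarithms in p is
    invisible to p and q, hence the separate argument for it. *)

Section Truncation.
Variable K : comNzRingType.
Implicit Types (f g h : ncseries K) (u v : nat -> ncseries K).

Lemma nccoefD f g w : nccoef (f + g) w = nccoef f w + nccoef g w.
Proof. by []. Qed.
Lemma nccoefN f w : nccoef (- f) w = - nccoef f w.
Proof. by []. Qed.
Lemma nccoefB f g w : nccoef (f - g) w = nccoef f w - nccoef g w.
Proof. by []. Qed.
Lemma nccoef0 w : nccoef (0 : ncseries K) w = 0.
Proof. by []. Qed.
Lemma nccoefZ c f w : nccoef (c *: f) w = c * nccoef f w.
Proof. by []. Qed.
Lemma nccoef1 w : nccoef (1 : ncseries K) w = (w == [::])%:R.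
Proof. by []. Qed.
Lemma nccoefM f g w : nccoef (f * g) w =
  \sum_(i < (size w).+1) nccoef f (take i w) * nccoef g (drop i w).
Proof. by []. Qed.

Lemma nccoef_sum (I : Type) (r : seq I) (P : pred I) (F : I -> ncseries K) w :
  nccoef (\sum_(i <- r | P i) F i) w = \sum_(i <- r | P i) nccoef (F i) w.
Proof. exact: (big_morph (fun f => nccoef f w)). Qed.

Lemma nccoefM_nil f g : nccoef (f * g) [::] = nccoef f [::] * nccoef g [::].
Proof. by rewrite nccoefM big_ord_recl big_ord0 addr0. Qed.

Lemma nccoefX_nil f n : nccoef (f ^+ n) [::] = nccoef f [::] ^+ n.
Proof.
by elim: n => [|n IHn]; rewrite ?expr0 // !exprS nccoefM_nil IHn.
Qed.

(** Membership in the n-th power of the augmentation ideal; [nceq n] is congruence modulo it, and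
    identities between infinite sums are checked on finite ones modulo every n. *)
Record ncord n f : Prop :=
  NCOrd { ncord_coef : forall w, (size w < n)%N -> nccoef f w = 0 }.
Definition nceq n f g := ncord n (f - g).

Lemma nceqP n f g :
  (forall w, (size w < n)%N -> nccoef f w = nccoef g w) <-> nceq n f g.
Proof.
split=> [fg|[fg] w wn]; first by split=> w wn; rewrite nccoefB fg // subrr.
by apply/eqP; rewrite -subr_eq0 -nccoefB fg.
Qed.

Lemma nceq_eq f g : (forall n, nceq n f g) -> f = g.
Proof. by move=> fg; apply: ncseriesP => w; apply: (nceqP _ _ _).2 (ltnSn _). Qed.

Lemma ncord_leq m n f : (m <= n)%N -> ncord n f -> ncord m f.
Proof. by move=> mn [nf]; split=> w wm; apply: nf; apply: leq_trans mn. Qed.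
Lemma ncordD n f g : ncord n f -> ncord n g -> ncord n (f + g).
Proof. by move=> [nf] [ng]; split=> w wn; rewrite nccoefD nf // ng // addr0. Qed.
Lemma ncordN n f : ncord n f -> ncord n (- f).
Proof. by move=> [nf]; split=> w wn; rewrite nccoefN nf // oppr0. Qed.
Lemma ncordB n f g : ncord n f -> ncord n g -> ncord n (f - g).
Proof. by move=> nf ng; apply/ncordD/ncordN. Qed.
Lemma ncordZ n c f : ncord n f -> ncord n (c *: f).
Proof. by move=> [nf]; split=> w wn; rewrite nccoefZ nf // mulr0. Qed.
Lemma ncord_sum n (I : Type) (r : seq I) (P : pred I) (F : I -> ncseries K) :
  (forall i, P i -> ncord n (F i)) -> ncord n (\sum_(i <- r | P i) F i).
Proof. by move=> nF; elim/big_ind: _ => //; exact: ncordD. Qed.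

Lemma ncordM m n f g : ncord m f -> ncord n g -> ncord (m + n) (f * g).
Proof.
move=> [mf] [ng]; split=> w wmn; rewrite nccoefM big1 // => i _.
have iw : (i <= size w)%N by rewrite -ltnS.
case: (ltnP i m) => im; first by rewrite mf ?mul0r // size_takel.
by rewrite ng ?mulr0 // size_drop ltn_subLR //; apply: leq_trans wmn _; rewrite leq_add2r.
Qed.

Lemma ncordMl n f g : ncord n f -> ncord n (f * g).
Proof. by move=> nf; rewrite -[n]addn0; apply: ncordM. Qed.
Lemma ncordMr n f g : ncord n g -> ncord n (f * g).
Proof. by move=> ng; rewrite -[n]add0n; apply: ncordM. Qed.

Lemma ncord1P f : ncord 1 f <-> nccoef f [::] = 0.
Proof.
by split=> [[->] //|f0]; split=> w; rewrite ltnS leqn0 => /nilP ->.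
Qed.

Lemma ncordX f n : ncord 1 f -> ncord n (f ^+ n).
Proof.
move=> f1; elim: n => [//|n IHn]; rewrite exprS -add1n.
exact: ncordM.
Qed.

Lemma ncord_lie m n f g : ncord m f -> ncord n g -> ncord (m + n) (lie f g).
Proof.
by move=> mf ng; apply: ncordB; first exact: ncordM; rewrite addnC; exact: ncordM.
Qed.

Lemma ncord_letter x : ncord 1 (letter K x).
Proof. exact/ncord1P. Qed.

Lemma nceq_refl n f : nceq n f f.
Proof. by rewrite /nceq subrr. Qed.
Lemma nceq_sym n f g : nceq n f g -> nceq n g f.
Proof. by move=> /ncordN; rewrite opprB. Qed.
Lemma nceq_trans n f g h : nceq n f g -> nceq n g h -> nceq n f h.
Proof. by move=> fg /(ncordD fg); rewrite /nceq addrA subrK. Qed.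
Lemma nceq_leq m n f g : (m <= n)%N -> nceq n f g -> nceq m f g.
Proof. exact: ncord_leq. Qed.
Lemma nceqD n f f' g g' : nceq n f f' -> nceq n g g' -> nceq n (f + g) (f' + g').
Proof. by move=> ff /(ncordD ff); rewrite /nceq opprD addrACA. Qed.
Lemma nceqN n f f' : nceq n f f' -> nceq n (- f) (- f').
Proof. by move=> /ncordN; rewrite /nceq opprD. Qed.
Lemma nceqB n f f' g g' : nceq n f f' -> nceq n g g' -> nceq n (f - g) (f' - g').
Proof. by move=> ff gg; apply/nceqD/nceqN. Qed.
Lemma nceqZ n c f f' : nceq n f f' -> nceq n (c *: f) (c *: f').
Proof. by move=> /(ncordZ c); rewrite /nceq scalerBr. Qed.
Lemma nceq_sum n (I : Type) (r : seq I) (P : pred I) (F G : I -> ncseries K) :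
  (forall i, P i -> nceq n (F i) (G i)) ->
  nceq n (\sum_(i <- r | P i) F i) (\sum_(i <- r | P i) G i).
Proof. by rewrite /nceq -sumrB; apply: ncord_sum. Qed.

Lemma nceqM n f f' g g' : nceq n f f' -> nceq n g g' -> nceq n (f * g) (f' * g').
Proof.
move=> ff gg; rewrite /nceq.
have -> : f * g - f' * g' = (f - f') * g + f' * (g - g').
  by rewrite mulrBl mulrBr addrA subrK.
by apply: ncordD; [exact: ncordMl|exact: ncordMr].
Qed.

(** A factor without constant term gains one degree; this gain lets the logarithm be constructed
    degree by degree. *)
Lemma nceqMS n f f' g g' : ncord 1 g -> ncord 1 f' ->
  nceq n f f' -> nceq n g g' -> nceq n.+1 (f * g) (f' * g').
Proof.
move=> g1 f1 ff gg; rewrite /nceq.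
have -> : f * g - f' * g' = (f - f') * g + f' * (g - g').
  by rewrite mulrBl mulrBr addrA subrK.
by apply: ncordD; [rewrite -addn1|rewrite -add1n]; exact: ncordM.
Qed.

Lemma nceq_lie n f f' g g' : nceq n f f' -> nceq n g g' -> nceq n (lie f g) (lie f' g').
Proof. by move=> ff gg; apply: nceqB; apply: nceqM. Qed.

Lemma nceq_lieS n f f' g g' : ncord 1 f -> ncord 1 f' -> ncord 1 g -> ncord 1 g' ->
  nceq n f f' -> nceq n g g' -> nceq n.+1 (lie f g) (lie f' g').
Proof. by move=> f1 f1' g1 g1' ff gg; apply: nceqB; apply: nceqMS. Qed.

Lemma ncsum_nceq u n m : (forall k, ncord k (u k)) -> (n <= m)%N ->
  nceq n (ncsum u) (\sum_(k < m) u k).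
Proof.
move=> ou nm; apply/nceqP => w wn /=; rewrite nccoef_sum.
have wm : ((size w).+1 <= m)%N by apply: leq_trans nm.
rewrite (big_ord_widen m (fun k => nccoef (u k) w) wm) big_mkcond /=.
by apply: eq_bigr => k _; case: ltnP => // wk; have [->] := ou k.
Qed.

Lemma nccoef_ncsum u m w : (forall k, ncord k (u k)) -> (size w < m)%N ->
  nccoef (ncsum u) w = \sum_(k < m) nccoef (u k) w.
Proof.
move=> ou wm; rewrite -nccoef_sum; move: w wm; apply/nceqP.
exact: ncsum_nceq.
Qed.

Lemma eq_ncsum u v : u =1 v -> ncsum u = ncsum v.
Proof. by move=> uv; congr ncsum; apply/funext. Qed.

Lemma ncsumD u v : ncsum u + ncsum v = ncsum (fun n => u n + v n).
Proof. by apply: ncseriesP => w /=; rewrite -big_split. Qed.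
Lemma ncsumZ c u : c *: ncsum u = ncsum (fun n => c *: u n).
Proof. by apply: ncseriesP => w /=; rewrite mulr_sumr. Qed.
Lemma ncsumN u : - ncsum u = ncsum (fun n => - u n).
Proof. by apply: ncseriesP => w /=; rewrite sumrN. Qed.

Lemma ncsum_mull f u : (forall k, ncord k (u k)) ->
  f * ncsum u = ncsum (fun n => f * u n).
Proof.
move=> ou; apply: nceq_eq => n.
apply: (@nceq_trans _ _ (\sum_(k < n) f * u k)); last first.
  by apply: nceq_sym; apply: ncsum_nceq => // k; apply: ncordMr.
rewrite -mulr_sumr; apply: nceqM; first exact: nceq_refl.
exact: ncsum_nceq.
Qed.

Lemma ncsum_mulr f u : (forall k, ncord k (u k)) ->
  ncsum u * f = ncsum (fun n => u n * f).
Proof.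
move=> ou; apply: nceq_eq => n.
apply: (@nceq_trans _ _ (\sum_(k < n) u k * f)); last first.
  by apply: nceq_sym; apply: ncsum_nceq => // k; apply: ncordMl.
rewrite -mulr_suml; apply: nceqM; last exact: nceq_refl.
exact: ncsum_nceq.
Qed.

Lemma ncsum_recl u : (forall k, ncord k (u k)) ->
  ncsum u = u 0%N + ncsum (fun n => u n.+1).
Proof.
move=> ou; apply: nceq_eq => n.
apply: nceq_trans (ncsum_nceq ou (leqnSn n)) _.
rewrite big_ord_recl; apply: nceqD; first exact: nceq_refl.
by apply: nceq_sym; apply: ncsum_nceq => // k; apply: ncord_leq (ou _).
Qed.

Lemma ncsum_fin m u : (forall k, (m <= k)%N -> u k = 0) ->
  (forall k, ncord k (u k)) -> ncsum u = \sum_(k < m) u k.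
Proof.
move=> u0 ou; apply: nceq_eq => n.
have -> : \sum_(k < m) u k = \sum_(k < n + m) u k.
  rewrite (big_ord_widen (n + m) u) ?leq_addl // big_mkcond.
  by apply: eq_bigr => k _; case: ltnP => // /u0.
exact: ncsum_nceq ou (leq_addr _ _).
Qed.

Lemma ncord_1B f : nccoef f [::] = 1 -> ncord 1 (1 - f).
Proof. by move=> f1; apply/ncord1P; rewrite nccoefB f1 subrr. Qed.

Lemma ncinv_ord f k : nccoef f [::] = 1 -> ncord k ((1 - f) ^+ k).
Proof. by move=> f1; apply/ncordX/ncord_1B. Qed.

Lemma ncmulVx f : nccoef f [::] = 1 -> ncinv f * f = 1.
Proof.
move=> f1; apply: nceq_eq => n.
have oV k : ncord k ((1 - f) ^+ k) by exact: ncinv_ord.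
apply: (@nceq_trans _ _ ((\sum_(k < n) (1 - f) ^+ k) * f)).
  by apply: nceqM; last exact: nceq_refl; apply: ncsum_nceq.
(* With f written through 1 - f, the truncated geometric series telescopes and the error is (1 -
   f)^n. *)
have fE : f = - ((1 - f) - 1) by rewrite opprB opprB addrC subrK.
rewrite {2}fE mulrN.
have -> : (\sum_(k < n) (1 - f) ^+ k) * (1 - f - 1) =
  (1 - f - 1) * (\sum_(k < n) (1 - f) ^+ k).
  rewrite mulr_suml mulr_sumr; apply: eq_bigr => k _.
  by rewrite mulrBl mulrBr -exprS -exprSr mul1r mulr1.
rewrite -subrX1 /nceq opprB addrC addrA addNr sub0r.
exact/ncordN/ncinv_ord.
Qed.

Lemma ncmulxV f : nccoef f [::] = 1 -> f * ncinv f = 1.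
Proof.
move=> f1; rewrite -[RHS](ncmulVx f1) /ncinv.
rewrite ncsum_mull ?ncsum_mulr; [|by move=> k; exact: ncinv_ord..].
apply: eq_ncsum => k.
have fE : f = 1 - (1 - f) by rewrite opprB addrC subrK.
by rewrite {1 4}fE mulrBl mulrBr -exprS -exprSr mul1r mulr1.
Qed.

Lemma ncinv_nil f : nccoef (ncinv f) [::] = 1.
Proof. by rewrite /= big_ord_recl big_ord0 addr0 expr0. Qed.

Lemma ncinv_uniq f g : nccoef f [::] = 1 -> f * g = 1 -> g = ncinv f.
Proof. by move=> f1 fg; rewrite -[g]mul1r -(ncmulVx f1) -mulrA fg mulr1. Qed.

(** Stripping the first or last letter. [ncL] follows the recursion of [shuffle], and the product
    rule of [ncR] is the source of the Fox calculus. *)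
Definition ncL x f := NCSeries (fun w => nccoef f (x :: w)).
Definition ncR x f := NCSeries (fun w => nccoef f (rcons w x)).

Lemma ncLM x f g : ncL x (f * g) = nccoef f [::] *: ncL x g + ncL x f * g.
Proof.
by apply: ncseriesP => w; rewrite /= big_ord_recl.
Qed.

Lemma ncRM x f g : ncR x (f * g) = f * ncR x g + nccoef g [::] *: ncR x f.
Proof.
apply: ncseriesP => w; rewrite /= size_rcons big_ord_recr /=; congr (_ + _).
  apply: eq_bigr => i _; have iw : (i <= size w)%N by rewrite -ltnS.
  by rewrite drop_rcons // -cats1 takel_cat.
by rewrite mulrC -[X in take X](size_rcons w x) take_size -(size_rcons w x) drop_size.
Qed.

Lemma ncLD x f g : ncL x (f + g) = ncL x f + ncL x g.
Proof. by []. Qed.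
Lemma ncLZ x c f : ncL x (c *: f) = c *: ncL x f.
Proof. by []. Qed.
Lemma ncL_letter x y : ncL x (letter K y) = (x == y)%:R.
Proof.
apply: ncseriesP => w /=; rewrite eqseq_cons.
by case: eqP => //= _; rewrite nccoef0.
Qed.
Lemma ncR_letter x y : ncR x (letter K y) = (x == y)%:R.
Proof.
apply: ncseriesP => w /=; rewrite -[[:: y]]/(rcons [::] y) eqseq_rcons andbC.
by case: eqP => //= _; rewrite nccoef0.
Qed.
Lemma ncL_letterM x y f : ncL x (letter K y * f) = if x == y then f else 0.
Proof. by rewrite ncLM scale0r add0r ncL_letter; case: eqP; rewrite ?mul1r ?mul0r. Qed.

End Truncation.

(** Shuffles are listed with multiplicity, so sums over the list carry the binomial coefficients. *)
Fixpoint shuffle (T : Type) (u v : seq T) : seq (seq T) :=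
  if u is x :: u' then
    (fix shuffle_u v := if v is y :: v' then
       map (cons x) (shuffle u' v) ++ map (cons y) (shuffle_u v')
     else [:: u]) v
  else [:: v].

Lemma shuffles0 (T : Type) (u : seq T) : shuffle u [::] = [:: u].
Proof. by case: u. Qed.

Lemma shuffle_cons (T : Type) x y (u v : seq T) : shuffle (x :: u) (y :: v) =
  map (cons x) (shuffle u (y :: v)) ++ map (cons y) (shuffle (x :: u) v).
Proof. by []. Qed.

Lemma size_shuffle (T : eqType) (u v w : seq T) :
  w \in shuffle u v -> size w = (size u + size v)%N.
Proof.
elim: u v w => [|x u IHu] v w; first by rewrite inE => /eqP ->.
elim: v w => [|y v IHv] w; first by rewrite inE => /eqP ->; rewrite addn0.
rewrite shuffle_cons mem_cat => /orP[] /mapP[w' w'uv ->] /=.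
  by rewrite (IHu _ _ w'uv).
by rewrite (IHv _ w'uv) /= addnS.
Qed.

(** * Shuffles and group-like series *)

Section Shuffle.
Variable K : comNzRingType.
Implicit Types (f g h : ncseries K).

Definition sh f (u v : seq bool) : K := \sum_(w <- shuffle u v) nccoef f w.

Lemma sh0s f v : sh f [::] v = nccoef f v.
Proof. by rewrite /sh big_seq1. Qed.
Lemma shs0 f u : sh f u [::] = nccoef f u.
Proof. by rewrite /sh shuffles0 big_seq1. Qed.
Lemma sh_cons f x y u v :
  sh f (x :: u) (y :: v) = sh (ncL x f) u (y :: v) + sh (ncL y f) (x :: u) v.
Proof. by rewrite /sh shuffle_cons big_cat !big_map. Qed.
Lemma shD f g u v : sh (f + g) u v = sh f u v + sh g u v.
Proof. by rewrite /sh -big_split. Qed.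
Lemma shZ c f u v : sh (c *: f) u v = c * sh f u v.
Proof. by rewrite /sh mulr_sumr. Qed.
Lemma shN f u v : sh (- f) u v = - sh f u v.
Proof. by rewrite /sh -sumrN. Qed.
Lemma sh_nceq n f g u v : (size u + size v < n)%N -> nceq n f g -> sh f u v = sh g u v.
Proof.
move=> uvn fg; rewrite /sh; apply: eq_big_seq => w /size_shuffle wE.
by apply: (nceqP _ _ _).2 fg _ _; rewrite wE.
Qed.

(* The shuffle coproduct, dual to [sh], is multiplicative for the concatenation product. *)
Lemma shM f g u v : sh (f * g) u v =
  \sum_(i < (size u).+1) \sum_(j < (size v).+1)
     sh f (take i u) (take j v) * sh g (drop i u) (drop j v).
Proof.
have [n] := ubnP (size u + size v); elim: n => // n IHn in f u v *; rewrite ltnS => uvn.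
case: u v uvn => [|x u] [|y v] uvn.
- by rewrite !big_ord_recl !big_ord0 /= !addr0 !sh0s nccoefM_nil.
- by rewrite big_ord_recl big_ord0 addr0 sh0s; apply: eq_bigr => j _; rewrite !sh0s.
- by rewrite shs0; apply: eq_bigr => i _; rewrite big_ord_recl big_ord0 addr0 /= !shs0.
rewrite sh_cons !ncLM !shD !shZ.
rewrite (IHn _ u (y :: v)) // (IHn _ (x :: u) v); last by rewrite /= addnS in uvn *.
rewrite addrACA -mulrDr -sh_cons -/(size _) /=.
rewrite [RHS]big_ord_recl [X in _ = X + _]big_ord_recl /=.
rewrite sh0s -addrA; congr (_ + _).
rewrite [X in _ + X = _]big_ord_recl addrCA; congr (_ + _).
  by apply: eq_bigr => j _; rewrite /= !sh0s add0n.
rewrite -big_split; apply: eq_bigr => i _ /=.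
rewrite add0n [in LHS]big_ord_recl [RHS]big_ord_recl /= -addrA; congr (_ + _).
  by rewrite !shs0.
rewrite -big_split; apply: eq_bigr => j _ /=.
by rewrite add0n sh_cons mulrDl.
Qed.

End Shuffle.

Section GroupLike.
Variable K : comNzRingType.
Implicit Types f g h : ncseries K.

Definition glike f :=
  nccoef f [::] = 1 /\ forall u v, sh f u v = nccoef f u * nccoef f v.

Definition shdef f u v := sh f u v - nccoef f u * nccoef f v.

Lemma sh1 u v : sh (1 : ncseries K) u v = ((u == [::]) && (v == [::]))%:R.
Proof.
have L1 x : ncL x (1 : ncseries K) = 0 by apply: ncseriesP.
have sh0 u' v' : sh (0 : ncseries K) u' v' = 0 by rewrite /sh big1.
case: u v => [|x u] [|y v]; rewrite ?sh0s ?shs0 //.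
by rewrite sh_cons !L1 !sh0 addr0.
Qed.

Lemma glike1 : glike (1 : ncseries K).
Proof. by split=> // u v; rewrite sh1 !nccoef1 -natrM mulnb. Qed.

Lemma shdefM f g u v : shdef (f * g) u v =
  \sum_(i < (size u).+1) \sum_(j < (size v).+1)
    (sh f (take i u) (take j v) * sh g (drop i u) (drop j v) -
     (nccoef f (take i u) * nccoef f (take j v)) *
     (nccoef g (drop i u) * nccoef g (drop j v))).
Proof.
rewrite /shdef shM !nccoefM big_distrlr /= -sumrB; apply: eq_bigr => i _.
by rewrite -sumrB; apply: eq_bigr => j _; rewrite mulrACA.
Qed.

Lemma glike_nil f : glike f -> nccoef f [::] = 1. Proof. by case. Qed.

(** Every proper splitting of u and v involves a defect of f at a smaller total length, which
    vanishes. Thus a correcting factor can be attached to a solution before a limit is taken. *)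
Lemma shdef_mulr f g u v : glike g ->
  (forall u' v', (size u' + size v' < size u + size v)%N -> shdef f u' v' = 0) ->
  shdef (f * g) u v = shdef f u v.
Proof.
move=> [g1 gg] IH.
transitivity (\sum_(i < (size u).+1) \sum_(j < (size v).+1)
    shdef f (take i u) (take j v) * (nccoef g (drop i u) * nccoef g (drop j v))).
  rewrite shdefM; apply: eq_bigr => i _; apply: eq_bigr => j _.
  by rewrite gg -mulrBl.
rewrite big_ord_recr /= big1 ?add0r; last first.
  move=> i _; rewrite big1 // => j _; rewrite IH ?mul0r // !size_take_min.
  by rewrite -addSn leq_add ?geq_minr // (minn_idPl _) // ltnW.
rewrite big_ord_recr /= big1 ?add0r; last first.
  move=> j _; rewrite IH ?mul0r // !size_take_min minnn.
  by rewrite -addnS leq_add // (minn_idPl _) // ltnW.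
by rewrite !take_size !drop_size g1 !mulr1.
Qed.

Lemma shdef_mull f g u v : glike f ->
  (forall u' v', (size u' + size v' < size u + size v)%N -> shdef g u' v' = 0) ->
  shdef (f * g) u v = shdef g u v.
Proof.
move=> [f1 ff] IH.
transitivity (\sum_(i < (size u).+1) \sum_(j < (size v).+1)
    (nccoef f (take i u) * nccoef f (take j v)) * shdef g (drop i u) (drop j v)).
  rewrite shdefM; apply: eq_bigr => i _; apply: eq_bigr => j _.
  by rewrite ff -mulrBr.
rewrite big_ord_recl /= [X in _ + X]big1 ?addr0; last first.
  move=> i _; rewrite big1 // => j _; rewrite IH ?mulr0 // !size_drop.
  by have := ltn_ord i; rewrite /bump /=; lia.
rewrite big_ord_recl /= [X in _ + X]big1 ?addr0; last first.
  move=> j _; rewrite IH ?mulr0 // !size_drop.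
  by have := ltn_ord j; rewrite /bump /=; lia.
by rewrite !take0 !drop0 f1 !mul1r.
Qed.

(** Applied to G_1 Phi = G_0, this transfers group-likeness from the two solutions to Phi. *)
Lemma glike_cancel f g : nccoef g [::] = 1 -> glike f -> glike (f * g) -> glike g.
Proof.
move=> g1 gf [_ fg]; split=> // u v.
have [n] := ubnP (size u + size v); elim: n => // n IHn in u v *; rewrite ltnS => uvn.
apply/eqP; rewrite -subr_eq0 -/(shdef g u v) -(@shdef_mull f) //.
  by rewrite /shdef fg subrr.
by move=> u' v' lt; apply/eqP; rewrite subr_eq0 IHn //; apply: leq_trans uvn.
Qed.

(* Dual of "x_0^m sh x_0^n = C(m+n,m) x_0^(m+n)" for an arbitrary sequence of coefficients. *)
Lemma sh_power x (c : nat -> K) u v :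
  let f := NCSeries (fun w => if all (pred1 x) w then c (size w) else 0) in
  sh f u v = if all (pred1 x) u && all (pred1 x) v then
      c (size u + size v)%N *+ 'C(size u + size v, size u) else 0.
Proof.
have [n] := ubnP (size u + size v); elim: n => // n IHn in c u v *; rewrite ltnS => uvn.
case: u v uvn => [|y u] [|z v] uvn f.
- by rewrite sh0s bin0.
- by rewrite sh0s add0n bin0.
- by rewrite shs0 andbT addn0 binn.
have L w : ncL w f = if w == x then
    NCSeries (fun w => if all (pred1 x) w then c (size w).+1 else 0) else 0.
  by case: eqP => [->|/eqP/negPf wx]; apply: ncseriesP => s; rewrite /= ?eqxx ?wx.
have sh0 u' v' : sh (0 : ncseries K) u' v' = 0 by rewrite /sh big1.
have IH1 u' v' : (size u' + size v' < n)%N -> _ := IHn (fun n => c n.+1) u' v'.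
have uv1 : (size u + (size v).+1 < n)%N by move: uvn => /=; lia.
have uv2 : ((size u).+1 + size v < n)%N by move: uvn => /=; lia.
rewrite sh_cons !L /=.
have [->|yx] := eqVneq y x; have [->|zx] := eqVneq z x; rewrite ?sh0 ?addr0 ?add0r ?andbF //.
- rewrite !IH1 //= eqxx /=; case: ifP => // _; last by rewrite addr0.
  rewrite !addnS !addSn -mulrnDr [in RHS]binS. congr (_ *+ _); exact: addnC.
- by rewrite IH1 //= (negPf zx) andbF.
- by rewrite IH1 //= (negPf yx).
Qed.

End GroupLike.

(** * Power series in one and two commuting variables *)

Section Fps.
Variable K : comNzRingType.
Implicit Types f g : {fps K}.

Lemma fpscoefD f g n : fpscoef (f + g) n = fpscoef f n + fpscoef g n.
Proof. by []. Qed.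
Lemma fpscoefN f n : fpscoef (- f) n = - fpscoef f n.
Proof. by []. Qed.
Lemma fpscoef1 n : fpscoef (1 : {fps K}) n = (n == 0%N)%:R.
Proof. by []. Qed.
Lemma fpscoefM f g n :
  fpscoef (f * g) n = \sum_(i < n.+1) fpscoef f i * fpscoef g (n - i).
Proof. by []. Qed.
Lemma fpscoef_sum (I : Type) (r : seq I) (P : pred I) (F : I -> {fps K}) n :
  fpscoef (\sum_(i <- r | P i) F i) n = \sum_(i <- r | P i) fpscoef (F i) n.
Proof. exact: (big_morph (fun f => fpscoef f n)). Qed.

Lemma fpscoefCM c f n : fpscoef (fpsC c * f) n = c * fpscoef f n.
Proof.
by rewrite fpscoefM big_ord_recl /= subn0 big1 ?addr0 // => i _; rewrite mul0r.
Qed.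
Lemma fpscoefXM f n :
  fpscoef (fpsX * f) n = if n is m.+1 then fpscoef f m else 0.
Proof.
rewrite fpscoefM; case: n => [|n]; first by rewrite big_ord_recl big_ord0 /= mul0r addr0.
rewrite big_ord_recl /= mul0r add0r big_ord_recl /= mul1r subSS subn0.
by rewrite big1 ?addr0 // => i _; rewrite mul0r.
Qed.

Lemma fpsC0 : fpsC 0 = 0 :> {fps K}.
Proof. by apply: fpsP => n /=; case: eqP. Qed.
Lemma fpsC1 : fpsC 1 = 1 :> {fps K}.
Proof. by apply: fpsP => n; rewrite fpscoef1 /=; case: eqP. Qed.
Lemma fpsCD a b : fpsC (a + b) = fpsC a + fpsC b :> {fps K}.
Proof. by apply: fpsP => n; rewrite fpscoefD /=; case: eqP; rewrite ?addr0. Qed.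
Lemma fpsCN a : fpsC (- a) = - fpsC a :> {fps K}.
Proof. by apply: fpsP => n; rewrite fpscoefN /=; case: eqP; rewrite ?oppr0. Qed.
Lemma fpsCM a b : fpsC (a * b) = fpsC a * fpsC b :> {fps K}.
Proof. by apply: fpsP => n; rewrite fpscoefCM /=; case: eqP; rewrite ?mulr0. Qed.

End Fps.

Section TwoVariableSeries.
Variable K : comNzRingType.
Implicit Types (f g : {fps {fps K}}) (h : {fps K}).

Lemma UVP f g : (forall k l, coefUV f k l = coefUV g k l) -> f = g.
Proof. by move=> fg; apply: fpsP => k; apply: fpsP => l; apply: fg. Qed.
Lemma coefUVD f g k l : coefUV (f + g) k l = coefUV f k l + coefUV g k l.
Proof. by []. Qed.
Lemma coefUVN f k l : coefUV (- f) k l = - coefUV f k l.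
Proof. by []. Qed.
Lemma coefUV0 k l : coefUV (0 : {fps {fps K}}) k l = 0.
Proof. by []. Qed.
Lemma coefUV1 k l : coefUV (1 : {fps {fps K}}) k l = ((k == 0%N) && (l == 0%N))%:R.
Proof. by rewrite /coefUV fpscoef1; case: eqP. Qed.
Lemma coefUV_sum (I : Type) (r : seq I) (P : pred I) (F : I -> {fps {fps K}}) k l :
  coefUV (\sum_(i <- r | P i) F i) k l = \sum_(i <- r | P i) coefUV (F i) k l.
Proof. exact: (big_morph (fun f => coefUV f k l)). Qed.
Lemma coefUVM f g k l : coefUV (f * g) k l =
  \sum_(i < k.+1) \sum_(j < l.+1) coefUV f i j * coefUV g (k - i) (l - j).
Proof. by rewrite /coefUV fpscoefM fpscoef_sum. Qed.

Lemma inV1 : inV 1 = 1 :> {fps {fps K}}. Proof. exact: fpsC1. Qed.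
Lemma inVD h h' : inV (h + h') = inV h + inV h'. Proof. exact: fpsCD. Qed.
Lemma inVN h : inV (- h) = - inV h. Proof. exact: fpsCN. Qed.
Lemma inVM h h' : inV (h * h') = inV h * inV h'. Proof. exact: fpsCM. Qed.
Lemma inVC (c : K) : inV (fpsC c) = constUV c. Proof. by []. Qed.

Lemma inU1 : inU 1 = 1 :> {fps {fps K}}.
Proof. by apply: fpsP => k; rewrite fpscoef1 /=; case: eqP; rewrite ?fpsC1 ?fpsC0. Qed.
Lemma inUD h h' : inU (h + h') = inU h + inU h'.
Proof. by apply: fpsP => k; rewrite fpscoefD /= fpsCD. Qed.
Lemma inUN h : inU (- h) = - inU h.
Proof. by apply: fpsP => k; rewrite fpscoefN /= fpsCN. Qed.
Lemma inUM h h' : inU (h * h') = inU h * inU h'.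
Proof.
apply: fpsP => k; rewrite fpscoefM /=.
by rewrite (big_morph _ (@fpsCD K) (@fpsC0 K)); apply: eq_bigr => i _; rewrite fpsCM.
Qed.
Lemma inUC (c : K) : inU (fpsC c) = constUV c.
Proof. by apply: fpsP => k /=; case: eqP => // _; rewrite fpsC0. Qed.

Lemma constUV0 : constUV 0 = 0 :> {fps {fps K}}. Proof. by rewrite /constUV !fpsC0. Qed.
Lemma constUV1 : constUV 1 = 1 :> {fps {fps K}}. Proof. by rewrite /constUV !fpsC1. Qed.
Lemma constUVD (a b : K) : constUV (a + b) = constUV a + constUV b.
Proof. by rewrite /constUV !fpsCD. Qed.
Lemma constUVN (a : K) : constUV (- a) = - constUV a.
Proof. by rewrite /constUV !fpsCN. Qed.
Lemma constUVM (a b : K) : constUV (a * b) = constUV a * constUV b.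
Proof. by rewrite /constUV !fpsCM. Qed.

Lemma coefUV_constM c f k l : coefUV (constUV c * f) k l = c * coefUV f k l.
Proof. by rewrite /coefUV !fpscoefCM. Qed.
Lemma coefUV_UM f k l :
  coefUV (varU K * f) k l = if k is k'.+1 then coefUV f k' l else 0.
Proof.
have -> : varU K = fpsX.
  by apply: fpsP => -[|[|n]]; rewrite /= ?fpsC0 ?fpsC1.
by rewrite /coefUV fpscoefXM; case: k.
Qed.
Lemma coefUV_VM f k l :
  coefUV (varV K * f) k l = if l is l'.+1 then coefUV f k l' else 0.
Proof. by rewrite /coefUV /varV /inV fpscoefCM fpscoefXM. Qed.
Lemma coefUV_inU h k l : coefUV (inU h) k l = if l == 0%N then fpscoef h k else 0.
Proof. by []. Qed.
Lemma coefUV_inV h k l : coefUV (inV h) k l = if k == 0%N then fpscoef h l else 0.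
Proof. by rewrite /coefUV /=; case: eqP. Qed.
Lemma coefUV_const (c : K) k l :
  coefUV (constUV c) k l = if (k == 0%N) && (l == 0%N) then c else 0.
Proof. by rewrite /constUV coefUV_inV; case: eqP. Qed.
Lemma coefUV_U k l : coefUV (varU K) k l = ((k == 1%N) && (l == 0%N))%:R.
Proof. by rewrite -[varU K]mulr1 coefUV_UM; case: k => // k; rewrite coefUV1. Qed.
Lemma coefUV_V k l : coefUV (varV K) k l = ((k == 0%N) && (l == 1%N))%:R.
Proof. by rewrite -[varV K]mulr1 coefUV_VM; case: l => [|l]; rewrite ?andbF // coefUV1. Qed.

Lemma varU_inj f g : varU K * f = varU K * g -> f = g.
Proof.
move=> fg; apply: UVP => k l.
by have := congr1 (fun f => coefUV f k.+1 l) fg; rewrite !coefUV_UM.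
Qed.

Lemma coefUVX_small f n k l : coefUV f 0 0 = 0 -> (k + l < n)%N -> coefUV (f ^+ n) k l = 0.
Proof.
move=> f0; elim: n k l => // n IHn k l kln; rewrite exprS coefUVM.
rewrite big1 // => i _; rewrite big1 // => j _.
case: (eqVneq (i + j)%N 0%N) => ij.
  by move: ij; case: (i : nat) => //; case: (j : nat) => // _; rewrite f0 mul0r.
rewrite IHn ?mulr0 //; have := ltn_ord i; have := ltn_ord j; lia.
Qed.

End TwoVariableSeries.

(** * Abelianisation and Fox derivative *)

Section FoxDerivative.
Variable K : comNzRingType.
Implicit Types (f g : ncseries K).
Local Notation a := (letter K false).
Local Notation b := (letter K true).
Local Notation U := (varU K).
Local Notation V := (varV K).

(* The coefficient of U^k V^l sums the coefficients of the words with k letters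
   a and l letters b, which are exactly the shuffles of a^k and b^l. *)
Definition abel f : {fps {fps K}} :=
  FPS (fun k => FPS (fun l => sh f (nseq k false) (nseq l true))).

(* [fox] is the entry (1,2) of the Magnus representation a |-> [[U,0],[0,0]], b |-> [[V,1],[0,0]],
   whose entry (1,1) is [abel]. *)
Definition fox f : {fps {fps K}} := abel (ncR true f).

Lemma coef_abel f k l : coefUV (abel f) k l = sh f (nseq k false) (nseq l true).
Proof. by []. Qed.

Lemma abelD f g : abel (f + g) = abel f + abel g.
Proof. by apply: UVP => k l; rewrite coefUVD !coef_abel shD. Qed.
Lemma abelN f : abel (- f) = - abel f.
Proof. by apply: UVP => k l; rewrite coefUVN !coef_abel shN. Qed.
Lemma abelB f g : abel (f - g) = abel f - abel g.
Proof. by rewrite abelD abelN. Qed.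
Lemma abelZ c f : abel (c *: f) = constUV c * abel f.
Proof. by apply: UVP => k l; rewrite coefUV_constM !coef_abel shZ. Qed.
Lemma abel1 : abel 1 = 1.
Proof. by apply: UVP => k l; rewrite coef_abel sh1 coefUV1; case: k; case: l. Qed.
Lemma abel0 : abel 0 = 0.
Proof. by rewrite -(subrr 1) abelB subrr. Qed.
Lemma abelM f g : abel (f * g) = abel f * abel g.
Proof.
apply: UVP => k l; rewrite coefUVM coef_abel shM !size_nseq.
apply: eq_bigr => i _; apply: eq_bigr => j _.
have ik : (i <= k)%N by rewrite -ltnS.
have jl : (j <= l)%N by rewrite -ltnS.
by rewrite !take_nseq // !drop_nseq.
Qed.
Lemma abelX f n : abel (f ^+ n) = abel f ^+ n.
Proof. by elim: n => [|n IHn]; rewrite ?abel1 // !exprS abelM IHn. Qed.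
Lemma abel_sum (I : Type) (r : seq I) (P : pred I) (F : I -> ncseries K) :
  abel (\sum_(i <- r | P i) F i) = \sum_(i <- r | P i) abel (F i).
Proof. by apply: big_morph; [exact: abelD|exact: abel0]. Qed.
Lemma abel_lie f g : abel (lie f g) = 0.
Proof. by rewrite abelB !abelM mulrC subrr. Qed.
Lemma abel_nceq n f g k l : (k + l < n)%N -> nceq n f g ->
  coefUV (abel f) k l = coefUV (abel g) k l.
Proof. by move=> kln fg; rewrite !coef_abel (sh_nceq _ fg) // !size_nseq. Qed.

Lemma abel_ncL f : abel f = constUV (nccoef f [::]) + U * abel (ncL false f) + V * abel (ncL true f).
Proof.
apply: UVP => k l; rewrite !coefUVD coefUV_UM coefUV_VM coefUV_const.
case: k l => [|k] [|l]; rewrite /= !coef_abel /= ?sh0s ?shs0 ?add0r ?addr0 //.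
by rewrite sh_cons.
Qed.

Lemma abel_letter x : abel (letter K x) = if x then V else U.
Proof.
by rewrite abel_ncL !ncL_letter; case: x; rewrite /= constUV0 abel0 abel1 mulr0 !mulr1 !add0r ?addr0.
Qed.

Lemma ncRD x f g : ncR x (f + g) = ncR x f + ncR x g.
Proof. by []. Qed.
Lemma ncRZ x c f : ncR x (c *: f) = c *: ncR x f.
Proof. by []. Qed.
Lemma ncR_nceq x n f g : nceq n.+1 f g -> nceq n (ncR x f) (ncR x g).
Proof.
move=> /nceqP fg; apply/nceqP => w wn; apply: fg.
by rewrite size_rcons ltnS.
Qed.

Lemma foxD f g : fox (f + g) = fox f + fox g.
Proof. by rewrite /fox ncRD abelD. Qed.
Lemma foxN f : fox (- f) = - fox f.
Proof. by rewrite /fox -abelN. Qed.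
Lemma foxB f g : fox (f - g) = fox f - fox g.
Proof. by rewrite foxD foxN. Qed.
Lemma foxZ c f : fox (c *: f) = constUV c * fox f.
Proof. by rewrite /fox ncRZ abelZ. Qed.
Lemma fox1 : fox 1 = 0.
Proof.
rewrite /fox -abel0; congr abel; apply: ncseriesP => w /=.
by case: w.
Qed.
Lemma fox0 : fox 0 = 0.
Proof. by rewrite -(subrr 1) foxB subrr. Qed.
Lemma foxM f g : fox (f * g) = abel f * fox g + constUV (nccoef g [::]) * fox f.
Proof. by rewrite /fox ncRM abelD abelM abelZ. Qed.
Lemma fox_sum (I : Type) (r : seq I) (P : pred I) (F : I -> ncseries K) :
  fox (\sum_(i <- r | P i) F i) = \sum_(i <- r | P i) fox (F i).
Proof. by apply: big_morph; [exact: foxD|exact: fox0]. Qed.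
Lemma fox_letter x : fox (letter K x) = x%:R.
Proof. by rewrite /fox ncR_letter; case: x; rewrite ?abel1 ?abel0. Qed.
(** One degree more than for [abel] is required, as [fox] strips a letter. *)
Lemma fox_nceq n f g k l : (k + l < n)%N -> nceq n.+1 f g ->
  coefUV (fox f) k l = coefUV (fox g) k l.
Proof. by move=> kln /(ncR_nceq true); apply: abel_nceq. Qed.
Lemma foxXS f n : nccoef f [::] = 0 -> fox (f ^+ n.+1) = abel f ^+ n * fox f.
Proof.
move=> f0; elim: n => [|n IHn]; first by rewrite expr1 mul1r.
by rewrite exprS foxM IHn nccoefX_nil f0 expr0n constUV0 mul0r addr0 mulrA -exprS.
Qed.
Lemma fox_lie f g : nccoef f [::] = 0 -> nccoef g [::] = 0 ->
  fox (lie f g) = abel f * fox g - abel g * fox f.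
Proof. by move=> f0 g0; rewrite foxB !foxM f0 g0 constUV0 !mul0r !addr0. Qed.

End FoxDerivative.

(** * Brackets, closed Lie ideals and the derived series *)

Section LieStructure.
Variable K : comNzRingType.
Implicit Types (f g h x : ncseries K) (F G : {fps {fps K}}) (P : set (ncseries K)).
Local Notation a := (letter K false).
Local Notation b := (letter K true).
Local Notation U := (varU K).
Local Notation V := (varV K).

Lemma lieDl f g h : lie (f + g) h = lie f h + lie g h.
Proof. by rewrite /lie mulrDl mulrDr opprD addrACA. Qed.
Lemma lieDr f g h : lie f (g + h) = lie f g + lie f h.
Proof. by rewrite /lie mulrDl mulrDr opprD addrACA. Qed.
Lemma lieNl f g : lie (- f) g = - lie f g.
Proof. by rewrite /lie mulNr mulrN opprD. Qed.
Lemma lieNr f g : lie f (- g) = - lie f g.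
Proof. by rewrite /lie mulNr mulrN opprD. Qed.
Lemma lieZl c f g : lie (c *: f) g = c *: lie f g.
Proof. by rewrite /lie -scalerAl -scalerAr scalerBr. Qed.
Lemma lieZr c f g : lie f (c *: g) = c *: lie f g.
Proof. by rewrite /lie -scalerAl -scalerAr scalerBr. Qed.
Lemma lieC f g : lie f g = - lie g f.
Proof. by rewrite /lie opprB. Qed.
Lemma lief0 f : lie f 0 = 0.
Proof. by rewrite /lie mulr0 mul0r subrr. Qed.
Lemma lieff f : lie f f = 0.
Proof. exact: subrr. Qed.
Lemma lie_jacobi x f g : lie x (lie f g) = lie (lie x f) g + lie f (lie x g).
Proof.
rewrite /lie !mulrBl !mulrBr !mulrA; apply: ncseriesP => w.
by rewrite !(nccoefD, nccoefN); ring.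
Qed.
Lemma lie_sumr (I : Type) (r : seq I) (Q : pred I) (E : I -> ncseries K) f :
  lie f (\sum_(i <- r | Q i) E i) = \sum_(i <- r | Q i) lie f (E i).
Proof. by rewrite /lie mulr_sumr mulr_suml -sumrB. Qed.
Lemma lie_ncsumr f (u : nat -> ncseries K) : (forall k, ncord k (u k)) ->
  lie f (ncsum u) = ncsum (fun n => lie f (u n)).
Proof. by move=> ou; rewrite /lie ncsum_mull // ncsum_mulr // ncsumN ncsumD. Qed.
Lemma lie_nil f g : nccoef (lie f g) [::] = 0.
Proof. by rewrite nccoefB !nccoefM_nil mulrC subrr. Qed.

Lemma lieE f g : lie f g = f * g - g * f.
Proof. by []. Qed.

Local Opaque lie.

Lemma degree_closureP P f :
  degree_closure P f <-> forall n, exists2 g, P g & nceq n f g.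
Proof. by split=> Pf n; case: (Pf n) => g Pg /nceqP; exists g. Qed.

Lemma sub_degree_closure P f : P f -> degree_closure P f.
Proof. by move=> Pf; apply/degree_closureP => n; exists f => //; apply: nceq_refl. Qed.

(** Idempotence of the closure: approximants need only be limits themselves. *)
Lemma degree_closure_limit P f :
  (forall n, exists2 g, degree_closure P g & nceq n f g) -> degree_closure P f.
Proof.
move=> Pf; apply/degree_closureP => n; case: (Pf n) => g /degree_closureP/(_ n)[h Ph gh] fg.
by exists h => //; apply: nceq_trans gh.
Qed.

Section Submodule.
Variable P : set (ncseries K).
Hypothesis PD : forall f g, P f -> P g -> P (f + g).
Hypothesis PZ : forall c f, P f -> P (c *: f).
Hypothesis P0 : P 0.

Lemma degree_closureD f g : degree_closure P f -> degree_closure P g -> degree_closure P (f + g).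
Proof.
move=> /degree_closureP Pf /degree_closureP Pg; apply/degree_closureP => n.
case: (Pf n) (Pg n) => f' Pf' ff' [g' Pg' gg'].
by exists (f' + g'); [exact: PD|exact: nceqD].
Qed.
Lemma degree_closureZ c f : degree_closure P f -> degree_closure P (c *: f).
Proof.
move=> /degree_closureP Pf; apply/degree_closureP => n.
by case: (Pf n) => f' Pf' ff'; exists (c *: f'); [exact: PZ|exact: nceqZ].
Qed.
Lemma degree_closureN f : degree_closure P f -> degree_closure P (- f).
Proof. by rewrite -scaleN1r; apply: degree_closureZ. Qed.
Lemma degree_closure_sum (I : Type) (r : seq I) (Q : pred I) (E : I -> ncseries K) :
  (forall i, Q i -> degree_closure P (E i)) -> degree_closure P (\sum_(i <- r | Q i) E i).
Proof.
move=> PE; elim/big_ind: _ => //; first exact: sub_degree_closure.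
exact: degree_closureD.
Qed.
Lemma degree_closure_ncsum (u : nat -> ncseries K) : (forall k, ncord k (u k)) ->
  (forall k, degree_closure P (u k)) -> degree_closure P (ncsum u).
Proof.
move=> ou Pu; apply: degree_closure_limit => n.
by exists (\sum_(k < n) u k); [exact: degree_closure_sum|exact: ncsum_nceq].
Qed.
End Submodule.

Lemma p_lie_letter (x : bool) : p_lie (letter K x).
Proof. exact/sub_degree_closure/free_lie_letter. Qed.
Lemma p_lie0 : p_lie (0 : ncseries K).
Proof. exact/sub_degree_closure/free_lie_0. Qed.
Lemma p_lieD f g : p_lie f -> p_lie g -> p_lie (f + g).
Proof. by apply: degree_closureD; exact: free_lie_D. Qed.
Lemma p_lieZ c f : p_lie f -> p_lie (c *: f).
Proof. by apply: degree_closureZ; exact: free_lie_Z. Qed.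
Lemma p_lieN f : p_lie f -> p_lie (- f).
Proof. by apply: degree_closureN; exact: free_lie_Z. Qed.
Lemma p_lie_sum (I : Type) (r : seq I) (Q : pred I) (E : I -> ncseries K) :
  (forall i, Q i -> p_lie (E i)) -> p_lie (\sum_(i <- r | Q i) E i).
Proof. by apply: degree_closure_sum; [exact: free_lie_D|exact: free_lie_0]. Qed.
Lemma p_lie_ncsum (u : nat -> ncseries K) : (forall k, ncord k (u k)) ->
  (forall k, p_lie (u k)) -> p_lie (ncsum u).
Proof. by apply: degree_closure_ncsum; [exact: free_lie_D|exact: free_lie_0]. Qed.
Lemma p_lie_lie f g : p_lie f -> p_lie g -> p_lie (lie f g).
Proof.
move=> /degree_closureP Pf /degree_closureP Pg; apply/degree_closureP => n.
case: (Pf n) (Pg n) => f' Pf' ff' [g' Pg' gg'].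
by exists (lie f' g'); [exact: free_lie_br|exact: nceq_lie].
Qed.

Lemma free_lie_nil f : free_lie f -> nccoef f [::] = 0.
Proof.
elim=> {f} [||f g _ IHf _ IHg|c f _ IHf|f g _ _ _ _] //; last exact: lie_nil.
  by rewrite nccoefD IHf IHg addr0.
by rewrite nccoefZ IHf mulr0.
Qed.
Lemma p_lie_nil f : p_lie f -> nccoef f [::] = 0.
Proof.
move=> /degree_closureP/(_ 1%N)[g Pg /nceqP ->] //.
exact: free_lie_nil.
Qed.
Lemma p_lie_ord f : p_lie f -> ncord 1 f.
Proof. by move=> Pf; apply/ncord1P/p_lie_nil. Qed.

Lemma D1p_lie f g : p_lie f -> p_lie g -> D1p (lie f g).
Proof. by move=> Pf Pg; apply/sub_degree_closure/lie_span_br. Qed.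
Lemma D1p_sub f : D1p f -> p_lie f.
Proof.
move=> /degree_closureP Df; apply: degree_closure_limit => n.
case: (Df n) => g Sg fg; exists g => //; elim: Sg => {fg}.
- exact: p_lie0.
- exact: p_lie_lie.
- by move=> *; apply: p_lieD.
- by move=> *; apply: p_lieZ.
Qed.

Lemma D2p0 : D2p (0 : ncseries K).
Proof. exact/sub_degree_closure/lie_span_0. Qed.
Lemma D2pD f g : D2p f -> D2p g -> D2p (f + g).
Proof. by apply: degree_closureD; exact: lie_span_D. Qed.
Lemma D2pZ c f : D2p f -> D2p (c *: f).
Proof. by apply: degree_closureZ; exact: lie_span_Z. Qed.
Lemma D2pN f : D2p f -> D2p (- f).
Proof. by apply: degree_closureN; exact: lie_span_Z. Qed.
Lemma D2p_lie f g : D1p f -> D1p g -> D2p (lie f g).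
Proof. by move=> Pf Pg; apply/sub_degree_closure/lie_span_br. Qed.
Lemma D2p_ideal x f : p_lie x -> D2p f -> D2p (lie x f).
Proof.
move=> Px /degree_closureP Df; apply: degree_closure_limit => n.
case: (Df n) => g Sg fg; exists (lie x g); last by apply: nceq_lie => //; apply: nceq_refl.
elim: Sg => {fg}.
- by rewrite lief0; apply: D2p0.
- move=> h k Dh Dk; rewrite lie_jacobi; apply: D2pD; apply: D2p_lie => //;
  by apply: D1p_lie => //; exact: D1p_sub.
- by move=> *; rewrite lieDr; apply: D2pD.
- by move=> *; rewrite lieZr; apply: D2pZ.
Qed.

Lemma abel_D1p f : D1p f -> abel f = 0.
Proof.
move=> /degree_closureP Df; apply: UVP => k l.
case: (Df (k + l).+1) => g Sg /abel_nceq -> //; elim: Sg.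
- by rewrite abel0.
- by move=> *; rewrite abel_lie.
- by move=> ? ? _ IH1 _ IH2; rewrite abelD coefUVD IH1 IH2 addr0.
- by move=> ? ? _ IH; rewrite abelZ coefUV_constM IH mulr0.
Qed.

Lemma D1p_nil f : D1p f -> nccoef f [::] = 0.
Proof. by move=> /D1p_sub/p_lie_nil. Qed.

Lemma lie_span_D1p f : lie_span (D1p (K:=K)) f -> abel f = 0 /\ fox f = 0.
Proof.
elim=> {f} [|f g Df Dg|f g _ [pf qf] _ [pg qg]|c f _ [pf qf]].
- by rewrite abel0 fox0.
- by rewrite abel_lie fox_lie ?D1p_nil // !abel_D1p // !mul0r subrr.
- by rewrite abelD foxD pf qf pg qg addr0.
- by rewrite abelZ foxZ pf qf mulr0.
Qed.

Lemma abel_D2p f : D2p f -> abel f = 0.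
Proof.
move=> /degree_closureP Df; apply: UVP => k l.
by case: (Df (k + l).+1) => g /lie_span_D1p[pg _] /abel_nceq -> //; rewrite pg.
Qed.

Lemma fox_D2p f : D2p f -> fox f = 0.
Proof.
move=> /degree_closureP Df; apply: UVP => k l.
by case: (Df (k + l).+2) => g /lie_span_D1p[_ qg] /fox_nceq -> //; rewrite qg.
Qed.

(** * The quotient of p by its second derived ideal *)

Definition adab k l : ncseries K := iter k (lie a) (iter l (lie b) (lie a b)).

Lemma adab_ord k l : ncord (k + l).+2 (adab k l).
Proof.
elim: k => [|k IHk]; last by rewrite -[(k.+1 + l).+2]add1n; apply: ncord_lie => //; apply: ncord_letter.
elim: l => [|l IHl]; first by apply: (@ncord_lie _ 1 1); apply: ncord_letter.
by rewrite -[(0 + l.+1).+2]add1n; apply: ncord_lie => //; apply: ncord_letter.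
Qed.

Lemma adab_D1p k l : D1p (adab k l).
Proof.
have D1ab : D1p (lie a b) by apply: D1p_lie; exact: p_lie_letter.
have D1l : D1p (adab 0 l).
  elim: l => // l IHl; apply: D1p_lie; [exact: p_lie_letter|exact: D1p_sub].
by elim: k => // k IHk; apply: D1p_lie; [exact: p_lie_letter|exact: D1p_sub].
Qed.

Lemma fox_adab k l : fox (adab k l) = U * (U ^+ k * V ^+ l).
Proof.
elim: k => [|k IHk].
  rewrite expr0 mul1r; elim: l => [|l IHl].
    by rewrite /adab /= fox_lie // !fox_letter !abel_letter !mulr1 mulr0 subr0.
  rewrite -[adab 0 l.+1]/(lie b (adab 0 l)) fox_lie //; last by rewrite (D1p_nil (adab_D1p _ _)).
  by rewrite IHl abel_letter (abel_D1p (adab_D1p _ _)) mul0r subr0 exprS mulrCA.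
rewrite -[adab k.+1 l]/(lie a (adab k l)) fox_lie //; last by rewrite (D1p_nil (adab_D1p _ _)).
by rewrite IHk abel_letter (abel_D1p (adab_D1p _ _)) mul0r subr0 exprS -mulrA.
Qed.

Definition D1_term F n := \sum_(k < n.+1) coefUV F k (n - k) *: adab k (n - k).

Lemma D1_reprE F : D1_repr F = ncsum (D1_term F).
Proof. by []. Qed.

Lemma D1_term_ord F n : ncord n (D1_term F n).
Proof.
apply: ncord_sum => k _; apply: ncordZ; apply: (ncord_leq _ (adab_ord _ _)).
by rewrite subnKC -1?ltnS // ltnW.
Qed.

Lemma D1_repr_D1p F : D1p (D1_repr F).
Proof.
have SD := @lie_span_D K (@p_lie K); have SZ := @lie_span_Z K (@p_lie K).
rewrite D1_reprE; apply: degree_closure_ncsum => // [|k|k]; first exact: lie_span_0.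
  exact: D1_term_ord.
apply: degree_closure_sum => // [|i _]; first exact: lie_span_0.
by apply: degree_closureZ => //; apply: adab_D1p.
Qed.

Lemma D1_repr_nceq n F G : (forall k l, (k + l < n)%N -> coefUV F k l = coefUV G k l) ->
  nceq n (D1_repr F) (D1_repr G).
Proof.
move=> FG; rewrite !D1_reprE.
apply: (nceq_trans (ncsum_nceq (D1_term_ord F) (leqnn n))).
apply: (nceq_trans _ (nceq_sym (ncsum_nceq (D1_term_ord G) (leqnn n)))).
have -> : \sum_(k < n) D1_term F k = \sum_(k < n) D1_term G k.
  apply: eq_bigr => k _; apply: eq_bigr => i _; rewrite FG // subnKC -?[(i <= k)%N]ltnS //; exact: ltn_ord.
exact: nceq_refl.
Qed.

Lemma D1_reprD F G : D1_repr (F + G) = D1_repr F + D1_repr G.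
Proof.
rewrite !D1_reprE ncsumD; apply: eq_ncsum => n.
by rewrite -big_split; apply: eq_bigr => k _; rewrite coefUVD scalerDl.
Qed.
Lemma D1_reprZ c F : D1_repr (constUV c * F) = c *: D1_repr F.
Proof.
rewrite !D1_reprE ncsumZ; apply: eq_ncsum => n.
by rewrite scaler_sumr; apply: eq_bigr => k _; rewrite coefUV_constM scalerA.
Qed.
Lemma D1_reprN F : D1_repr (- F) = - D1_repr F.
Proof. by rewrite -mulN1r -constUV1 -constUVN D1_reprZ scaleN1r. Qed.
Lemma D1_repr1 : D1_repr 1 = lie a b.
Proof.
rewrite D1_reprE (@ncsum_fin _ 1) => [|k k1|k]; last exact: D1_term_ord.
  by rewrite big_ord1 /D1_term big_ord1 coefUV1 scale1r.
rewrite /D1_term big1 // => i _; rewrite coefUV1.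
by case: eqP => [->|_]; rewrite ?scale0r // subn0 (gtn_eqF k1) scale0r.
Qed.

Lemma coefUV_UV i j k l : coefUV (U ^+ i * V ^+ j) k l = ((k == i) && (l == j))%:R.
Proof.
elim: i k => [|i IHi] k; last by rewrite exprS -mulrA coefUV_UM; case: k.
rewrite expr0 mul1r; elim: j l => [|j IHj] l; first by rewrite expr0 coefUV1.
by rewrite exprS coefUV_VM; case: l => // ; rewrite andbF.
Qed.

Lemma abel_repr F : abel (D1_repr F) = 0.
Proof. exact/abel_D1p/D1_repr_D1p. Qed.

Lemma fox_repr F : fox (D1_repr F) = U * F.
Proof.
apply: UVP => k l; rewrite D1_reprE.
rewrite (fox_nceq (ltnSn _) (ncsum_nceq (D1_term_ord F) (leqnn _))) fox_sum coefUV_sum.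
rewrite coefUV_UM.
transitivity (\sum_(n < (k + l).+2) \sum_(i < n.+1)
    coefUV F i (n - i) * ((k == i.+1) && (l == n - i)%N)%:R).
  apply: eq_bigr => n _; rewrite fox_sum coefUV_sum; apply: eq_bigr => i _.
  by rewrite foxZ coefUV_constM fox_adab mulrA -exprS coefUV_UV.
case: k => [|k]; first by rewrite big1 // => n _; rewrite big1 // => i _; rewrite mulr0.
have kl : (k + l < (k.+1 + l).+2)%N by lia.
rewrite (bigD1 (Ordinal kl)) //= [X in _ + X]big1 ?addr0; last first.
  move=> n nkl; rewrite big1 // => i _; rewrite eqSS.
  case: eqP => [ki|]; rewrite ?mulr0 //; case: eqP => [li|]; rewrite ?mulr0 //.
  case/eqP: nkl; apply/val_inj => /=; have := ltn_ord i; lia.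
have kk : (k < (k + l).+1)%N by lia.
rewrite (bigD1 (Ordinal kk)) //= big1 ?addr0; last first.
  move=> i ik; rewrite eqSS; case: eqP => [ki|]; rewrite ?mulr0 //.
  by case/eqP: ik; apply/val_inj.
by rewrite eqxx addKn eqxx mulr1.
Qed.

Lemma lie_a_repr F : lie a (D1_repr F) = D1_repr (U * F).
Proof.
rewrite !D1_reprE lie_ncsumr; last exact: D1_term_ord.
rewrite [RHS]ncsum_recl; last exact: D1_term_ord.
rewrite [D1_term _ 0]/D1_term big_ord1 coefUV_UM scale0r add0r.
apply: eq_ncsum => n; rewrite lie_sumr /D1_term [RHS]big_ord_recl coefUV_UM scale0r add0r.
by apply: eq_bigr => k _; rewrite lieZr coefUV_UM.
Qed.

(** On D^1 p, ad(a) and ad(b) commute modulo D^2 p, their commutator being ad([a,b]). The order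
    chosen in [adab] makes ad(a) act by U exactly, so only ad(b) produces a discrepancy. *)
Lemma lie_b_adab k l : D2p (lie b (adab k l) - adab k l.+1).
Proof.
elim: k => [|k IHk]; first by rewrite subrr; apply: D2p0.
have -> : lie b (adab k.+1 l) - adab k.+1 l.+1 =
   lie a (lie b (adab k l) - adab k l.+1) - lie (lie a b) (adab k l).
  rewrite -[adab k.+1 l]/(lie a (adab k l)) -[adab k.+1 l.+1]/(lie a (adab k l.+1)).
  rewrite [lie a (_ - _)]lieDr [lie a (- _)]lieNr [lie b _]lie_jacobi [lie b a]lieC. by rewrite lieNl [- _ + _]addrC addrAC.
apply: D2pD; first by apply: D2p_ideal => //; apply: p_lie_letter.
by apply/D2pN/D2p_lie; [exact: (adab_D1p 0 0)|exact: adab_D1p].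
Qed.

Lemma lie_b_repr F : D2p (lie b (D1_repr F) - D1_repr (V * F)).
Proof.
rewrite !D1_reprE lie_ncsumr; last exact: D1_term_ord.
rewrite [X in _ - X]ncsum_recl; last exact: D1_term_ord.
rewrite [D1_term _ 0]/D1_term big_ord1 coefUV_VM scale0r add0r ncsumN ncsumD.
have SD := @lie_span_D K (@D1p K); have SZ := @lie_span_Z K (@D1p K).
apply: degree_closure_ncsum => // [|n|n]; first exact: lie_span_0.
  apply: ncordB; first by apply/(@ncord_lie _ 0 n) => //; apply: D1_term_ord.
  by apply: (ncord_leq _ (D1_term_ord _ _)).
rewrite lie_sumr [X in _ - X]/D1_term [X in _ - X]big_ord_recr /= subnn.
rewrite coefUV_VM scale0r addr0 -sumrB.
apply: degree_closure_sum => // [|k _]; first exact: lie_span_0.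
rewrite subSn -1?ltnS // coefUV_VM lieZr -scalerBr.
by apply: degree_closureZ => //; apply: lie_b_adab.
Qed.

(** Normal form of an element of p modulo D^2 p. *)
Definition D1_rep3 (al be : K) F := al *: a + be *: b + D1_repr F.

Lemma D1_rep3_p_lie al be F : p_lie (D1_rep3 al be F).
Proof.
apply: p_lieD; first by apply: p_lieD; apply: p_lieZ; apply: p_lie_letter.
exact/D1p_sub/D1_repr_D1p.
Qed.

Lemma D2p_trans f g h : D2p (f - g) -> D2p (g - h) -> D2p (f - h).
Proof. by move=> fg /(D2pD fg); rewrite addrA subrK. Qed.

(** D^1 p/D^2 p is an abelian ideal on which a and b act as U and V; the scalar term is the multiple
    of [a,b], whose series is 1. *)
Lemma lie_rep3 al be F al' be' F' :
  D2p (lie (D1_rep3 al be F) (D1_rep3 al' be' F') -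
    D1_rep3 0 0 (constUV (al * be' - be * al') +
      (constUV al * (U * F') + constUV be * (V * F')) -
      (constUV al' * (U * F) + constUV be' * (V * F)))).
Proof.
rewrite /D1_rep3 !scale0r !add0r.
rewrite -[constUV (_ - _)]mulr1 !D1_reprD D1_reprN !D1_reprD !D1_reprZ D1_repr1 -!lie_a_repr.
have -> : lie (al *: a + be *: b + D1_repr F) (al' *: a + be' *: b + D1_repr F') =
  (al * be' - be * al') *: lie a b + al *: lie a (D1_repr F') + be *: lie b (D1_repr F')
  - al' *: lie a (D1_repr F) - be' *: lie b (D1_repr F) + lie (D1_repr F) (D1_repr F').
  rewrite !(lieDl, lieDr, lieZl, lieZr) !lieff !scaler0.
  rewrite [lie b a]lieC [lie (D1_repr F) a]lieC [lie (D1_repr F) b]lieC.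
  by apply: ncseriesP => w; rewrite !(nccoefD, nccoefN, nccoefZ, nccoef0); ring.
set X := (X in D2p X).
have -> : X = be *: (lie b (D1_repr F') - D1_repr (V * F'))
  - be' *: (lie b (D1_repr F) - D1_repr (V * F)) + lie (D1_repr F) (D1_repr F').
  by apply: ncseriesP => w; rewrite !(nccoefD, nccoefN, nccoefZ, nccoef0); ring.
apply: D2pD; last by apply: D2p_lie; apply: D1_repr_D1p.
by apply: D2pD; [|apply: D2pN]; apply: D2pZ; apply: lie_b_repr.
Qed.

(** Normal forms exist first for Lie polynomials, where induction on brackets is available. *)
Lemma free_lie_rep3 f : free_lie f -> exists al be F, D2p (f - D1_rep3 al be F).
Proof.
have D1_repr0 : D1_repr (0 : {fps {fps K}}) = 0.
  by rewrite -[0 in LHS](mul0r 0) -constUV0 D1_reprZ scale0r.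
elim=> {f} [x||f g Pf [al [be [F DF]]] Pg [al' [be' [F' DF']]]|c f Pf [al [be [F DF]]]|
  f g Pf [al [be [F DF]]] Pg [al' [be' [F' DF']]]].
- exists (~~ x)%:R, x%:R, 0; rewrite /D1_rep3 D1_repr0 addr0.
  case: x; rewrite /= scale0r scale1r ?add0r ?addr0 subrr; exact: D2p0.
- by exists 0, 0, 0; rewrite /D1_rep3 D1_repr0 !scale0r !addr0 subr0; apply: D2p0.
- exists (al + al'), (be + be'), (F + F').
  have -> : f + g - D1_rep3 (al + al') (be + be') (F + F') =
     (f - D1_rep3 al be F) + (g - D1_rep3 al' be' F').
    rewrite /D1_rep3 D1_reprD; apply: ncseriesP => w.
    by rewrite !(nccoefD, nccoefN, nccoefZ, nccoef0); ring.
  exact: D2pD.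
- exists (c * al), (c * be), (constUV c * F).
  have -> : c *: f - D1_rep3 (c * al) (c * be) (constUV c * F) = c *: (f - D1_rep3 al be F).
    rewrite /D1_rep3 D1_reprZ; apply: ncseriesP => w.
    by rewrite !(nccoefD, nccoefN, nccoefZ, nccoef0); ring.
  exact: D2pZ.
- do 3!eexists; apply: D2p_trans (lie_rep3 al be F al' be' F').
  move: (D1_rep3_p_lie al be F) DF DF'.
  move: (D1_rep3 al be F) (D1_rep3 al' be' F') => r r' Pr DF DF'.
  have -> : lie f g - lie r r' = lie r (g - r') - lie g (f - r).
    rewrite !(lieDl, lieDr, lieNr) [lie g f]lieC [lie g r]lieC.
    by apply: ncseriesP => w; rewrite !(nccoefD, nccoefN, nccoefZ, nccoef0); ring.
  apply: D2pD; first by exact: D2p_ideal.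
  by apply/D2pN/D2p_ideal => //; apply: sub_degree_closure.
Qed.

Lemma abel_rep3 f al be F : D2p (f - D1_rep3 al be F) ->
  abel f = constUV al * U + constUV be * V.
Proof.
move=> /abel_D2p/eqP; rewrite abelB subr_eq0 => /eqP ->.
by rewrite !abelD !abelZ !abel_letter abel_repr addr0.
Qed.

Lemma fox_rep3 f al be F : D2p (f - D1_rep3 al be F) -> fox f = constUV be + U * F.
Proof.
move=> /fox_D2p/eqP; rewrite foxB subr_eq0 => /eqP ->.
by rewrite !foxD !foxZ !fox_letter fox_repr mulr0 add0r mulr1.
Qed.

Lemma constUV_U_inj be be' F F' :
  constUV be + U * F = constUV be' + U * F' -> be = be' /\ F = F'.
Proof.
move=> E; have be_eq : be = be'.
  have := congr1 (fun G : {fps {fps K}} => coefUV G 0 0) E.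
  by rewrite !coefUVD !coefUV_const !coefUV_UM !addr0.
by split=> //; apply: varU_inj; apply: (addrI (constUV be)); rewrite {2}be_eq.
Qed.

(** The Lie polynomials approximating f have normal forms that vary with the degree; [abel] and
    [fox] tie their coefficients to those of f, so the normal forms converge. *)
Lemma p_lie_rep3 f be F : p_lie f -> fox f = constUV be + U * F ->
  D2p (f - D1_rep3 (coefUV (abel f) 1 0) be F).
Proof.
move=> /degree_closureP Pf qf; apply: degree_closure_limit => n.
(* Two degrees beyond n: [fox] costs one letter and the factor U in front of the series costs
   another. *)
case: (Pf n.+2) => g Pg fg; case: (free_lie_rep3 Pg) => al [be' [G DG]].
exists (g - D1_rep3 al be' G) => //; apply: nceqB.
  by apply: (nceq_leq _ fg); rewrite ltnW.
have pg := abel_rep3 DG; have qg := fox_rep3 DG.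
have -> : coefUV (abel f) 1 0 = al.
  rewrite (@abel_nceq _ n.+2 f g) // pg coefUVD !coefUV_constM coefUV_U coefUV_V.
  by rewrite mulr1 mulr0 addr0.
have qE k l : (k + l < n.+1)%N -> coefUV (constUV be + U * F) k l = coefUV (constUV be' + U * G) k l.
  by move=> kl; rewrite -qf -qg; apply: fox_nceq fg.
have -> : be = be'.
  by have := qE 0%N 0%N isT; rewrite !coefUVD !coefUV_const !coefUV_UM !addr0.
apply: nceqD; first exact: nceq_refl.
apply: D1_repr_nceq => k l kl; have := qE k.+1 l kl.
by rewrite !coefUVD !coefUV_const !coefUV_UM !add0r.
Qed.

Theorem unique_D1_component f be F : p_lie f -> fox f = constUV be + U * F ->
  unique (D1_component f) F.
Proof.
move=> Pf qf; split.
  by split=> //; do 2!eexists; apply: p_lie_rep3 qf.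
move=> G [_ [al [be' /fox_rep3]]]; rewrite qf.
by case/constUV_U_inj.
Qed.

End LieStructure.

(** * Exponential, logarithm and substitution of Lie series *)

Section CauchyProduct.
Variable K : comNzRingType.
Implicit Types (f g h : ncseries K) (u v : nat -> ncseries K).

Lemma ncsumM u v : (forall k, ncord k (u k)) -> (forall k, ncord k (v k)) ->
  ncsum u * ncsum v = ncsum (fun n => \sum_(i < n.+1) u i * v (n - i)%N).
Proof.
move=> ou ov; set s := (X in _ = ncsum X).
have os k : ncord k (s k).
  apply: ncord_sum => i _; have ik : (i <= k)%N by rewrite -ltnS.
  by rewrite -[k in ncord k _](subnKC ik); apply: ncordM.
apply: nceq_eq => -[|n]; first by [].
apply: (nceq_trans _ (nceq_sym (ncsum_nceq os (leqnn n.+1)))).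
apply: (nceq_trans (nceqM (ncsum_nceq ou (leqnn n.+1)) (ncsum_nceq ov (leqnn n.+1)))).
rewrite /s -(sum_triangle _ (fun i m => u i * v (m - i)%N)) mulr_suml.
apply: nceq_sum => i _; rewrite mulr_sumr.
have ni : (n.+1 = i + (n - i).+1)%N by rewrite addnS subnKC // -ltnS.
under [X in nceq _ _ X]eq_bigr do rewrite addKn.
rewrite -!(big_mkord xpredT (fun j => u i * v j)).
rewrite (@big_cat_nat _ _ _ (n - i).+1) //=; last by rewrite ltnS leq_subr.
rewrite /nceq addrAC subrr add0r big_nat; apply: ncord_sum => j /andP[jn _].
by apply: (@ncord_leq _ _ (i + j)%N); [lia|apply: ncordM].
Qed.

Lemma ncordX_lie f g n : ncord 1 f -> ncord n (iter n (lie f) g).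
Proof.
by move=> f1; elim: n => [|n IHn] //; rewrite iterS -add1n; apply: ncord_lie.
Qed.

(** Left multiplication by f is the sum of ad(f) and right multiplication by f, which commute; this
    is their binomial formula. *)
Lemma mulXr_ad f g n : f ^+ n * g =
  \sum_(j < n.+1) (iter j (lie f) g * f ^+ (n - j)) *+ 'C(n, j).
Proof.
elim: n => [|n IHn]; first by rewrite big_ord1 expr0 mul1r mulr1 bin0.
have adS j : f * iter j (lie f) g = iter j.+1 (lie f) g + iter j (lie f) g * f.
  by rewrite iterS lieE subrK.
rewrite exprS -mulrA IHn mulr_sumr.
under eq_bigr => j _.
  rewrite mulrnAr mulrA adS mulrDl -mulrA -exprS mulrnDl -subSn -1?ltnS //; over.
pose G j := (iter j.+1 (lie f) g * f ^+ (n - j)) *+ 'C(n, j.+1).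
have GE : \sum_(j < n) G j = \sum_(j < n.+1) G j.
  by rewrite big_ord_recr /G /= bin_small // mulr0n addr0.
rewrite big_split /= [RHS]big_ord_recl bin0 subn0 addrC.
rewrite [X in X + _]big_ord_recl /= bin0 subn0 -addrA; congr (_ + _).
transitivity (\sum_(j < n) G j + \sum_(j < n.+1) (iter j.+1 (lie f) g * f ^+ (n - j)) *+ 'C(n, j)).
  by congr (_ + _); apply: eq_bigr => j _; rewrite /G ?subSS.
rewrite GE -big_split; apply: eq_bigr => j _.
by rewrite /bump /= /G add1n binS mulrnDr subSS.
Qed.

(** The Euler derivation. In characteristic 0 it determines a series up to its constant term, so it
    can be inverted degree by degree. *)
Definition ncdeg f := NCSeries (fun w => (size w)%:R * nccoef f w).

Lemma ncdegD f g : ncdeg (f + g) = ncdeg f + ncdeg g.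
Proof. by apply: ncseriesP => w; rewrite /= mulrDr. Qed.
Lemma ncdegZ c f : ncdeg (c *: f) = c *: ncdeg f.
Proof. by apply: ncseriesP => w; rewrite /= mulrCA. Qed.
Lemma ncdegM f g : ncdeg (f * g) = ncdeg f * g + f * ncdeg g.
Proof.
apply: ncseriesP => w; rewrite /= mulr_sumr -big_split; apply: eq_bigr => i _ /=.
have iw : (i <= size w)%N by rewrite -ltnS.
by rewrite size_takel // size_drop -{1}(subnKC iw) natrD; ring.
Qed.
Lemma ncdeg1 : ncdeg 1 = 0.
Proof. by apply: ncseriesP => -[|x w]; rewrite /= ?mul0r ?mulr0. Qed.
Lemma ncdeg_ord n f : ncord n f -> ncord n (ncdeg f).
Proof. by move=> [nf]; split=> w wn; rewrite /= nf // mulr0. Qed.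
Lemma ncdeg_nceq n f g : nceq n f g -> nceq n (ncdeg f) (ncdeg g).
Proof. by move=> /nceqP fg; apply/nceqP => w wn; rewrite /= fg. Qed.
Lemma ncdeg_ord1 f : ncord 1 (ncdeg f).
Proof. by apply/ncord1P; rewrite /= mul0r. Qed.
Lemma ncdeg_ncsum u : ncdeg (ncsum u) = ncsum (fun n => ncdeg (u n)).
Proof. by apply: ncseriesP => w; rewrite /= mulr_sumr. Qed.

(** The powers of f standing before the derivative are moved to its right by [mulXr_ad], and the
    binomials add up by Pascal's rule. *)
Lemma ncdegX f n : ncdeg (f ^+ n) =
  \sum_(j < n) (iter j (lie f) (ncdeg f) * f ^+ (n.-1 - j)) *+ 'C(n, j.+1).
Proof.
elim: n => [|n IHn]; first by rewrite big_ord0 expr0 ncdeg1.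
pose G j := (iter j (lie f) (ncdeg f) * f ^+ (n - j)) *+ 'C(n, j.+1).
have GE : \sum_(j < n) G j = \sum_(j < n.+1) G j.
  by rewrite big_ord_recr /G /= bin_small // mulr0n addr0.
rewrite exprSr ncdegM IHn mulr_suml mulXr_ad.
under eq_bigr => j _.
  rewrite mulrnAl -mulrA -exprSr.
  have -> : ((n.-1 - j).+1 = n - j)%N by have := ltn_ord j; lia.
  over.
rewrite -/(G _) GE -big_split; apply: eq_bigr => j _.
by rewrite /G /= binS mulrnDr.
Qed.

Definition nchom (n : nat) f := NCSeries (fun w => if size w == n then nccoef f w else 0).

Lemma nchomM n f g : nchom n (f * g) = \sum_(i < n.+1) nchom i f * nchom (n - i)%N g.
Proof.
apply: ncseriesP => w; rewrite nccoef_sum /=; case: eqP => [<-|wn].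
  apply: eq_bigr => i _; have iw : (i <= size w)%N by rewrite -ltnS.
  rewrite (bigD1 i) //= size_takel // size_drop !eqxx big1 ?addr0 // => j ij.
  rewrite size_takel; last by rewrite -ltnS.
  by rewrite val_eqE (negPf ij) mul0r.
rewrite big1 // => i _; rewrite big1 // => j _.
rewrite size_takel -1?ltnS // size_drop.
case: eqP => ji; rewrite ?mul0r //; case: eqP => ni; rewrite ?mulr0 //.
by case: wn; have := ltn_ord i; have := ltn_ord j; lia.
Qed.
Lemma nchomD n f g : nchom n (f + g) = nchom n f + nchom n g.
Proof. by apply: ncseriesP => w; rewrite nccoefD /=; case: eqP; rewrite ?addr0. Qed.
Lemma nchomN n f : nchom n (- f) = - nchom n f.
Proof. by apply: ncseriesP => w; rewrite nccoefN /=; case: eqP; rewrite ?oppr0. Qed.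
Lemma nchomZ n c f : nchom n (c *: f) = c *: nchom n f.
Proof. by apply: ncseriesP => w; rewrite nccoefZ /=; case: eqP; rewrite ?mulr0. Qed.
Lemma nchom_lie n f g : nchom n (lie f g) = \sum_(i < n.+1) lie (nchom i f) (nchom (n - i)%N g).
Proof.
rewrite lieE nchomD nchomN !nchomM [X in _ - X](reindex_inj rev_ord_inj) /= -sumrB.
by apply: eq_bigr => i _; rewrite subSS subKn // -ltnS.
Qed.

Lemma free_lie_sum (I : Type) (r : seq I) (Q : pred I) (E : I -> ncseries K) :
  (forall i, Q i -> free_lie (E i)) -> free_lie (\sum_(i <- r | Q i) E i).
Proof. by move=> PE; elim/big_ind: _ => //; [exact: free_lie_0|exact: free_lie_D]. Qed.

(** Needed to invert the Euler derivation inside Lie polynomials, where the part of degree k is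
    divided by k. *)
Lemma free_lie_hom n f : free_lie f -> free_lie (nchom n f).
Proof.
move=> Pf; elim: Pf n => {f} [x||f g _ IHf _ IHg|c f _ IHf|f g _ IHf _ IHg] n.
- case: (eqVneq n 1%N) => [->|n1].
    have -> : nchom 1 (letter K x) = letter K x; last exact: free_lie_letter.
    by apply: ncseriesP => w /=; case: eqP => // w1; case: eqP => // wx; rewrite wx in w1.
  have -> : nchom n (letter K x) = 0; last exact: free_lie_0.
  apply: ncseriesP => w /=; case: eqP => // w1; case: eqP => // wx.
  by case/eqP: n1; rewrite -w1 wx.
- have -> : nchom n (0 : ncseries K) = 0; last exact: free_lie_0.
  by apply: ncseriesP => w /=; case: eqP.
- by rewrite nchomD; apply: free_lie_D.
- by rewrite nchomZ; apply: free_lie_Z.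
- by rewrite nchom_lie; apply: free_lie_sum => i _; apply: free_lie_br.
Qed.

Lemma free_lie_deg f : free_lie f -> free_lie (ncdeg f).
Proof.
elim=> {f} [x||f g _ IHf _ IHg|c f _ IHf|f g Pf IHf Pg IHg].
- have -> : ncdeg (letter K x) = letter K x; last exact: free_lie_letter.
  by apply: ncseriesP => w /=; case: eqP => [->|_]; rewrite ?mulr0 // mul1r.
- have -> : ncdeg (0 : ncseries K) = 0; last exact: free_lie_0.
  by apply: ncseriesP => w /=; rewrite mulr0.
- by rewrite ncdegD; apply: free_lie_D.
- by rewrite ncdegZ; apply: free_lie_Z.
- have -> : ncdeg (lie f g) = lie (ncdeg f) g + lie f (ncdeg g).
    rewrite lieE -[- (g * f)]scaleN1r ncdegD ncdegZ scaleN1r !ncdegM.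
    by rewrite !lieE; apply: ncseriesP => w; rewrite !(nccoefD, nccoefN); ring.
  by apply: free_lie_D; apply: free_lie_br.
Qed.

Lemma p_lie_deg f : p_lie f -> p_lie (ncdeg f).
Proof.
move=> /degree_closureP Pf; apply/degree_closureP => n; case: (Pf n) => g Pg fg.
by exists (ncdeg g); [exact: free_lie_deg|exact: ncdeg_nceq].
Qed.

Lemma p_lie_ad f g n : p_lie f -> p_lie g -> p_lie (iter n (lie f) g).
Proof. by move=> Pf Pg; elim: n => // n IHn; apply: p_lie_lie. Qed.

End CauchyProduct.

(** * Exponential and logarithm, and series whose logarithm lies in p *)

Section ExpLogSeries.
Variable K : numFieldType.
Implicit Types (f g : ncseries K) (h : {fps K}).

Definition fpsdeg (h : {fps K}) : {fps K} := FPS (fun n => n%:R * fpscoef h n).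
Definition fpslog : {fps K} := FPS (fun n => (-1) ^+ n.+1 / n%:R).

Lemma fpsdegM h (k : {fps K}) : fpsdeg (h * k) = fpsdeg h * k + h * fpsdeg k.
Proof.
apply: fpsP => n; rewrite /= mulr_sumr -big_split; apply: eq_bigr => i _ /=.
have ni : (i <= n)%N by rewrite -ltnS.
by rewrite -{1}(subnKC ni) natrD; ring.
Qed.

Lemma fpsdegX h n : fpsdeg (h ^+ n) = (fpsdeg h * h ^+ n.-1) *+ n.
Proof.
elim: n => [|n IHn].
  by rewrite mulr0n; apply: fpsP => -[|n] /=; rewrite ?mul0r ?mulr0.
rewrite exprS fpsdegM IHn mulrnAr mulrCA -exprS; case: n {IHn} => [|n] //.
by rewrite mulr0n addr0.
Qed.

Lemma fpscoefX_small h n m : fpscoef h 0 = 0 -> (m < n)%N -> fpscoef (h ^+ n) m = 0.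
Proof.
move=> h0; elim: n m => // n IHn m mn; rewrite exprS fpscoefM big1 // => i _.
case: (posnP i) => [->|i0]; first by rewrite h0 mul0r.
by rewrite IHn ?mulr0 //; have := ltn_ord i; lia.
Qed.

Lemma invfS n : (n.+1)%:R * (n.+1`!)%:R^-1 = (n`!)%:R^-1 :> K.
Proof. by rewrite factS natrM invfM mulrA mulfV ?mul1r // pnatr_eq0. Qed.

(* y = exp(log(1+T)) satisfies (1+T) T y' = T y because (1+T) T (log(1+T))' = T. *)
Lemma exp_fpslog m : \sum_(k < m.+1) (k`!)%:R^-1 * fpscoef (fpslog ^+ k) m = (m <= 1)%:R.
Proof.
pose y m := \sum_(k < m.+1) (k`!)%:R^-1 * fpscoef (fpslog ^+ k) m.
have log0 : fpscoef fpslog 0 = 0 by rewrite /= invr0 mulr0.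
(* [d] is T/(1 + T), the Euler derivative of log(1 + T). *)
have [d dE [d0 dS]] : exists2 d, d = fpsdeg fpslog &
    fpscoef d 0 = 0 /\ forall i, fpscoef d i.+1 = (-1) ^+ i.
  exists (fpsdeg fpslog) => //; split=> [|i]; first by rewrite /= mul0r.
  by rewrite /= mulrCA mulfV ?pnatr_eq0 // mulr1 !exprS mulrA mulrNN mulr1 mul1r.
have yE n m' : (m' < n)%N -> y m' = \sum_(k < n) (k`!)%:R^-1 * fpscoef (fpslog ^+ k) m'.
  move=> mn; rewrite /y (big_ord_widen n (fun k => (k`!)%:R^-1 * fpscoef (fpslog ^+ k) m') mn).
  by rewrite big_mkcond; apply: eq_bigr => k _; case: ltnP => // km; rewrite fpscoefX_small ?mulr0.
have ydeg n : n.+1%:R * y n.+1 = \sum_(i < n.+1) (-1) ^+ i * y (n - i)%N.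
  transitivity (\sum_(k < n.+2) (k`!)%:R^-1 * fpscoef (fpsdeg (fpslog ^+ k)) n.+1).
    by rewrite mulr_sumr; apply: eq_bigr => k _; rewrite mulrCA.
  rewrite big_ord_recl fpsdegX mulr0n mulr0 add0r.
  transitivity (\sum_(k < n.+1) (k`!)%:R^-1 * fpscoef (d * fpslog ^+ k) n.+1).
    apply: eq_bigr => k _; rewrite lift0 fpsdegX -dE [_.+1.-1]/=.
    rewrite -[X in _ * fpscoef X _]mulr_natl.
    have -> : (k.+1%:R : {fps K}) = fpsC k.+1%:R.
      by elim: k.+1 => [|j IHj]; rewrite ?fpsC0 // !mulrS fpsCD IHj fpsC1.
    by rewrite fpscoefCM mulrA [_^-1 * _]mulrC invfS.
  under eq_bigr => k _ do rewrite fpscoefM big_ord_recl d0 mul0r add0r mulr_sumr.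
  rewrite exchange_big; apply: eq_bigr => i _.
  rewrite (yE n.+1) ?ltnS ?leq_subr // mulr_sumr; apply: eq_bigr => k _.
  by rewrite lift0 dS subSS mulrCA.
(* Adding the relations at two consecutive degrees, that is multiplying by 1 + T, eliminates the
   alternating sum. *)
have rec n : n.+1%:R * y n.+1 = (1 - n%:R) * y n.
  rewrite ydeg big_ord_recl mul1r subn0 mulrBl mul1r; congr (_ + _).
  case: n => [|n]; first by rewrite big_ord0 mul0r oppr0.
  rewrite ydeg -sumrN; apply: eq_bigr => i _.
  by rewrite lift0 subSS exprS mulN1r mulNr.
have y0 : y 0%N = 1 by rewrite /y big_ord1 /= invr1 mul1r.
have yS n : y n.+1 = (n == 0%N)%:R.
  have n0 : n.+1%:R != 0 :> K by rewrite pnatr_eq0.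
  apply: (mulfI n0); rewrite rec.
  elim: n {n0} => [|n IHn]; first by rewrite subr0 y0 !mul1r.
  have n0 : n.+1%:R != 0 :> K by rewrite pnatr_eq0.
  have -> : y n.+1 = (n == 0%N)%:R by apply: (mulfI n0); rewrite rec.
  by rewrite mulr0; case: eqP => [->|_]; rewrite ?mulr0 // subrr mul0r.
by rewrite -/(y m); case: m => [|m]; rewrite ?y0 // yS; case: m.
Qed.

(** Powers of a single f commute, so identities between one-variable series pass to noncommutative
    ones. *)
Definition fpseval f (h : {fps K}) : ncseries K := ncsum (fun n => fpscoef h n *: f ^+ n).

Lemma fpseval_ord f h : ncord 1 f -> forall n, ncord n (fpscoef h n *: f ^+ n).
Proof. by move=> f1 n; apply/ncordZ/ncordX. Qed.

Lemma fpsevalM f h (k : {fps K}) : ncord 1 f ->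
  fpseval f (h * k) = fpseval f h * fpseval f k.
Proof.
move=> f1; rewrite /fpseval ncsumM; [|exact: fpseval_ord..].
apply: eq_ncsum => n; rewrite fpscoefM scaler_suml; apply: eq_bigr => i _.
have ni : (i <= n)%N by rewrite -ltnS.
by rewrite -scalerAl -scalerAr scalerA -exprD subnKC.
Qed.

Lemma fpsevalX f h n : ncord 1 f -> fpseval f (h ^+ n) = fpseval f h ^+ n.
Proof.
move=> f1; elim: n => [|n IHn]; last by rewrite !exprS fpsevalM // IHn.
rewrite /fpseval (@ncsum_fin _ 1); last exact: fpseval_ord.
  by rewrite big_ord1 /= scale1r.
by case=> // k _; rewrite /= scale0r.
Qed.

Lemma nclogE g : nclog g = fpseval (g - 1) fpslog.
Proof. by []. Qed.

Lemma ncexp_ord f : ncord 1 f -> forall n, ncord n ((n`!%:R)^-1 *: f ^+ n).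
Proof. by move=> f1 n; apply/ncordZ/ncordX. Qed.

Lemma nclog_nil g : nccoef (nclog g) [::] = 0.
Proof. by rewrite /= big_ord1 /= invr0 mulr0 mul0r. Qed.

Lemma nclog_ord g : ncord 1 (nclog g).
Proof. exact/ncord1P/nclog_nil. Qed.

Lemma nclogK g : nccoef g [::] = 1 -> ncexp (nclog g) = g.
Proof.
move=> g1; have o1 : ncord 1 (g - 1) by apply/ncord1P; rewrite nccoefB g1 subrr.
apply: ncseriesP => w; rewrite (nccoef_ncsum (ncexp_ord (nclog_ord g)) (ltnSn _)).
transitivity (\sum_(m < (size w).+1) (m <= 1)%:R * nccoef ((g - 1) ^+ m) w).
  under eq_bigr => k _.
    rewrite nccoefZ nclogE -fpsevalX // (nccoef_ncsum (fpseval_ord _ o1) (ltnSn _)) mulr_sumr; over.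
  rewrite exchange_big; apply: eq_bigr => m _.
  rewrite -exp_fpslog mulr_suml (big_ord_widen (size w).+1
    (fun k => (k`!)%:R^-1 * fpscoef (fpslog ^+ k) m * nccoef ((g - 1) ^+ m) w)) //.
  rewrite [RHS]big_mkcond; apply: eq_bigr => k _.
  rewrite nccoefZ mulrA; case: ltnP => // km.
  by rewrite fpscoefX_small ?mulr0 ?mul0r // /= invr0 mulr0.
rewrite big_ord_recl /= mul1r; case: w => [|x w]; first by rewrite big_ord0 addr0 g1.
rewrite big_ord_recl /= mul1r big1 ?addr0; last by move=> i _; rewrite mul0r.
by rewrite add0r subr0.
Qed.

Lemma ncexp_nil f : nccoef (ncexp f) [::] = 1.
Proof. by rewrite /= big_ord1 /= invr1 mul1r. Qed.

Lemma ncexpNK f : ncord 1 f -> ncexp f * ncexp (- f) = 1.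
Proof.
move=> f1; pose e (s : K) : {fps K} := FPS (fun n => s ^+ n / (n`!)%:R).
have eE s : fpseval f (e s) = ncexp (s *: f).
  by apply: eq_ncsum => n; rewrite exprZn scalerA mulrC.
have -> : ncexp f = fpseval f (e 1) by rewrite eE scale1r.
have -> : ncexp (- f) = fpseval f (e (- 1)) by rewrite eE scaleN1r.
rewrite -fpsevalM // -[RHS](fpsevalX 0 0 f1) [e 1 * _]mulrC; congr fpseval.
apply: fpsP => n; rewrite fpscoefM expr0 fpscoef1.
apply: (@mulfI _ (n`!)%:R); first by rewrite pnatr_eq0 -lt0n fact_gt0.
transitivity ((1 - 1 : K) ^+ n); last first.
  by rewrite subrr expr0n; case: n => [|n]; rewrite ?mulr0 // mulr1.
rewrite exprBn mulr_sumr; apply: eq_bigr => i _.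
have ni : (i <= n)%N by rewrite -ltnS.
have f0 m : (m`!)%:R != 0 :> K by rewrite pnatr_eq0 -lt0n fact_gt0.
rewrite /= !expr1n -(bin_fact ni) !natrM -[RHS]mulr_natl.
by field; rewrite !f0.
Qed.

Lemma ncexp_inv f : ncord 1 f -> ncinv (ncexp f) = ncexp (- f).
Proof. by move=> f1; apply/esym/ncinv_uniq; rewrite ?ncexp_nil ?ncexpNK. Qed.

Lemma ncexp_ad f g : ncord 1 f ->
  ncexp f * g = ncsum (fun n => (n`!)%:R^-1 *: iter n (lie f) g) * ncexp f.
Proof.
move=> f1; rewrite ncsumM; [|by move=> n; apply/ncordZ/ncordX_lie|exact: ncexp_ord].
rewrite ncsum_mulr; last exact: ncexp_ord.
apply: eq_ncsum => n; rewrite -scalerAl mulXr_ad scaler_sumr; apply: eq_bigr => i _.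
have ni : (i <= n)%N by rewrite -ltnS.
have f0 m : (m`!)%:R != 0 :> K by rewrite pnatr_eq0 -lt0n fact_gt0.
rewrite /=. rewrite -scalerAl -scalerAr [RHS]scalerA -[_ *+ 'C(_, _)]scaler_nat [LHS]scalerA; congr (_ *: _).
by rewrite -(bin_fact ni) !natrM; field; rewrite !f0 pnatr_eq0 -lt0n bin_gt0.
Qed.

(** The factor on the left is (e^x - 1)/x at x = ad(f), applied to the derivative of f. *)
Lemma ncdeg_exp f : ncord 1 f -> ncdeg (ncexp f) =
  ncsum (fun n => (n.+1`!)%:R^-1 *: iter n (lie f) (ncdeg f)) * ncexp f.
Proof.
move=> f1; rewrite ncsumM; [|by move=> n; apply/ncordZ/ncordX_lie|exact: ncexp_ord].
rewrite ncdeg_ncsum ncsum_recl; last by move=> n; apply/ncdeg_ord/ncexp_ord.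
rewrite expr0 ncdegZ ncdeg1 scaler0 add0r.
apply: eq_ncsum => n; rewrite ncdegZ ncdegX scaler_sumr; apply: eq_bigr => i _.
have ni : (i < n.+1)%N by [].
have f0 m : (m`!)%:R != 0 :> K by rewrite pnatr_eq0 -lt0n fact_gt0.
rewrite /=. rewrite -scalerAl -scalerAr [RHS]scalerA -[_ *+ 'C(_, _)]scaler_nat [LHS]scalerA; congr (_ *: _).
rewrite -(bin_fact ni) subSS !natrM; field.
by rewrite !f0 addrC natr1 !pnatr_eq0 /= -lt0n bin_gt0.
Qed.

(* The derivative formula for exp determines the degree-n part of [ncdeg (nclog g)]
   from [l] and from the parts of [nclog g] of degree < n. *)
Lemma p_lie_log g l : nccoef g [::] = 1 -> p_lie l -> ncdeg g = l * g -> p_lie (nclog g).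
Proof.
move=> g1 Pl dg; set f := nclog g.
have f1 : ncord 1 f := nclog_ord g.
pose u (e : ncseries K) n := ((n.+1`!)%:R^-1 : K) *: iter n (lie e) (ncdeg e).
have ou e : ncord 1 e -> forall n, ncord n (u e n).
  by move=> e1 n; apply/ncordZ/ncordX_lie.
have lE : ncsum (u f) = l.
  have := ncdeg_exp f1; rewrite nclogK // dg => E.
  by rewrite -[l]mulr1 -(ncmulxV g1) mulrA E -mulrA ncmulxV // mulr1.
have f0 : nccoef f [::] = 0 := nclog_nil g.
clearbody f; apply/degree_closureP; elim=> [|n [e Pe fe]].
  by exists 0; [exact: free_lie_0|].
have e1 : ncord 1 e by apply/ncord1P/free_lie_nil.
have /degree_closureP/(_ n.+1)[l' Pl' ll'] := Pl.
(* Isolating the term k = 0 gives [ncdeg f] as [l] minus terms that all contain a bracket with f;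
   these are known up to degree n from f in degrees below n. *)
pose z := l' - \sum_(k < n.+1) u e k.+1.
have Pu k : free_lie (u e k).
  apply: free_lie_Z; elim: k => [|k IHk]; first exact: free_lie_deg.
  exact: free_lie_br.
have Pz : free_lie z.
  by apply: free_lie_D => //; rewrite -scaleN1r; apply/free_lie_Z/free_lie_sum.
(* Inverse of the Euler derivation. At k = 0 the convention [0^-1 = 0] gives the zero constant term
   of f. *)
exists (\sum_(k < n.+1) (k%:R^-1 : K) *: nchom k z).
  by apply: free_lie_sum => i _; apply/free_lie_Z/free_lie_hom.
have fz : nceq n.+1 (ncdeg f) z.
  have -> : ncdeg f = l - ncsum (fun n => u f n.+1).
    have u0 : u f 0%N = ncdeg f by rewrite /u /= invr1 scale1r.
    by rewrite -lE ncsum_recl ?u0 ?addrK //; apply: ou.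
  apply: nceqB => //.
  apply: (nceq_trans (ncsum_nceq _ (leqnn _))) => [k|].
    by apply: ncord_leq (ou _ f1 _).
  apply: nceq_sum => k _; apply: nceqZ; rewrite !iterS.
  have P j : ncord 1 (iter j (lie f) (ncdeg f)) /\ ncord 1 (iter j (lie e) (ncdeg e)).
    elim: j => [|j [IH1 IH2]]; first by split; apply: ncdeg_ord1.
    by split; apply: (@ncord_lie _ 0 1).
  apply: nceq_lieS => //; [by have [] := P k|by have [] := P k|].
  elim: (k : nat) => [|j IHj]; first exact: ncdeg_nceq.
  exact: nceq_lie.
clearbody z; apply/nceqP => w wn; rewrite nccoef_sum (bigD1 (Ordinal wn)) //= eqxx big1 ?addr0; last first.
  move=> i iw /=; have [wi|_] := eqVneq (size w) i; rewrite ?mulr0 //.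
  by case/eqP: iw; apply/val_inj.
rewrite -((nceqP _ _ _).2 fz w wn) /=.
case: w {wn} => [|x w]; first by rewrite invr0 mul0r.
by rewrite mulrA mulVf ?mul1r // pnatr_eq0.
Qed.

Definition lie_exp g := exists2 f, p_lie f & g = ncexp f.

Lemma lie_exp_nil g : lie_exp g -> nccoef g [::] = 1.
Proof. by case=> f _ ->; apply: ncexp_nil. Qed.

(** A logarithmic derivative behaves simply under products and substitutions, unlike the logarithm
    itself. *)
Lemma lie_exp_deg g : lie_exp g <->
  nccoef g [::] = 1 /\ exists2 l, p_lie l & ncdeg g = l * g.
Proof.
split=> [[f Pf ->]|[g1 [l Pl dg]]]; last first.
  by exists (nclog g); rewrite ?nclogK //; apply: p_lie_log dg.
have f1 := p_lie_ord Pf.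
split; first exact: ncexp_nil.
eexists; last exact: ncdeg_exp.
apply: p_lie_ncsum => n; first by apply/ncordZ/ncordX_lie.
by apply/p_lieZ/p_lie_ad => //; apply: p_lie_deg.
Qed.

Lemma lie_exp_log g : lie_exp g -> p_lie (nclog g).
Proof. by move=> /lie_exp_deg[g1 [l Pl dg]]; apply: p_lie_log dg. Qed.

Lemma lie_expM f g : lie_exp f -> lie_exp g -> lie_exp (f * g).
Proof.
move=> Ef Eg; apply/lie_exp_deg.
have /lie_exp_deg[f1 [l Pl df]] := Ef; have /lie_exp_deg[g1 [m Pm dg]] := Eg.
split; first by rewrite nccoefM_nil f1 g1 mulr1.
case: Ef => x Px fE; have x1 := p_lie_ord Px.
(* The logarithmic derivative of f g is l + f m f^-1, and f m f^-1 = e^(ad x)(m) remains in p. *)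
exists (l + ncsum (fun n => (n`!)%:R^-1 *: iter n (lie x) m)).
  apply: p_lieD => //; apply: p_lie_ncsum => n; first by apply/ncordZ/ncordX_lie.
  exact/p_lieZ/p_lie_ad.
by rewrite ncdegM df dg !mulrDl [f * (m * g)]mulrA fE ncexp_ad // -!mulrA.
Qed.

Lemma lie_expV g : lie_exp g -> lie_exp (ncinv g).
Proof.
case=> f Pf ->; exists (- f); first exact: p_lieN.
exact/ncexp_inv/p_lie_ord.
Qed.

End ExpLogSeries.

(** * Substitution of Lie series in a group-like series *)

Fixpoint words n : seq (seq bool) :=
  if n is m.+1 then map (cons false) (words m) ++ map (cons true) (words m) else [:: [::]].

Lemma big_wordsS (V : nmodType) n (F : seq bool -> V) :
  \sum_(w <- words n.+1) F w = \sum_x \sum_(w <- words n) F (x :: w).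
Proof. by rewrite big_cat !big_map big_bool; apply: addrC. Qed.

(** Replaces the tuples of [ncsubst] by lists, on which inductions peel off the first letter. *)
Lemma big_words (V : nmodType) n (F : seq bool -> V) :
  \sum_(w : n.-tuple bool) F w = \sum_(w <- words n) F w.
Proof.
elim: n => [|n IHn] in F *.
  rewrite big_seq1 (bigD1 [tuple]) //= big1 ?addr0 // => w /negP[].
  by rewrite [w]tuple0.
rewrite big_wordsS.
under [RHS]eq_bigr => x _ do rewrite -(IHn (fun w => F (x :: w))).
rewrite pair_bigA /=.
rewrite (reindex (fun p : bool * n.-tuple bool => cons_tuple p.1 p.2)) //=.
exists (fun t : n.+1.-tuple bool => (thead t, behead_tuple t)) => [[x t] _|t _] /=.
  by congr (_, _); apply/val_inj.
by rewrite [RHS]tuple_eta; apply/val_inj.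
Qed.

Lemma size_words n w : w \in words n -> size w = n.
Proof.
elim: n w => [|n IHn] w; first by rewrite inE => /eqP ->.
by rewrite mem_cat => /orP[] /mapP[u /IHn <- ->].
Qed.

Section Unshuffle.
Variables (K : comNzRingType) (V : lmodType K).
Implicit Types (F : seq bool -> seq bool -> V) (f : ncseries K).

(* The unshuffle coproduct of [w], paired with [F]. *)
Fixpoint unsh (w : seq bool) F : V :=
  if w is x :: w' then unsh w' (fun u v => F (x :: u) v) + unsh w' (fun u v => F u (x :: v))
  else F [::] [::].

Lemma eq_unsh w F F' : (forall u v, F u v = F' u v) -> unsh w F = unsh w F'.
Proof. by elim: w F F' => //= x w IHw F F' FF'; congr (_ + _); apply: IHw. Qed.
Lemma unshD w F F' : unsh w (fun u v => F u v + F' u v) = unsh w F + unsh w F'.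
Proof. by elim: w F F' => //= x w IHw F F'; rewrite !IHw addrACA. Qed.
Lemma unsh_nil w (G : seq bool -> V) : unsh w (fun u v => (u == [::])%:R *: G v) = G w.
Proof.
elim: w G => [|x w IHw] G /=; first by rewrite scale1r.
rewrite IHw (@eq_unsh _ _ (fun u v => (u == [::])%:R *: (0 : V))) ?IHw ?add0r // => u v.
by rewrite scale0r scaler0.
Qed.

(** Unshuffling is dual to shuffling: w splits into (u, v) as many times as it occurs in
    [shuffle u v]. *)
Lemma unsh_pairing n f F : \sum_(w <- words n) nccoef f w *: unsh w F =
  \sum_(i < n.+1) \sum_(u <- words i) \sum_(v <- words (n - i)) sh f u v *: F u v.
Proof.
elim: n => [|n IHn] in f F *; first by rewrite big_ord1 !big_seq1 sh0s.
(* The two parts of [sh f u v], according to whether the first letter of the shuffle comes from u or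
   from v. *)
pose shl u v := if u is x :: u' then sh (ncL x f) u' v else 0.
pose shr u v := if v is y :: v' then sh (ncL y f) u v' else 0.
transitivity (\sum_(i < n.+2) \sum_(u <- words i) \sum_(v <- words (n.+1 - i))
    (shl u v *: F u v + shr u v *: F u v)); last first.
  apply: eq_bigr => i _; rewrite big_seq [RHS]big_seq; apply: eq_bigr => u /size_words su.
  rewrite big_seq [RHS]big_seq; apply: eq_bigr => v /size_words sv.
  rewrite -scalerDl; congr (_ *: _); case: u v su sv => [|x u] [|y v] /= su sv.
  - by have := ltn_ord i; lia.
  - by rewrite add0r !sh0s.
  - by rewrite addr0 !shs0.
  - by rewrite sh_cons.
under [RHS]eq_bigr => i _ do
  (under eq_bigr => u _ do rewrite big_split /=; rewrite big_split /=).
rewrite big_split /= [X in _ = X + _]big_ord_recl big_seq1.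
rewrite [X in _ = X + _ + _]big1 ?add0r; last by move=> v _; rewrite scale0r.
rewrite [X in _ = _ + X]big_ord_recr /= subnn.
rewrite [X in _ = _ + (_ + X)]big1 ?addr0; last first.
  by move=> u _; rewrite big_seq1 scale0r.
have El : \sum_(i < n.+1) \sum_(u <- words (bump 0 i)) \sum_(v <- words (n.+1 - bump 0 i))
    shl u v *: F u v = \sum_x \sum_(i < n.+1) \sum_(u <- words i) \sum_(v <- words (n - i))
    sh (ncL x f) u v *: F (x :: u) v.
  by rewrite exchange_big; apply: eq_bigr => i _; rewrite /bump [(0 <= i)%N]leq0n add1n big_wordsS subSS.
have Er : \sum_(i < n.+1) \sum_(u <- words i) \sum_(v <- words (n.+1 - i))
    shr u v *: F u v = \sum_x \sum_(i < n.+1) \sum_(u <- words i) \sum_(v <- words (n - i))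
    sh (ncL x f) u v *: F u (x :: v).
  rewrite [RHS]exchange_big; apply: eq_bigr => i _; rewrite subSn -1?ltnS //.
  by rewrite [RHS]exchange_big; apply: eq_bigr => u _; rewrite big_wordsS.
rewrite [X in _ = X + _]El Er -big_split big_wordsS; apply: eq_bigr => x _ /=.
rewrite -!IHn -big_split; apply: eq_bigr => w _.
by rewrite scalerDr.
Qed.

End Unshuffle.

Section GroupLikeSubstitution.
Variable K : numFieldType.
Implicit Types (f g : ncseries K).
Variables y z : ncseries K.
Hypotheses (Py : p_lie y) (Pz : p_lie z).

Let s x := if x then z else y.
Let W (w : seq bool) := \prod_(x <- w) s x.

Let s1 x : ncord 1 (s x). Proof. by case: x; apply: p_lie_ord. Qed.
Let Ps x : p_lie (s x). Proof. by case: x. Qed.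
Lemma ncsubstE f :
  ncsubst f y z = ncsum (fun n => \sum_(w <- words n) nccoef f w *: W w).
Proof. by apply: eq_ncsum => n; rewrite (big_words n (fun w => nccoef f w *: W w)). Qed.

Let W_ord w : ncord (size w) (W w).
Proof. by elim: w => [//|x w IHw]; rewrite /W big_cons -[size _]/(1 + size w)%N; apply: ncordM. Qed.

Lemma subst_ord f n : ncord n (\sum_(w <- words n) nccoef f w *: W w).
Proof.
rewrite big_seq; apply: ncord_sum => w /size_words wn.
by apply: ncordZ; rewrite -wn; apply: W_ord.
Qed.

Lemma ncsubst_nil f : nccoef (ncsubst f y z) [::] = nccoef f [::].
Proof. by rewrite ncsubstE /= big_ord1 big_seq1 /W big_nil /= mulr1. Qed.

(* Dynkin's right-normed bracketing, with the degree derivation in the innermost place. *)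
Fixpoint dynkin (w : seq bool) : ncseries K :=
  if w is x :: w' then lie (s x) (dynkin w') + (w' == [::])%:R *: ncdeg (s x) else 0.

Lemma dynkin_ord w : ncord (size w) (dynkin w).
Proof.
elim: w => [//|x w IHw] /=; apply: ncordD; first by rewrite -add1n; apply: ncord_lie.
by case: w {IHw} => [|x' w]; rewrite ?scale0r // scale1r; apply: ncdeg_ord1.
Qed.

Lemma dynkin_p_lie w : p_lie (dynkin w).
Proof.
elim: w => [|x w IHw] /=; first exact: p_lie0.
by apply: p_lieD; [exact: p_lie_lie|apply: p_lieZ; exact: p_lie_deg].
Qed.

Lemma unsh_mull w c (F : seq bool -> seq bool -> ncseries K) :
  unsh w (fun u v => c * F u v) = c * unsh w F.
Proof. by elim: w F => //= x w IHw F; rewrite !IHw mulrDr. Qed.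

(** The convolution of the Dynkin operator with the identity is the degree derivation: prefixing a
    letter x to either part, the two products with [s x] in the middle cancel. *)
Lemma unsh_dynkin w : unsh w (fun u v => dynkin u * W v) = ncdeg (W w).
Proof.
elim: w => [|x w IHw]; first by rewrite /= mul0r /W big_nil ncdeg1.
rewrite /= -unshD.
transitivity (unsh w (fun u v => s x * (dynkin u * W v) +
   (u == [::])%:R *: (ncdeg (s x) * W v))).
  apply: eq_unsh => u v; rewrite {2}/W big_cons -/(W v) lieE mulrDl mulrBl.
  by rewrite -scalerAl !mulrA addrAC subrK.
by rewrite unshD unsh_mull IHw unsh_nil /W big_cons -/(W w) ncdegM addrC.
Qed.

(** Group-likeness factors the sum over unshufflings, so the Euler derivative of the substituted
    series is its Dynkin image, an element of p, times the series. *)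
Lemma lie_exp_subst f : glike f -> lie_exp (ncsubst f y z).
Proof.
move=> [f1 fsh]; apply/lie_exp_deg; split; first by rewrite ncsubst_nil.
have rho_ord n : ncord n (\sum_(w <- words n) nccoef f w *: dynkin w).
  rewrite big_seq; apply: ncord_sum => w /size_words wn.
  by apply: ncordZ; rewrite -wn; apply: dynkin_ord.
exists (ncsum (fun n => \sum_(w <- words n) nccoef f w *: dynkin w)).
  apply: p_lie_ncsum => // n; apply: p_lie_sum => w _; apply: p_lieZ.
  exact: dynkin_p_lie.
rewrite ncsubstE ncdeg_ncsum ncsumM //; last exact: subst_ord.
apply: eq_ncsum => n.
transitivity (\sum_(w <- words n) nccoef f w *: unsh w (fun u v => dynkin u * W v)).
  have degS := big_morph (@ncdeg K) (@ncdegD K).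
  rewrite (degS 0); last by apply: ncseriesP => w; rewrite /= mulr0.
  by apply: eq_bigr => w _; rewrite unsh_dynkin ncdegZ.
rewrite unsh_pairing; apply: eq_bigr => i _.
rewrite mulr_suml; apply: eq_bigr => u _; rewrite mulr_sumr; apply: eq_bigr => v _.
by rewrite fsh -scalerAl -scalerAr [RHS]scalerA.
Qed.

End GroupLikeSubstitution.

(** * Abelianisation and Fox derivative of exponentials and substitutions *)

Section Composition.
Variable K : comNzRingType.
Implicit Types (c : nat -> K) (P G : {fps {fps K}}).

(** Substitution of P in the series with coefficients c; stopping at n = k + l is exact once P has
    no constant term. *)
Definition uvcomp c P : {fps {fps K}} :=
  FPS (fun k => FPS (fun l => \sum_(n < (k + l).+1) c n * coefUV (P ^+ n) k l)).

Lemma coef_uvcomp c P k l N : coefUV P 0 0 = 0 -> (k + l < N)%N ->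
  coefUV (uvcomp c P) k l = \sum_(n < N) c n * coefUV (P ^+ n) k l.
Proof.
move=> P0 klN; rewrite {1}/coefUV /=.
rewrite (big_ord_widen N (fun n => c n * coefUV (P ^+ n) k l) klN) big_mkcond /=.
by apply: eq_bigr => n _; case: ltnP => // kln; rewrite coefUVX_small ?mulr0.
Qed.

Lemma coef_uvcompM c P G k l N : coefUV P 0 0 = 0 -> (k + l < N)%N ->
  coefUV (uvcomp c P * G) k l = \sum_(n < N) c n * coefUV (P ^+ n * G) k l.
Proof.
move=> P0 klN; rewrite coefUVM.
transitivity (\sum_(i < k.+1) \sum_(j < l.+1) \sum_(n < N)
    c n * (coefUV (P ^+ n) i j * coefUV G (k - i) (l - j))).
  apply: eq_bigr => i _; apply: eq_bigr => j _; rewrite (coef_uvcomp _ _ (N := N)) //.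
    by rewrite mulr_suml; apply: eq_bigr => n _; rewrite mulrA.
  by have := ltn_ord i; have := ltn_ord j; lia.
under eq_bigr do rewrite exchange_big /=.
rewrite exchange_big; apply: eq_bigr => n _; rewrite coefUVM mulr_sumr.
by apply: eq_bigr => i _; rewrite mulr_sumr.
Qed.

Lemma coefUVX_const (t : K) k l n : coefUV ((constUV t * varV K) ^+ n) k l =
  ((k == 0%N) && (l == n))%:R * t ^+ n.
Proof.
elim: n k l => [|n IHn] k l; first by rewrite expr0 coefUV1 mulr1.
rewrite exprS -mulrA coefUV_constM coefUV_VM; case: l => [|l].
  by rewrite andbF mulr0 mul0r.
by rewrite IHn eqSS exprS mulrCA.
Qed.

Lemma uvcomp_V c t : uvcomp c (constUV t * varV K) = inV (fps_scalevar t (FPS c)).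
Proof.
apply: UVP => k l; rewrite coefUV_inV /coefUV /= -/(coefUV _ _ _).
under eq_bigr do rewrite -/(coefUV _ k l) coefUVX_const.
case: eqP => [->|k0] /=; last by rewrite big1 // => n _; rewrite mul0r mulr0.
rewrite big_ord_recr /= eqxx mul1r big1 ?add0r 1?mulrC // => n _.
by rewrite gtn_eqF ?mul0r ?mulr0.
Qed.

Lemma uvcomp_U c : uvcomp c (varU K) = inU (FPS c).
Proof.
have UX n k l : coefUV (varU K ^+ n) k l = ((k == n) && (l == 0%N))%:R.
  by rewrite -[_ ^+ n]mulr1 -(expr0 (varV K)) coefUV_UV.
apply: UVP => k l; rewrite coefUV_inU /coefUV /=.
under eq_bigr do rewrite -/(coefUV _ k l) UX.
case: eqP => [->|l0]; last by rewrite big1 // => n _; rewrite andbF mulr0.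
rewrite addn0 big_ord_recr /= eqxx mulr1 big1 ?add0r // => n _.
by rewrite gtn_eqF ?mulr0.
Qed.

Lemma uvcomp_0 c : uvcomp c 0 = constUV (c 0%N).
Proof.
apply: UVP => k l; rewrite coefUV_const /coefUV /= big_ord_recl.
rewrite -/(coefUV _ k l) expr0 coefUV1 big1 ?addr0; last first.
  by move=> n _; rewrite expr0n mulr0.
by case: ifP; rewrite ?mulr1 ?mulr0.
Qed.

End Composition.

Section AbelFoxExp.
Variable K : numFieldType.
Implicit Types (f g y z : ncseries K).

Lemma coef_abel00 f : coefUV (abel f) 0 0 = nccoef f [::].
Proof. by rewrite coef_abel sh0s. Qed.

Lemma abel_exp f : nccoef f [::] = 0 ->
  abel (ncexp f) = uvcomp (fun n => (n`!)%:R^-1) (abel f).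
Proof.
move=> /[dup] f0 /ncord1P f1; apply: UVP => k l.
rewrite (coef_uvcomp _ _ (N := (k + l).+1)) ?coef_abel00 //.
rewrite (abel_nceq (ltnSn _) (ncsum_nceq (ncexp_ord f1) (leqnn _))).
rewrite abel_sum coefUV_sum; apply: eq_bigr => n _.
by rewrite abelZ coefUV_constM abelX.
Qed.

Lemma fox_exp f : nccoef f [::] = 0 ->
  fox (ncexp f) = uvcomp (fun n => (n.+1`!)%:R^-1) (abel f) * fox f.
Proof.
move=> /[dup] f0 /ncord1P f1; apply: UVP => k l.
rewrite (coef_uvcompM _ _ (N := (k + l).+1)) ?coef_abel00 //.
rewrite (fox_nceq (ltnSn _) (ncsum_nceq (ncexp_ord f1) (leqnn _))).
rewrite fox_sum coefUV_sum big_ord_recl foxZ fox1 mulr0 coefUV0 add0r.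
by apply: eq_bigr => n _; rewrite foxZ coefUV_constM foxXS.
Qed.

Lemma fox_inv f : nccoef f [::] = 1 -> abel f = 1 -> fox (ncinv f) = - fox f.
Proof.
move=> f1 pf; have := congr1 (@fox K) (ncmulxV f1).
by rewrite foxM ncinv_nil constUV1 pf !mul1r fox1 => /eqP; rewrite addr_eq0 => /eqP.
Qed.

Lemma abel_inv f : nccoef f [::] = 1 -> abel f = 1 -> abel (ncinv f) = 1.
Proof.
by move=> f1 pf; have := congr1 (@abel K) (ncmulxV f1); rewrite abelM pf mul1r abel1.
Qed.

Section Subst.
Variables y z : ncseries K.
Hypotheses (Py : p_lie y) (Pz : p_lie z) (pz : abel z = 0).
Let W (w : seq bool) := \prod_(x <- w) (if x then z else y).

Lemma abel_words f n : abel (\sum_(w <- words n) nccoef f w *: W w) =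
  constUV (nccoef f (nseq n false)) * abel y ^+ n.
Proof.
elim: n f => [|n IHn] f; first by rewrite big_seq1 abelZ /W big_nil abel1 expr0.
rewrite big_wordsS big_bool abelD !abel_sum /=.
rewrite big1 ?add0r => [|w _]; last by rewrite abelZ /W big_cons abelM pz mul0r mulr0.
rewrite exprS mulrCA -(IHn (ncL false f)) abel_sum mulr_sumr; apply: eq_bigr => w _.
by rewrite !abelZ {1}/W big_cons abelM mulrCA.
Qed.

(** Only the last letter is differentiated and the others are abelianised, so a z in an earlier
    place kills the word. *)
Lemma fox_words f n : fox (\sum_(w <- words n.+1) nccoef f w *: W w) =
  abel y ^+ n * (constUV (nccoef f (rcons (nseq n false) true)) * fox z
                 + constUV (nccoef f (nseq n.+1 false)) * fox y).
Proof.
have W1 x : W [:: x] = if x then z else y by rewrite /W big_seq1.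
have WS x v w : fox (W [:: x, v & w]) = abel (if x then z else y) * fox (W (v :: w)).
  rewrite {1}/W big_cons foxM -/(W (v :: w)) {2}/W big_cons nccoefM_nil.
  have -> : nccoef (if v then z else y) [::] = 0 by case: v; apply: p_lie_nil.
  by rewrite mul0r constUV0 mul0r addr0.
elim: n f => [|n IHn] f.
  by rewrite !big_cons big_nil addr0 foxD !foxZ !W1 expr0 mul1r addrC.
transitivity (\sum_x \sum_(w <- words n.+1)
    constUV (nccoef f (x :: w)) * (abel (if x then z else y) * fox (W w))).
  rewrite big_wordsS fox_sum; apply: eq_bigr => x _.
  rewrite fox_sum !big_wordsS; apply: eq_bigr => v _; apply: eq_bigr => w _.
  by rewrite foxZ WS.
rewrite big_bool /= big1 ?add0r => [|w _]; last by rewrite pz mul0r mulr0.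
rewrite exprS -mulrA -(IHn (ncL false f)) fox_sum mulr_sumr.
by apply: eq_bigr => w _; rewrite foxZ mulrCA.
Qed.

Variable f : ncseries K.
Hypothesis f0 : forall n, nccoef f (nseq n false) = (n == 0%N)%:R.

Lemma abel_subst : abel (ncsubst f y z) = 1.
Proof.
have o := subst_ord Py Pz f; apply: UVP => k l; rewrite ncsubstE //.
rewrite (abel_nceq (ltnSn _) (ncsum_nceq o (leqnn _))) abel_sum.
rewrite big_ord_recl abel_words f0 expr0 constUV1 mulr1 big1 ?addr0 // => n _.
by rewrite abel_words f0 constUV0 mul0r.
Qed.

Lemma fox_subst : fox (ncsubst f y z) =
  uvcomp (fun n => nccoef f (rcons (nseq n false) true)) (abel y) * fox z.
Proof.
have o := subst_ord Py Pz f; apply: UVP => k l; rewrite ncsubstE //.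
rewrite (fox_nceq (ltnSn _) (ncsum_nceq o (leqnn _))) fox_sum coefUV_sum.
rewrite (coef_uvcompM _ _ (N := (k + l).+1)) ?coef_abel00 ?p_lie_nil //.
rewrite big_ord_recl big_seq1 foxZ big_nil fox1 mulr0 coefUV0 add0r.
apply: eq_bigr => n _; rewrite lift0 fox_words f0 constUV0 mul0r addr0.
by rewrite mulrCA coefUV_constM.
Qed.

End Subst.
End AbelFoxExp.

(** * Bernoulli numbers *)

Section Bernoulli.

Definition bser : {fps rat} := FPS (fun k => bernoulli_num k / k`!%:R).
Definition eser : {fps rat} := FPS (fun n => (n.+1)`!%:R^-1).

(* T Ber' = Ber - Ber^2 - T Ber. *)
Lemma bser_riccati : fpsdeg bser = bser - bser * bser - fpsX * bser.
Proof.
have EB : eser * bser = 1 := bernoulli_gen.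
have dE : fpsdeg eser = 1 + fpsX * eser - eser.
  apply: fpsP => n; rewrite !fpscoefD fpscoefN fpscoefXM fpscoef1.
  case: n => [|n] /=; first by rewrite mul0r addr0 invr1 subrr.
  by rewrite add0r -(invfS _ n.+1) -[n.+2%:R]natr1; ring.
have d1 : fpsdeg eser * bser + eser * fpsdeg bser = 0.
  rewrite -fpsdegM EB; apply: fpsP => -[|n] /=; by rewrite ?mul0r ?mulr0.
have : fpsdeg bser = - (bser * bser) * fpsdeg eser.
  have := congr1 (fun f => bser * f) d1; rewrite mulr0 mulrDr !mulrA [bser * eser]mulrC EB mul1r.
  by move=> /eqP; rewrite addrC addr_eq0 => /eqP ->; ring.
move=> ->; rewrite dE.
have -> : - (bser * bser) * (1 + fpsX * eser - eser) =
  - (bser * bser) - fpsX * bser * (eser * bser) + bser * (eser * bser) by ring.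
by rewrite EB; ring.
Qed.

(** Coefficients of (x/2) coth(x/2), that is of x/(e^x - 1) + x/2: the correction removes B_1. *)
Definition beta n : rat := fpscoef bser n + (n == 1%N)%:R / 2.

Lemma beta_rec n : (1 < n)%N ->
  n.+1%:R * beta n = - \sum_(i < n.-1) beta i.+1 * beta (n - i.+1) + (n == 2%N)%:R / 4.
Proof.
case: n => [|[|n]] // _.
pose B : {fps rat} := bser + fpsC 2^-1 * fpsX.
have BE k : fpscoef B k = beta k by rewrite /B fpscoefD fpscoefCM mulrC.
(* Adding T/2 completes the square in the Riccati equation and removes the term T Ber. *)
have dB : fpsdeg B = B - B * B + fpsC 4^-1 * fpsX * fpsX.
  have -> : fpsdeg B = fpsdeg bser + fpsC 2^-1 * fpsX.
    apply: fpsP => k; rewrite fpscoefD -[LHS]/(k%:R * fpscoef B k).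
    rewrite -[fpscoef (fpsdeg _) k]/(k%:R * fpscoef bser k) /B fpscoefD mulrDr !fpscoefCM.
    by congr (_ + _); case: k => [|[|k]]; rewrite /= ?mulr0 ?mul1r.
  have -> : fpsC (4^-1) = fpsC 2^-1 * fpsC 2^-1 :> {fps rat}.
    by rewrite -fpsCM; congr fpsC.
  have h2 : fpsC 2^-1 + fpsC 2^-1 = 1 :> {fps rat} by rewrite -fpsCD -[RHS]fpsC1; congr fpsC.
  rewrite bser_riccati /B; set h := fpsC 2^-1 in h2 *.
  have -> : fpsX * bser = (h + h) * fpsX * bser by rewrite h2 mul1r.
  by ring.
have beta0 : beta 0 = 1 by rewrite /beta /= mul0r addr0 divr1.
have : n.+2%:R * beta n.+2 = beta n.+2 - fpscoef (B * B) n.+2 + (n == 0%N)%:R / 4.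
  rewrite -BE -[LHS]/(fpscoef (fpsdeg B) n.+2) dB !fpscoefD fpscoefN.
  congr (_ + _); rewrite -mulrA fpscoefCM fpscoefXM mulrC; congr (_ / _).
(* The two extreme terms of the square are both [beta n.+2]; moved to the left they turn the factor
   n + 2 into n + 3. *)
rewrite fpscoefM big_ord_recl big_ord_recr lift0 subn0 subnn !BE beta0 mul1r mulr1.
have -> : \sum_(i < n.+1) fpscoef B (lift ord0 (widen_ord (leqnSn n.+1) i)) *
    fpscoef B (n.+2 - lift ord0 (widen_ord (leqnSn n.+1) i)) =
    \sum_(i < n.+1) beta i.+1 * beta (n.+2 - i.+1).
  by apply: eq_bigr => i _; rewrite !BE lift0.
move=> E; rewrite -[n.+3%:R]natr1 [LHS]mulrDl mul1r [X in X + _ = _]E.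
rewrite !eqSS [n.+2.-1]/=; move: (beta n.+2) (\sum_(i < n.+1) _) => x y /=; ring.
Qed.

Lemma bernoulli_num0 : bernoulli_num 0 = 1.
Proof. by []. Qed.

Lemma bernoulli_num1 : bernoulli_num 1 = - 2^-1.
Proof. by rewrite /bernoulli_num /= big_ord1 bin0 mul1r mulr1. Qed.

Lemma beta1 : beta 1 = 0.
Proof. by rewrite /beta /= bernoulli_num1 divr1 mul1r addNr. Qed.

(** At odd n, each product in the recurrence has one odd index. *)
Lemma beta_odd n : odd n -> beta n = 0.
Proof.
have [m] := ubnP n; elim: m => // m IHm in n *; rewrite ltnS => nm.
case: n nm => [|[|n]] // nm on; first exact: beta1.
have n0 : n.+3%:R != 0 :> rat by rewrite pnatr_eq0.
apply: (mulfI n0); rewrite beta_rec // mulr0 big1 ?oppr0 ?add0r.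
  by case: n on {nm n0} => //= n; rewrite mul0r.
move=> i _; have := ltn_ord i => /= iN.
have [oi|ei] := boolP (odd i.+1); first by rewrite IHm ?mul0r //; lia.
rewrite [X in _ * X]IHm ?mulr0 //; first lia.
by rewrite oddB ?on ?(negPf ei) //; lia.
Qed.

Lemma sum_odd (V : nmodType) (F : nat -> V) k : (forall j, F j.*2 = 0) ->
  \sum_(i < k.*2.+1) F i = \sum_(j < k) F j.*2.+1.
Proof.
move=> F0; elim: k => [|k IHk]; first by rewrite big_ord1 (F0 0%N) big_ord0.
by rewrite doubleS big_ord_recr big_ord_recr IHk [RHS]big_ord_recr /= -doubleS F0 addr0.
Qed.

Lemma beta_even_rec m : (1 < m)%N ->
  (m.*2.+1)%:R * beta m.*2 = - \sum_(i < m.-1) beta i.+1.*2 * beta (m - i.+1).*2.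
Proof.
case: m => [|[|m]] // _; rewrite beta_rec // mul0r addr0; congr (- _).
rewrite (@sum_odd _ (fun i => beta i.+1 * beta (m.+2.*2 - i.+1)) m.+1) => [|j].
  by apply: eq_bigr => i _; rewrite doubleB doubleS.
by rewrite beta_odd ?mul0r //= odd_double.
Qed.

Lemma beta_bernoulli n : (1 < n)%N -> beta n = bernoulli_num n / n`!%:R.
Proof. by case: n => [|[|n]] // _; rewrite /beta mul0r addr0. Qed.

End Bernoulli.

Local Opaque uvcomp abel fox coefUV ncsum nc_mul nc_add nc_opp nc_scale.

(** * The components of A_oo and B_oo *)

Section SubstLetters.
Variable K : numFieldType.
Variables y z : ncseries K.
Hypotheses (Py : p_lie y) (Pz : p_lie z).

Lemma ncsubst_letter x : ncsubst (letter K x) y z = if x then z else y.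
Proof.
rewrite ncsubstE (@ncsum_fin _ 2); last exact: subst_ord.
  rewrite big_ord_recl big_ord1 big_seq1 /= scale0r add0r !big_cons !big_nil !mulr1 addr0.
  by case: x; rewrite /= scale0r scale1r ?addr0 ?add0r.
move=> n n2; rewrite big_seq big1 // => w /size_words wn.
by case: w wn => [|v [|v' w]] wn; rewrite /= ?eqseq_cons ?andbF ?scale0r //; rewrite -wn in n2.
Qed.

Lemma ncsubstN f : ncsubst (- f) y z = - ncsubst f y z.
Proof.
rewrite !ncsubstE ncsumN; apply: eq_ncsum => n.
by rewrite -sumrN; apply: eq_bigr => w _; rewrite nccoefN scaleNr.
Qed.

Lemma ncsubstD f g : ncsubst (f + g) y z = ncsubst f y z + ncsubst g y z.
Proof.
rewrite !ncsubstE ncsumD; apply: eq_ncsum => n.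
by rewrite -big_split; apply: eq_bigr => w _; rewrite nccoefD scalerDl.
Qed.
End SubstLetters.

Section LinearAbel.
Variable K : numFieldType.

Lemma abel_p_lie (f : ncseries K) : p_lie f ->
  abel f = constUV (coefUV (abel f) 1 0) * varU K + constUV (coefUV (abel f) 0 1) * varV K.
Proof.
move=> /degree_closureP Pf; apply: UVP => k l.
case: (Pf (k + l).+2) => g /free_lie_rep3[al [be [F /abel_rep3 pg]]] fg.
have kl : (k + l < (k + l).+2)%N by lia.
rewrite !(@abel_nceq _ _ _ _ _ _ _ fg) // pg !(coefUVD, coefUV_constM, coefUV_U, coefUV_V) /=.
by rewrite !mulr1 !mulr0 addr0 add0r.
Qed.

(** The abelianisation of an element of p is linear, and exp is 1 + x up to degree one, so comparing
    degree one suffices. *)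
Lemma abel_log (f : ncseries K) al be : p_lie f ->
  abel (ncexp f) = uvcomp (fun n => (n`!)%:R^-1) (constUV al * varU K + constUV be * varV K) ->
  abel f = constUV al * varU K + constUV be * varV K.
Proof.
move=> Pf; have f0 := p_lie_nil Pf; rewrite (abel_exp f0) => E.
have P0 : coefUV (constUV al * varU K + constUV be * varV K) 0 0 = 0.
  by rewrite !(coefUVD, coefUV_constM, coefUV_U, coefUV_V) !mulr0 addr0.
have c1 k l P : coefUV P 0 0 = 0 -> (k + l = 1)%N ->
    coefUV (uvcomp (fun n => (n`!)%:R^-1) P) k l = coefUV P k l :> K.
  move=> P00 kl; have kl2 : (k + l < 2)%N by rewrite kl.
  rewrite (coef_uvcomp _ P00 kl2) big_ord_recl big_ord1.
  rewrite expr0 expr1 coefUV1 /= invr1 !mul1r.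
  have -> : (k == 0%N) && (l == 0%N) = false by apply/negP => /andP[/eqP k0 /eqP l0]; move: kl; rewrite k0 l0.
  by rewrite add0r.
have p00 : coefUV (abel f) 0 0 = 0 by rewrite coef_abel00.
have e k l : (k + l = 1)%N -> coefUV (abel f) k l =
    coefUV (constUV al * varU K + constUV be * varV K) k l.
  by move=> kl; rewrite -(c1 _ _ _ p00 kl) E (c1 _ _ _ P0 kl).
rewrite [LHS](abel_p_lie Pf) (e 1%N 0%N erefl) (e 0%N 1%N erefl).
rewrite !(coefUVD, coefUV_constM, coefUV_U, coefUV_V).
by rewrite !mulr1 !mulr0 addr0 add0r.
Qed.

End LinearAbel.

Section ScaledSeries.
Variable K : comNzRingType.
Implicit Types (t : K) (f g : {fps K}).

Lemma fps_scalevarM t f g : fps_scalevar t (f * g) = fps_scalevar t f * fps_scalevar t g.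
Proof.
apply: fpsP => n; rewrite fpscoefM /= mulr_sumr; apply: eq_bigr => i _.
have ni : (i <= n)%N by rewrite -ltnS.
by rewrite -{1}(subnKC ni) exprD; ring.
Qed.
Lemma fps_scalevarD t f g : fps_scalevar t (f + g) = fps_scalevar t f + fps_scalevar t g.
Proof. by apply: fpsP => n; rewrite fpscoefD /= mulrDr. Qed.
Lemma fps_scalevar1 t : fps_scalevar t 1 = 1.
Proof. by apply: fpsP => -[|n]; rewrite /= ?mulr0 // mulr1. Qed.
Lemma fps_scalevarX t : fps_scalevar t fpsX = fpsC t * fpsX.
Proof. by apply: fpsP => n; rewrite fpscoefCM /=; case: n => [|[|n]]; rewrite ?mulr0. Qed.
End ScaledSeries.

Section Components.
Variable C : numFieldType.
Local Notation a := (letter C false).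
Local Notation U := (varU C).
Local Notation V := (varV C).

Definition bserC : {fps C} := FPS (fun k => ratr (bernoulli_num k) / k`!%:R).
Definition eserC : {fps C} := FPS (fun n => (n.+1)`!%:R^-1).
Definition expC : {fps C} := FPS (fun n => n`!%:R^-1).

Lemma bserC_eserC : bserC * eserC = 1.
Proof.
rewrite mulrC; apply: fpsP => n; rewrite fpscoefM.
have := congr1 (fun f => ratr (fpscoef f n) : C) bernoulli_gen.
rewrite fpscoefM rmorph_sum !fpscoef1 rmorph_nat => <-; apply: eq_bigr => i _.
by rewrite /= rmorphM fmorph_div fmorphV !rmorph_nat.
Qed.

Lemma expC_eserC : expC = 1 + fpsX * eserC.
Proof.
by apply: fpsP => -[|n]; rewrite fpscoefD fpscoefXM /= ?invr1 ?addr0 ?add0r.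
Qed.

Lemma bserC_cseries : bserC = 1 - fpsC 2^-1 * fpsX + fpsX * cseries C.
Proof.
apply: fpsP => n; rewrite !fpscoefD fpscoefN fpscoefCM fpscoefXM.
case: n => [|[|n]]; rewrite [LHS]/= ?bernoulli_num0 ?bernoulli_num1 /=.
- by rewrite rmorph1 mulr0 divr1 subr0 addr0.
- by rewrite rmorphN fmorphV rmorph_nat mulr1 add0r divr1 addr0.
- by rewrite mulr0 subr0 add0r.
Qed.

Variables (t : C) (z : nat -> C).
(** Euler's formula for even n and the vanishing of odd Bernoulli numbers in one equation, with t
    for 2 pi i and z n for zeta(n). *)
Hypothesis zE : forall n, (1 < n)%N ->
  ratr (bernoulli_num n) / n`!%:R * t ^+ n / 2 + z n = if odd n then z n else 0.

Definition oddz d : {fps C} :=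
  FPS (fun m => let n := (m + d)%N in if (3 <= n)%N && odd n then z n else 0).

(** The series of the coefficients Phi(x_0^n x_1); its zero constant term reflects that Phi has no
    linear part. *)
Definition zser : {fps C} := FPS (fun n => if n == 0%N then 0 else - z n.+1).

(** Half of the Bernoulli series cancels the even zeta values, and its linear term, from B_1 = -1/2,
    leaves -t/4. *)
Lemma fpsseries_A : fpsC 2^-1 * fps_scalevar t bserC - fpsX * zser =
  fpsC 2^-1 - fpsC (t * 2^-1 * 2^-1) * fpsX + oddz 0.
Proof.
apply: fpsP => n; rewrite !fpscoefD !fpscoefN !fpscoefCM fpscoefXM /=.
case: n => [|[|n]] /=.
- by rewrite bernoulli_num0 rmorph1 -[0`!]/1%N; field.
- by rewrite bernoulli_num1 rmorphN fmorphV rmorph_nat -[1`!]/1%N; field.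
- have -> : 2^-1 * (t ^+ n.+2 * (ratr (bernoulli_num n.+2) / (n.+2)`!%:R)) - - z n.+2 =
    ratr (bernoulli_num n.+2) / (n.+2)`!%:R * t ^+ n.+2 / 2 + z n.+2 by ring.
  rewrite zE // mulr0 subr0 add0r !addn0 /=.
  by case: n => [|n].
Qed.

(** The difference retains the odd powers, which carry even zeta values and hence Bernoulli numbers;
    the sum, in [fpsseries_B2], retains the odd zeta values. *)
Lemma fpsseries_B1 : fps_scalevar (- 1) zser - zser = - (fpsC t * fps_scalevar t (cseries C)).
Proof.
apply: fpsP => n; rewrite fpscoefD !fpscoefN fpscoefCM /=.
case: n => [|n] /=; first by rewrite !mulr0 !oppr0 addr0.
have := zE (n := n.+2) isT; rewrite [t ^+ n.+2]exprS [odd n.+2]/= negbK -signr_odd [odd n.+1]/=.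
move: (ratr _ / _) (z n.+2) (t ^+ n.+1) => x y T.
case: (odd n) => E; rewrite [~~ _]/= ?expr0 ?expr1.
  have e : x * (t * T) / 2 = 0 by apply: (addIr y); rewrite E add0r.
  transitivity (- (2 * (x * (t * T) / 2))); last by field.
  by rewrite e; ring.
have -> : y = - (x * (t * T) / 2) by apply/eqP; rewrite -addr_eq0 addrC E.
by field.
Qed.

Lemma fpsseries_B2 : fps_scalevar (- 1) zser + zser = - (oddz 1 + oddz 1).
Proof.
apply: fpsP => n; rewrite fpscoefD fpscoefN fpscoefD /=.
case: n => [|n] /=; first by rewrite !mulr0 !addr0 oppr0.
rewrite -signr_odd /= !addn1 /= negbK.
by case: n => [|n] /=; [|case: (odd n) => /=]; rewrite ?expr0 ?expr1; ring.
Qed.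

(** Phi at (iota x_0, iota x_1) and at (iota x_oo, iota x_1). As iota x_oo abelianises to -V, the
    Fox derivatives differ by the sign of V. *)
Variables G Goo : ncseries C.
Hypotheses (G_lie_exp : lie_exp G) (Goo_lie_exp : lie_exp Goo).
Hypotheses (abel_G : abel G = 1) (abel_Goo : abel Goo = 1).
Hypothesis fox_G : fox G = inV zser * U.
Hypothesis fox_Goo : fox Goo = inV (fps_scalevar (- 1) zser) * U.
Let h : C := 2^-1.

Lemma A_component_of (hp : C) X Y A : t = 2 * hp ->
  p_lie X -> abel X = constUV t * V -> fox X = constUV t * inU bserC ->
  p_lie Y -> abel Y = 0 -> fox Y = constUV hp * U ->
  A = ncexp Y * G * ncexp X * ncinv G ->
  unique (D1_component (nclog A))
   (constUV t * (inU (cseries C) - constUV (t / 4) * V + inV (oddz 0))).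
Proof.
move=> tE PX pX qX PY pY qY AE.
have E1 : lie_exp (ncexp Y) by exists Y.
have E2 : lie_exp (ncexp X) by exists X.
have EA : lie_exp A.
  rewrite AE; exact: lie_expM (lie_expM (lie_expM E1 G_lie_exp) E2) (lie_expV G_lie_exp).
have PA := lie_exp_log EA; have A1 := lie_exp_nil EA.
have X0 := p_lie_nil PX; have Y0 := p_lie_nil PY.
have px : abel (ncexp X) = uvcomp (fun n => n`!%:R^-1) (constUV t * V).
  by rewrite (abel_exp X0) pX.
have pz : abel (ncexp Y) = 1.
  by rewrite (abel_exp Y0) pY uvcomp_0 invr1 constUV1.
have pPhi1 := lie_exp_nil G_lie_exp.
have pA : abel A = uvcomp (fun n => n`!%:R^-1) (constUV t * V).
  by rewrite AE 3!abelM px pz (abel_inv pPhi1 abel_G) abel_G 2!mulr1 mul1r.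
have pL : abel (nclog A) = constUV 0 * U + constUV t * V.
  apply: (abel_log PA); rewrite (nclogK A1) pA constUV0 mul0r add0r.
  exact: erefl.
rewrite constUV0 mul0r add0r in pL.
have qA : fox A = inV (fps_scalevar t eserC) * fox (nclog A).
  by rewrite -{1}(nclogK A1) (fox_exp (nclog_nil A)) pL uvcomp_V.
have tBE : fps_scalevar t bserC * fps_scalevar t eserC = 1.
  by rewrite -fps_scalevarM bserC_eserC fps_scalevar1.
have qL : fox (nclog A) = inV (fps_scalevar t bserC) * fox A.
  by rewrite qA mulrA -inVM tBE inV1 mul1r.
apply: (@unique_D1_component _ _ t _ PA); rewrite qL.
rewrite AE !foxM !abelM pz px abel_G !ncexp_nil pPhi1 ncinv_nil (fox_inv pPhi1 abel_G) !constUV1.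
rewrite (fox_exp X0) (fox_exp Y0) pX pY uvcomp_0 invr1 constUV1.
rewrite qX qY fox_G !uvcomp_V -!/eserC -!/expC expC_eserC.
rewrite fps_scalevarD fps_scalevar1 fps_scalevarM fps_scalevarX.
rewrite !(inVD, inVM) inV1 inVC -[inV fpsX]/V.
have {tBE} tBE : inV (fps_scalevar t bserC) * inV (fps_scalevar t eserC) = 1.
  by rewrite -inVM tBE inV1.
have key : constUV h * inV (fps_scalevar t bserC) =
    V * inV zser + constUV h - constUV (t / 4) * V + inV (oddz 0).
  have := congr1 (@inV C) fpsseries_A.
  have -> : t / 4 = t * 2^-1 * 2^-1 by field.
  rewrite !(inVD, inVN, inVM, inVC) -[inV fpsX]/V => /eqP; rewrite subr_eq => /eqP ->.
  by ring.
have UB : inU bserC = 1 - constUV h * U + U * inU (cseries C).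
  by rewrite bserC_cseries !(inUD, inUN, inUM, inUC) inU1.
have -> : constUV hp = constUV t * constUV h.
  by rewrite -constUVM tE /h; congr constUV; field.
move: tBE key UB; set B := inV (fps_scalevar t bserC); set E := inV (fps_scalevar t eserC).
set T := constUV t; set H := constUV h; set p := inV zser; set BU := inU bserC.
move=> tBE key UB.
(* Once B E = 1, conjugation by [G] leaves - T V p U, which [key] cancels, and the U/2 due to [Y]
   cancels the B_1 term of [BU]. *)
have -> : B * (1 * 1 * (1 + T * V * E) * - (p * U) + 1 *
   (1 * 1 * (E * (T * BU)) + 1 * (1 * (p * U) + 1 * (1 * (T * H * U))))) =
   T * U * (H * B) - (B * E) * T * V * p * U + (B * E) * T * BU by ring.
by rewrite tBE key UB; ring.
Qed.

Lemma B_component_of B : B = Goo * ncexp a * ncinv G ->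
  unique (D1_component (nclog B))
   (- constUV t * (inV (fps_scalevar t (cseries C))
                  + U * inU (cseries C) * inV (fps_scalevar t (cseries C)))
     + U * inV (oddz 1)).
Proof.
move=> BE.
have Pa : p_lie a := p_lie_letter _ _.
have E1 : lie_exp (ncexp a) by exists a.
have EB : lie_exp B.
  rewrite BE; exact: lie_expM (lie_expM Goo_lie_exp E1) (lie_expV G_lie_exp).
have PB := lie_exp_log EB; have B1 := lie_exp_nil EB.
have a0 := p_lie_nil Pa.
have pa : abel (ncexp a) = uvcomp (fun n => n`!%:R^-1) U by rewrite (abel_exp a0) abel_letter.
have pPhi1 := lie_exp_nil G_lie_exp.
have pB : abel B = uvcomp (fun n => n`!%:R^-1) U.
  by rewrite BE !abelM pa (abel_inv pPhi1 abel_G) abel_Goo mulr1 mul1r.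
have pL : abel (nclog B) = constUV 1 * U + constUV 0 * V.
  apply: (abel_log PB); rewrite (nclogK B1) pB constUV0 mul0r addr0 constUV1 mul1r.
  exact: erefl.
rewrite constUV0 mul0r addr0 constUV1 mul1r in pL.
have qB : fox B = inU eserC * fox (nclog B).
  by rewrite -{1}(nclogK B1) (fox_exp (nclog_nil B)) pL uvcomp_U.
have qL : fox (nclog B) = inU bserC * fox B.
  by rewrite qB mulrA -inUM bserC_eserC inU1 mul1r.
apply: (@unique_D1_component _ _ 0 _ PB); rewrite qL constUV0 add0r.
rewrite BE !foxM !abelM pa abel_Goo !ncexp_nil ncinv_nil (fox_inv pPhi1 abel_G) !constUV1.
rewrite (fox_exp a0) fox_letter mulr0 fox_G fox_Goo uvcomp_U -/expC expC_eserC.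
rewrite inUD inU1 inUM -[inU fpsX]/U.
have tBE : inU bserC * inU eserC = 1 by rewrite -inUM bserC_eserC inU1.
have UB : inU bserC = 1 - constUV h * U + U * inU (cseries C).
  by rewrite bserC_cseries !(inUD, inUN, inUM, inUC) inU1.
have hh : constUV h + constUV h = 1 by rewrite -constUVD -[RHS]constUV1; congr constUV; rewrite /h; field.
have key1 := congr1 (@inV C) fpsseries_B1.
have key2 := congr1 (@inV C) fpsseries_B2.
rewrite !(inVD, inVN, inVM, inVC) in key1 key2.
move: tBE UB hh key1 key2; set BU := inU bserC; set EU := inU eserC.
set H := constUV h; set p := inV zser; set q := inV (fps_scalevar _ zser).
set T := constUV t; set cV := inV (fps_scalevar _ _); set Z := inV _; set cU := inU _.
move=> tBE UB hh key1 key2.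
have -> : BU * (1 * (1 + U * EU) * - (p * U) + 1 * (1 * 0 + 1 * (q * U))) =
   U * (BU * (q - p) - (BU * EU) * U * p) by ring.
rewrite tBE key1; congr (_ * _).
(* As q is p at -V, this splits p into its even and odd parts in V, to which [key2] and [key1]
   apply. *)
have -> : p = H * (q + p) - H * (q - p).
  by rewrite -[LHS]mul1r -hh; ring.
rewrite key1 key2 UB.
have -> : H * - (Z + Z) = - ((H + H) * Z) by ring.
rewrite hh; ring.
Qed.

End Components.

Lemma fox_subst_V (K : numFieldType) (f y z : ncseries K) (t : K) : p_lie y -> p_lie z ->
  abel z = 0 -> (forall n, nccoef f (nseq n false) = (n == 0%N)%:R) ->
  abel y = constUV t * varV K ->
  fox (ncsubst f y z) =
  inV (fps_scalevar t (FPS (fun n => nccoef f (rcons (nseq n false) true)))) * fox z.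
Proof. by move=> Py Pz pz f0 py; rewrite fox_subst // py uvcomp_V. Qed.

(** * The images of x_0, x_1, x_oo and Phi under iota *)

Section IotaSeries.
Variable C : numFieldType.
Local Notation a := (letter C false).
Local Notation b := (letter C true).
Local Notation U := (varU C).
Local Notation V := (varV C).

Lemma adab_b_ord k : ncord k (iter k (lie a) b).
Proof. by apply: ncordX_lie; apply: ncord_letter. Qed.

Lemma iota_x0_ord (c : nat -> C) k : ncord k (c k *: iter k (lie a) b).
Proof. exact/ncordZ/adab_b_ord. Qed.

Definition iota0 : ncseries C :=
  ncsum (fun k => (ratr (bernoulli_num k) / k`!%:R) *: iter k (lie a) b).

Lemma iota_x0_p_lie : p_lie iota0.
Proof.
apply: p_lie_ncsum => k; first by apply: ncordZ; apply: adab_b_ord.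
by apply: p_lieZ; apply: p_lie_ad; exact: p_lie_letter.
Qed.

Lemma ab_p_lie : p_lie (lie a b).
Proof. by apply: p_lie_lie; exact: p_lie_letter. Qed.

Lemma abel_ad_b k : abel (iter k.+1 (lie a) b) = 0.
Proof. by rewrite iterS abel_lie. Qed.

Lemma fox_ad_b k : fox (iter k (lie a) b) = U ^+ k.
Proof.
elim: k => [|k IHk]; first by rewrite fox_letter.
have Pa := p_lie_letter C false.
have yk := p_lie_nil (p_lie_ad k Pa (p_lie_letter C true)).
by rewrite iterS (fox_lie (p_lie_nil Pa) yk) IHk abel_letter fox_letter mulr0 subr0 exprS.
Qed.

Lemma abel_iota_x0 : abel iota0 = V.
Proof.
have o k := iota_x0_ord (fun k => ratr (bernoulli_num k) / k`!%:R) k.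
apply: UVP => k l; rewrite (abel_nceq (ltnSn _) (ncsum_nceq o (leqnn _))) abel_sum.
rewrite big_ord_recl big1 ?addr0 => [|i _]; last by rewrite abelZ lift0 abel_ad_b mulr0.
by rewrite /= bernoulli_num0 rmorph1 divr1 scale1r abel_letter.
Qed.

Lemma fox_iota_x0 : fox iota0 = inU (bserC C).
Proof.
have o k := iota_x0_ord (fun k => ratr (bernoulli_num k) / k`!%:R) k.
rewrite -uvcomp_U; apply: UVP => k l.
rewrite (fox_nceq (ltnSn _) (ncsum_nceq o (leqnn _))) fox_sum coefUV_sum.
rewrite (coef_uvcomp _ _ (N := (k + l).+2)) ?coefUV_U ?leqnSn //.
by apply: eq_bigr => n _; rewrite foxZ coefUV_constM fox_ad_b.
Qed.

Lemma fox_ab : fox (lie a b) = U.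
Proof.
rewrite (fox_lie (p_lie_nil (p_lie_letter C false)) (p_lie_nil (p_lie_letter C true))).
by rewrite !fox_letter !abel_letter mulr1 mulr0 subr0.
Qed.

Definition subst_iota f := ncsubst f iota0 (lie a b).

Lemma subst_iota_letter x : subst_iota (letter C x) = if x then lie a b else iota0.
Proof. by rewrite /subst_iota ncsubst_letter //; [exact: iota_x0_p_lie|exact: ab_p_lie]. Qed.

Lemma subst_iota_xoo : subst_iota (- letter C false - letter C true) = - iota0 - lie a b.
Proof. by rewrite /subst_iota ncsubstD !ncsubstN -!/(subst_iota _) !subst_iota_letter. Qed.

Variables (Phi : ncseries C) (z : nat -> C).
Hypothesis Phi_glike : glike Phi.
Hypothesis Phi0 : forall n, nccoef Phi (nseq n false) = (n == 0%N)%:R.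
Hypothesis Phi1 : forall n, nccoef Phi (rcons (nseq n false) true) =
  if n == 0%N then 0 else - z n.+1.

Let phiE : FPS (fun n => nccoef Phi (rcons (nseq n false) true)) = zser z.
Proof. by apply: fpsP => n; exact: Phi1. Qed.

Let Phi_iota := ncsubst Phi iota0 (lie a b).
Let Phi_iotaoo := ncsubst Phi (- iota0 - lie a b) (lie a b).

Let Poo : p_lie (- iota0 - lie a b).
Proof.
by apply: p_lieD; apply: p_lieN; [exact: iota_x0_p_lie|exact: ab_p_lie].
Qed.

Let abel_Phi : abel Phi_iota = 1.
Proof. exact: (abel_subst iota_x0_p_lie ab_p_lie (abel_lie _ _) Phi0). Qed.

Let fox_Phi : fox Phi_iota = inV (zser z) * U.
Proof.
have p1 : abel iota0 = constUV 1 * V by rewrite constUV1 mul1r abel_iota_x0.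
rewrite /Phi_iota (fox_subst_V iota_x0_p_lie ab_p_lie (abel_lie _ _) Phi0 p1) fox_ab phiE.
by congr (inV _ * _); apply: fpsP => n; rewrite /= expr1n mul1r.
Qed.

Let fox_Phioo : fox Phi_iotaoo = inV (fps_scalevar (- 1) (zser z)) * U.
Proof.
have p1 : abel (- iota0 - lie a b) = constUV (- 1) * V.
  by rewrite abelB abelN abel_iota_x0 abel_lie subr0 constUVN constUV1 mulN1r.
by rewrite /Phi_iotaoo (fox_subst_V Poo ab_p_lie (abel_lie _ _) Phi0 p1) fox_ab phiE.
Qed.

Let lie_exp_Phi : lie_exp Phi_iota.
Proof. exact: (lie_exp_subst iota_x0_p_lie ab_p_lie Phi_glike). Qed.

Let lie_exp_Phioo : lie_exp Phi_iotaoo.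
Proof. exact: (lie_exp_subst Poo ab_p_lie Phi_glike). Qed.

Variables (hp t : C).
Hypothesis tE : t = 2 * hp.
Hypothesis zE : forall n, (1 < n)%N ->
  ratr (bernoulli_num n) / n`!%:R * t ^+ n / 2 + z n = if odd n then z n else 0.

Lemma A_component :
  let x0 := subst_iota (letter C false) in let x1 := subst_iota (letter C true) in
  unique (D1_component (nclog (ncexp (hp *: x1) * ncsubst Phi x0 x1 * ncexp ((2 * hp) *: x0)
     * ncinv (ncsubst Phi x0 x1))))
   (constUV t * (inU (cseries C) - constUV (t / 4) * V + inV (oddz z 0))).
Proof.
rewrite !subst_iota_letter /=.
apply: (A_component_of zE lie_exp_Phi abel_Phi fox_Phi tE _ _ _ _ _ _ erefl).
- by apply: p_lieZ; exact: iota_x0_p_lie.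
- by rewrite abelZ abel_iota_x0 tE.
- by rewrite foxZ fox_iota_x0 tE.
- by apply: p_lieZ; exact: ab_p_lie.
- by rewrite abelZ abel_lie mulr0.
- by rewrite foxZ fox_ab.
Qed.

Lemma B_component :
  let x0 := subst_iota (letter C false) in let x1 := subst_iota (letter C true) in
  let xoo := subst_iota (- letter C false - letter C true) in
  unique (D1_component (nclog (ncsubst Phi xoo x1 * ncexp a * ncinv (ncsubst Phi x0 x1))))
   (- constUV t * (inV (fps_scalevar t (cseries C))
                  + U * inU (cseries C) * inV (fps_scalevar t (cseries C)))
     + U * inV (oddz z 1)).
Proof.
rewrite !subst_iota_letter subst_iota_xoo /=.
apply: (B_component_of zE lie_exp_Phi lie_exp_Phioo abel_Phi _ fox_Phi fox_Phioo erefl).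
exact: (abel_subst Poo ab_p_lie (abel_lie _ _) Phi0).
Qed.

End IotaSeries.

Section ToComplex.
Variable R : realType.

Lemma sh_to_C (f : ncseries R) u v : sh (to_C f) u v = (sh f u v)%:C%C.
Proof. by rewrite /sh rmorph_sum. Qed.

Lemma glike_to_C (f : ncseries R) : glike f -> glike (to_C f).
Proof.
move=> [f1 fsh]; split=> [|u v]; first by rewrite /= f1.
by rewrite sh_to_C fsh rmorphM.
Qed.

End ToComplex.

Local Transparent uvcomp abel fox coefUV ncsum nc_mul nc_add nc_opp nc_scale.

Local Open Scope classical_set_scope.

(** * Values of zeta at even integers *)

Section ZetaConvergence.
Variable R : realType.

Definition zpart (s n : nat) : R := \sum_(k < n) (k.+1%:R ^+ s)^-1.

Lemma zpartE s : series (fun k => (k.+1%:R ^+ s)^-1 : R) = zpart s.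
Proof. by apply/funext => n; rewrite /series /= big_mkord. Qed.

Lemma zeta_term_ge0 s k : 0 <= (k.+1%:R ^+ s)^-1 :> R.
Proof. by rewrite invr_ge0 exprn_ge0. Qed.

Lemma zpart_ndecr s : {homo zpart s : n m / (n <= m)%N >-> n <= m}.
Proof.
move=> n m nm; rewrite /zpart (big_ord_widen m (fun k => (k.+1%:R ^+ s)^-1) nm).
rewrite big_mkcond /=; apply: ler_sum => k _; case: ifP => // _; exact: zeta_term_ge0.
Qed.

Lemma zeta_term_le s t k : (s <= t)%N -> (k.+1%:R ^+ t)^-1 <= (k.+1%:R ^+ s)^-1 :> R.
Proof.
move=> st; rewrite lef_pV2 ?posrE ?exprn_gt0 ?ltr0n //.
by apply: ler_weXn2l => //; rewrite ler1n.
Qed.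

(** The subtracted term makes the bound inductive: 1/(x + 1)^2 <= 1/x - 1/(x + 1). *)
Lemma zpart2_le n : zpart 2 n.+1 <= 2 - n.+1%:R^-1.
Proof.
elim: n => [|n IHn].
  rewrite /zpart big_ord1 expr1n invr1; lra.
rewrite /zpart big_ord_recr /= -/(zpart 2 n.+1); apply: le_trans (lerD IHn (lexx _)) _.
have n1 : 0 < n.+1%:R :> R by rewrite ltr0n.
have nE : n.+2%:R = n.+1%:R + 1 :> R by rewrite natr1.
rewrite nE; move: n.+1%:R n1 => x x0.
rewrite -subr_ge0.
have -> : 2 - (x + 1)^-1 - (2 - x^-1 + ((x + 1) ^+ 2)^-1) = (x * (x + 1) ^+ 2)^-1.
  by field; rewrite !gt_eqF //; lra.
by rewrite invr_ge0 mulr_ge0 ?exprn_ge0 //; lra.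
Qed.

Lemma zpart_le2 s n : (1 < s)%N -> zpart s n <= 2.
Proof.
move=> s1; case: n => [|n]; first by rewrite /zpart big_ord0.
apply: (@le_trans _ _ (zpart 2 n.+1)).
  by apply: ler_sum => k _; apply: zeta_term_le.
by apply: le_trans (zpart2_le n) _; rewrite gerBl invr_ge0.
Qed.

Lemma cvg_zpart s : (1 < s)%N -> zpart s n @[n --> \oo] --> zeta R s.
Proof.
move=> s1; rewrite /zeta zpartE.
suff : cvgn (zpart s) by [].
apply: nondecreasing_is_cvgn; first exact: zpart_ndecr.
by exists 2 => _ [n _ <-]; apply: zpart_le2.
Qed.

Lemma zpart_le_zeta s n : (1 < s)%N -> zpart s n <= zeta R s.
Proof.
move=> s1; have c := cvg_zpart s1.
rewrite -(cvg_lim _ c) //; apply: nondecreasing_cvgn_le; first exact: zpart_ndecr.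
by apply/cvg_ex; exists (zeta R s).
Qed.

End ZetaConvergence.

(** * Williams' recurrence for even zeta values *)

Section Williams.
Variable R : realType.
Local Notation zpart := (@zpart R).

Definition harm (n : nat) : R := \sum_(k < n) k.+1%:R^-1.

Lemma harmS n : harm n.+1 = harm n + n.+1%:R^-1.
Proof. by rewrite /harm big_ord_recr. Qed.

Lemma harm_diff_le a b : harm (a + b) - harm a <= b%:R / a.+1%:R.
Proof.
elim: b => [|b IHb]; first by rewrite addn0 subrr mul0r.
rewrite addnS harmS addrAC -[b.+1%:R]natr1 mulrDl mul1r; apply: lerD => //.
by rewrite lef_pV2 ?posrE ?ltr0n // ler_nat ltnS leq_addr.
Qed.

Lemma harm_diff_ge0 a b : 0 <= harm (a + b) - harm a.
Proof.
elim: b => [|b IHb]; first by rewrite addn0 subrr.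
by rewrite addnS harmS addrAC addr_ge0.
Qed.

Definition sqdiff (p k : nat) : R :=
  if k == p then 0 else (k.+1%:R ^+ 2 - p.+1%:R ^+ 2)^-1.

Lemma sqdiffE p k : k != p -> sqdiff p k =
  (2 * p.+1%:R)^-1 * ((k.+1%:R - p.+1%:R)^-1 - (k.+1%:R + p.+1%:R)^-1).
Proof.
move=> kp; rewrite /sqdiff (negPf kp).
have h1 : k.+1%:R - p.+1%:R != 0 :> R by rewrite subr_eq0 eqr_nat eqSS.
have h2 : k.+1%:R + p.+1%:R != 0 :> R by rewrite -natrD pnatr_eq0.
have h3 : p.+1%:R != 0 :> R by rewrite pnatr_eq0.
have h4 : k.+1%:R ^+ 2 - p.+1%:R ^+ 2 != 0 :> R by rewrite subr_sqr mulf_neq0.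
move: h1 h2 h3 h4; move: (k.+1%:R : R) (p.+1%:R : R) => x y h1 h2 h3 h4.
by field; rewrite h1 h2 h3 h4.
Qed.

Lemma sqdiff_sum_small p n : (n <= p)%N -> \sum_(k < n) sqdiff p k =
  (2 * p.+1%:R)^-1 * (harm (p - n) - harm p - (harm (p.+1 + n) - harm p.+1)).
Proof.
elim: n => [|n IHn] np; first by rewrite big_ord0 subn0 addn0 !subrr mulr0.
rewrite big_ord_recr /= IHn 1?ltnW // sqdiffE ?ltn_eqF // -mulrDr; congr (_ * _).
rewrite addnS [harm (p.+1 + n).+1]harmS.
have -> : (p - n = (p - n.+1).+1)%N by lia.
rewrite [harm (p - n.+1).+1]harmS.
have -> : (n.+1%:R - p.+1%:R : R)^-1 = - ((p - n.+1).+1%:R)^-1.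
  have -> : (p - n.+1).+1 = (p.+1 - n.+1)%N by lia.
  by rewrite natrB 1?ltnW // -invrN opprB.
have -> : n.+1%:R + p.+1%:R = (p.+1 + n).+1%:R :> R by rewrite -natrD addnC addnS.
by ring.
Qed.

(** Partial fractions telescope to harmonic numbers. With indices shifted to start at 1, 3/(4 p^2)
    is the sum of 1/(k^2 - p^2) over all k different from p, and the harmonic difference is the
    truncation error. *)
Lemma sqdiff_sum p n : (p < n)%N -> \sum_(k < n) sqdiff p k =
  3 / (4 * p.+1%:R ^+ 2) - (harm (n + p.+1) - harm (n - p.+1)) / (2 * p.+1%:R).
Proof.
have p0 : p.+1%:R != 0 :> R by rewrite pnatr_eq0.
elim: n => // n IHn; rewrite ltnS leq_eqVlt => /predU1P[<-|pn].
  rewrite big_ord_recr /= sqdiff_sum_small // /sqdiff eqxx addr0 !subnn.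
  rewrite [harm p.+1]harmS [(p.+1 + p.+1)%N]addnS [harm (p.+1 + p).+1]harmS [harm 0]/harm big_ord0.
  have -> : (p.+1 + p).+1%:R = 2 * p.+1%:R :> R by rewrite -addnS natrD mulrDl mul1r.
  by field.
rewrite big_ord_recr /= IHn // sqdiffE ?gtn_eqF // addSn [harm (n + p.+1).+1]harmS subSS.
have -> : (n - p = (n - p.+1).+1)%N by lia.
rewrite [harm (n - p.+1).+1]harmS.
have -> : n.+1%:R - p.+1%:R = ((n - p.+1).+1)%:R :> R.
  have -> : ((n - p.+1).+1 = n.+1 - p.+1)%N by lia.
  by rewrite natrB // ltnW.
have -> : n.+1%:R + p.+1%:R = (n + p.+1).+1%:R :> R by rewrite -natrD.
have h1 : (n - p.+1).+1%:R != 0 :> R by rewrite pnatr_eq0.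
have h2 : (n + p.+1).+1%:R != 0 :> R by rewrite pnatr_eq0.
move: h1 h2 p0; move: ((n - p.+1).+1%:R : R) ((n + p.+1).+1%:R : R) (p.+1%:R : R) => x y z h1 h2 h3.
by field; rewrite h1 h2 h3.
Qed.

Definition sqinv (k : nat) : R := (k.+1%:R ^+ 2)^-1.

Lemma zpart_double m n : zpart m.*2 n = \sum_(k < n) sqinv k ^+ m.
Proof. by apply: eq_bigr => k _; rewrite /sqinv exprVn -exprM mul2n. Qed.

(** For x = 1/k^2 and y = 1/p^2 the sum is geometric, equal to x y (x^(m+1) - y^(m+1))/(x - y),
    while x y/(y - x) = 1/(k^2 - p^2). *)
Lemma sqinv_geom m p k : k != p ->
  \sum_(j < m.+1) sqinv p ^+ j.+1 * sqinv k ^+ (m.+1 - j) =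
  sqinv p ^+ m.+1 * sqdiff p k + sqinv k ^+ m.+1 * sqdiff k p.
Proof.
move=> kp; rewrite /sqdiff (negPf kp) eq_sym (negPf kp).
have h1 : k.+1%:R != 0 :> R by rewrite pnatr_eq0.
have h2 : p.+1%:R != 0 :> R by rewrite pnatr_eq0.
have h4 : k.+1%:R ^+ 2 - p.+1%:R ^+ 2 != 0 :> R.
  by rewrite subr_sqr mulf_neq0 // ?subr_eq0 ?eqr_nat ?eqSS // -natrD pnatr_eq0.
transitivity (sqinv p * sqinv k * \sum_(j < m.+1) sqinv k ^+ (m - j) * sqinv p ^+ j).
  rewrite mulr_sumr; apply: eq_bigr => j _; rewrite subSn -1?ltnS // !exprS; ring.
set S := \sum_(j < m.+1) _.
have : sqinv k ^+ m.+1 - sqinv p ^+ m.+1 = (sqinv k - sqinv p) * S := subrXX _ _ _.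
move: (sqinv k ^+ m.+1) (sqinv p ^+ m.+1) => A B E.
have -> : A = B + (sqinv k - sqinv p) * S by rewrite -E addrC subrK.
rewrite /sqinv; move: S {E} h1 h2 h4 => S.
move: (k.+1%:R : R) (p.+1%:R : R) => x y h1 h2 h4.
have h5 : y ^+ 2 - x ^+ 2 != 0 by rewrite -opprB oppr_eq0.
by field; rewrite h1 h2 h4 h5.
Qed.

Definition williams_err (m n : nat) : R :=
  \sum_(p < n) sqinv p ^+ m.+1 * ((harm (n + p.+1) - harm (n - p.+1)) / p.+1%:R).

(** The diagonal contributes m + 1 and the two symmetric off-diagonal sums 3/4 each, whence m +
    5/2. *)
Lemma williams_finite m n :
  \sum_(j < m.+1) zpart j.+1.*2 n * zpart (m.+1 - j).*2 n =
  (m%:R + 5 / 2) * zpart m.+2.*2 n - williams_err m n.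
Proof.
transitivity (\sum_(p < n) \sum_(k < n) \sum_(j < m.+1) sqinv p ^+ j.+1 * sqinv k ^+ (m.+1 - j)).
  under eq_bigr => j _ do rewrite !zpart_double big_distrlr /=.
  rewrite exchange_big; apply: eq_bigr => p _ /=.
  by rewrite exchange_big.
transitivity (\sum_(p < n) \sum_(k < n) ((if k == p then m.+1%:R * sqinv p ^+ m.+2 else 0) +
    (sqinv p ^+ m.+1 * sqdiff p k + sqinv k ^+ m.+1 * sqdiff k p))).
  apply: eq_bigr => p _; apply: eq_bigr => k _.
  case: (eqVneq k p) => [->|kp].
    rewrite /sqdiff eqxx !mulr0 !addr0.
    rewrite (eq_bigr (fun=> sqinv p ^+ m.+2)) => [|j _].
      by rewrite sumr_const card_ord mulr_natl.
    by rewrite -exprD; congr (_ ^+ _); have := ltn_ord j; lia.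
  by rewrite add0r sqinv_geom.
under eq_bigr do rewrite big_split /= big_split /=.
rewrite big_split /= big_split /= [X in _ + (_ + X)]exchange_big /=.
have sq : \sum_(p < n) \sum_(k < n) sqinv p ^+ m.+1 * sqdiff p k =
    3 / 4 * zpart m.+2.*2 n - 2^-1 * williams_err m n.
  rewrite zpart_double mulr_sumr /williams_err [2^-1 * _]mulr_sumr -sumrB.
  apply: eq_bigr => p _; rewrite -mulr_sumr sqdiff_sum // [sqinv p ^+ m.+2]exprSr.
  have p0 : p.+1%:R != 0 :> R by rewrite pnatr_eq0.
  by move: (sqinv p ^+ m.+1) => A; rewrite /sqinv; field.
have dg : \sum_(p < n) \sum_(k < n) (if k == p then m.+1%:R * sqinv p ^+ m.+2 else 0) =
    m.+1%:R * zpart m.+2.*2 n.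
  rewrite zpart_double mulr_sumr; apply: eq_bigr => p _.
  by rewrite -big_mkcond big_pred1_eq.
by rewrite dg sq -[m.+1%:R]natr1; field.
Qed.

Lemma williams_err_bound m n : `|williams_err m n| <= 8 / n.+1%:R.
Proof.
have t0 p : (p < n)%N -> 0 <= (harm (n + p.+1) - harm (n - p.+1)) / p.+1%:R <= 2 / (n - p)%:R.
  move=> pn; have e : (n + p.+1 = (n - p.+1) + (2 * p.+1))%N by lia.
  rewrite e divr_ge0 ?harm_diff_ge0 //= ler_pdivrMr ?ltr0n //.
  apply: le_trans (harm_diff_le _ _) _.
  have -> : (n - p.+1).+1 = (n - p)%N by lia.
  by rewrite natrM mulrAC.
have s0 k : 0 <= sqinv k by rewrite invr_ge0 exprn_ge0.
have s1 k : sqinv k <= 1.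
  by rewrite invf_le1 ?exprn_gt0 ?ltr0n // exprn_ege1 // ler1n.
rewrite ger0_norm; last first.
  apply: sumr_ge0 => p _; rewrite mulr_ge0 ?exprn_ge0 //.
  by case/andP: (t0 p (ltn_ord p)).
(* Put x = p + 1, y = n - p, so x + y = n + 1. Then 1/(x^2 y) = (1/x^2 + 1/(x y))/(x + y), and 1/(x
   y) <= 2/(x + y) since x, y >= 1. *)
apply: (@le_trans _ _ (\sum_(p < n) (2 / n.+1%:R * sqinv p + 4 / n.+1%:R ^+ 2))).
  apply: ler_sum => p _; case/andP: (t0 p (ltn_ord p)) => h0 h1.
  apply: (@le_trans _ _ (sqinv p * (2 / (n - p)%:R))).
    apply: ler_pM => //; first exact: exprn_ge0.
    by rewrite exprS ler_piMr // exprn_ile1.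
  have pn := ltn_ord p.
  have pE : n.+1%:R = p.+1%:R + (n - p)%:R :> R by rewrite -natrD; congr (_%:R); lia.
  have y1 : 1 <= (n - p)%:R :> R by rewrite ler1n; lia.
  have x1 : 1 <= p.+1%:R :> R by rewrite ler1n.
  rewrite /sqinv pE; move: x1 y1; move: (p.+1%:R : R) ((n - p)%:R : R) => x y x1 y1.
  rewrite -subr_ge0.
  have -> : 2 / (x + y) * (x ^+ 2)^-1 + 4 / (x + y) ^+ 2 - (x ^+ 2)^-1 * (2 / y) =
     (2 * (2 * x * y - (x + y))) / (x * y * (x + y) ^+ 2).
    by field; rewrite !gt_eqF //; lra.
  rewrite divr_ge0 //; last by rewrite !mulr_ge0 ?exprn_ge0 //; lra.
  nra.
rewrite big_split /= -mulr_sumr sumr_const card_ord.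
have -> : \sum_(p < n) sqinv p = zpart 2 n.
  by rewrite (zpart_double 1); apply: eq_bigr => p _; rewrite expr1.
have := @zpart_le2 R 2 n isT.
have n0 : 0 < n.+1%:R :> R by rewrite ltr0n.
rewrite -[_ *+ n]mulr_natr.
have -> : n%:R = n.+1%:R - 1 :> R by rewrite -natr1 addrK.
move: (zpart 2 n) n0; move: (n.+1%:R : R) => x z x0 z2.
rewrite -subr_ge0.
have -> : 8 / x - (2 / x * z + 4 / x ^+ 2 * (x - 1)) = (2 * (2 - z) * x + 4) / x ^+ 2.
  by field; rewrite gt_eqF.
rewrite divr_ge0 ?exprn_ge0 ?ltW //.
have : 0 <= (2 - z) * x by rewrite mulr_ge0 ?subr_ge0 // ltW.
nra.
Qed.

Lemma zeta_even_rec m :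
  \sum_(j < m.+1) zeta R j.+1.*2 * zeta R (m.+1 - j).*2 = (m%:R + 5 / 2) * zeta R m.+2.*2.
Proof.
have e0 : williams_err m n @[n --> \oo] --> (0 : R).
  apply/norm_cvg0P.
  apply: (@squeeze_cvgr _ _ _ _ (fun=> 0) (fun n => 8 * harmonic n)).
  - by near=> n; rewrite normr_ge0 /= williams_err_bound.
  - exact: cvg_cst.
  - by rewrite -[X in _ --> X](mulr0 8); apply: cvgM; [exact: cvg_cst|exact: cvg_harmonic].
have l1 : (\sum_(j < m.+1) zpart j.+1.*2 n * zpart (m.+1 - j).*2 n) @[n --> \oo] -->
    \sum_(j < m.+1) zeta R j.+1.*2 * zeta R (m.+1 - j).*2.
  apply: cvg_big => [|j _]; first exact: add_continuous.
  by apply: cvgM; apply: cvg_zpart; have := ltn_ord j; lia.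
have l2 : ((m%:R + 5 / 2) * zpart m.+2.*2 n - williams_err m n) @[n --> \oo] -->
    (m%:R + 5 / 2) * zeta R m.+2.*2 - 0.
  by apply: cvgB e0; apply: cvgM; [exact: cvg_cst|apply: cvg_zpart].
rewrite subr0 in l2.
rewrite -(funext (williams_finite m)) in l2.
exact: (@norm_cvg_unique R R^o _ _ _ _ l1 l2).
Unshelve. all: by end_near. Qed.

End Williams.

(** * The value of zeta(2) and Euler's formula *)

Section Basel.
Variable R : realType.
Local Notation pi := (@pi R).

Lemma sin_le_id (x : R) : 0 < x -> sin x <= x.
Proof.
move=> x0; have c : {within `[0, x], continuous (@sin R)}.
  by apply: continuous_subspaceT; exact: continuous_sin.
have [c0 _] := @MVT R sin cos 0 x x0 (fun z _ => is_derive_sin z) c.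
rewrite sin0 !subr0 => ->; by rewrite ler_piMl ?cos_le1 // ltW.
Qed.

Lemma id_le_tan (x : R) : 0 < x < pi / 2 -> x <= tan x.
Proof.
move=> /andP[x0 xpi].
have cp z : 0 <= z <= x -> 0 < cos z.
  move=> /andP[z0 zx]; apply: cos_gt0_pihalf; apply/andP; split; last exact: le_lt_trans xpi.
  by apply: lt_le_trans z0; rewrite oppr_lt0 divr_gt0 ?pi_gt0.
have c : {within `[0, x], continuous (@tan R)}.
  apply: derivable_within_continuous => z zx; apply: derivable_tan.
  by rewrite gt_eqF // cp //; move: zx; rewrite in_itv.
have d z : z \in `]0, x[%R -> is_derive z 1 (@tan R) ((cos z) ^- 2).
  rewrite in_itv /= => /andP[z0 zx]; apply: is_derive_tan.
  by rewrite gt_eqF // cp // !ltW.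
have [c0] := @MVT R tan _ 0 x x0 d c; rewrite in_itv /= => /andP[c00 c0x].
rewrite tan0 !subr0 => ->; have cc : 0 < cos c0 by rewrite cp // !ltW.
rewrite ler_peMl ?(ltW x0) //.
by rewrite invf_ge1 ?exprn_gt0 // exprn_ile1 ?cos_le1 // ltW.
Qed.

(** From sin x <= x <= tan x, because 1/tan^2 = 1/sin^2 - 1. *)
Lemma inv_sqr_bounds (x : R) : 0 < x < pi / 2 ->
  (sin x ^+ 2)^-1 - 1 <= (x ^+ 2)^-1 <= (sin x ^+ 2)^-1.
Proof.
move=> /[dup] xp /andP[x0 xpi].
have s0 : 0 < sin x by apply: sin_gt0_pihalf.
have c0 : 0 < cos x.
  by apply: cos_gt0_pihalf; rewrite xpi (lt_trans _ x0) // oppr_lt0 divr_gt0 ?pi_gt0.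
have -> : (sin x ^+ 2)^-1 - 1 = (tan x ^+ 2)^-1.
  have e := cos2Dsin2 x; rewrite /tan expr_div_n invf_div.
  have -> : cos x ^+ 2 = 1 - sin x ^+ 2 by rewrite -e addrK.
  by rewrite mulrBl mul1r divff // expf_neq0 // gt_eqF.
have t0 : 0 < tan x by rewrite divr_gt0.
rewrite !lef_pV2 ?posrE ?exprn_gt0 //.
by rewrite !ler_sqr ?nnegrE ?(ltW x0) ?(ltW s0) ?(ltW t0) // id_le_tan // sin_le_id.
Qed.

(** From sin x = 2 s c and 1/s^2 + 1/c^2 = 1/(s^2 c^2) at the half angle. Writing the cosine as the
    sine of (pi - x)/2 keeps the identity within the family [odd_angle]. *)
Lemma inv_sin_halve (x : R) : 0 < x < pi ->
  (sin x ^+ 2)^-1 = 4^-1 * ((sin (x / 2) ^+ 2)^-1 + (sin ((pi - x) / 2) ^+ 2)^-1).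
Proof.
move=> /andP[x0 xpi].
have p0 := pi_gt0 R.
have s0 : 0 < sin (x / 2) by apply: sin_gt0_pihalf; apply/andP; split; lra.
have c0 : 0 < cos (x / 2) by apply: cos_gt0_pihalf; apply/andP; split; lra.
have -> : sin ((pi - x) / 2) = cos (x / 2).
  have -> : (pi - x) / 2 = - (x / 2) + pi / 2 by lra.
  by rewrite sinDpihalf cosN.
have -> : sin x = 2 * (cos (x / 2) * sin (x / 2)).
  by rewrite mulr_natl -sin_mulr2n; congr sin; rewrite -mulr_natr; lra.
have e := cos2Dsin2 (x / 2); move: s0 c0 e; move: (sin _) (cos _) => s c s0 c0 e.
have -> : (s ^+ 2)^-1 + (c ^+ 2)^-1 = (c ^+ 2 + s ^+ 2) / (s ^+ 2 * c ^+ 2).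
  by field; rewrite !gt_eqF.
by rewrite e; field; rewrite !gt_eqF.
Qed.

Definition odd_angle (n k : nat) : R := (2 * k%:R + 1) * (pi / 2 ^+ n.+2).

Lemma odd_angle_bounds n k : (k < 2 ^ n)%N -> 0 < odd_angle n k < pi / 2.
Proof.
move=> kn; have p0 := pi_gt0 R.
have b : k%:R + 1 <= 2 ^+ n :> R by rewrite -natrX natr1 ler_nat.
have k0 : 0 <= k%:R :> R by [].
rewrite /odd_angle !exprS; have t0 : 0 < 2 ^+ n :> R by rewrite exprn_gt0.
move: b k0 t0; move: (k%:R : R) (2 ^+ n : R) => x t b k0 t0.
apply/andP; split.
  by rewrite mulr_gt0 ?divr_gt0 //; lra.
have -> : (2 * x + 1) * (pi / (2 * (2 * t))) = pi / 2 * ((2 * x + 1) / (2 * t)).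
  by field; rewrite gt_eqF.
rewrite gtr_pMr ?divr_gt0 // ltr_pdivrMr; lra.
Qed.

Definition sin_sum n : R := \sum_(k < 2 ^ n) (sin (odd_angle n k) ^+ 2)^-1.

(** Each angle of level n yields two of level n + 1 and a factor 4; at level 0 the only term is
    1/sin^2(pi/4) = 2. *)
Lemma sin_sumE n : sin_sum n = 2 * 4 ^+ n.
Proof.
elim: n => [|n IHn].
  rewrite /sin_sum big_ord1 /odd_angle mulr0 add0r mul1r expr0 mulr1.
  have -> : 2 ^+ 2 = 4 :> R by rewrite expr2; lra.
  have p0 := pi_gt0 R.
  have c0 : 0 < cos (pi / 4) by apply: cos_gt0_pihalf; apply/andP; split; lra.
  have := tan_piquarter R; rewrite /tan => h.
  have e : sin (pi / 4) = cos (pi / 4) by rewrite -[LHS](divfK (lt0r_neq0 c0)) h mul1r.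
  have := cos2Dsin2 (pi / 4); rewrite -e => e2.
  have -> : sin (pi / 4) ^+ 2 = 2^-1 by lra.
  by rewrite invrK.
have h : \sum_(k < 2 ^ n) (sin (odd_angle n k) ^+ 2)^-1 =
   4^-1 * sin_sum n.+1.
  rewrite /sin_sum expnS mul2n -addnn big_split_ord /= mulrDr !mulr_sumr.
  (* The reflected angles (pi - x)/2 fill the upper half of level n + 1 in reverse order. *)
  rewrite [X in _ = _ + X](reindex_inj rev_ord_inj) /= -big_split /=.
  apply: eq_bigr => k _; have /andP[a0 a1] := odd_angle_bounds (ltn_ord k).
  have p0 := pi_gt0 R.
  rewrite inv_sin_halve; last by apply/andP; split; lra.
  rewrite -mulrDr; congr (_ * ((sin _ ^+ 2)^-1 + (sin _ ^+ 2)^-1)).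
    by rewrite /odd_angle [2 ^+ n.+3]exprS; field; rewrite expf_neq0.
  rewrite /odd_angle natrD natrB // natrX -natr1 !exprS.
  have t0 : 2 ^+ n != 0 :> R by rewrite expf_neq0.
  move: (2 ^+ n) t0 => t t0; by field.
by rewrite -/(sin_sum n) IHn in h; rewrite exprS; lra.
Qed.

Definition odd_part (n : nat) : R := \sum_(k < n) ((2 * k%:R + 1) ^+ 2)^-1.

(** Each of the 2^n values 1/sin^2 exceeds 1/x^2 by at most 1; after scaling by (pi/2^(n+2))^2 the
    total error is of order 2^-n. *)
Lemma odd_part_bounds n :
  pi ^+ 2 / 8 - pi ^+ 2 / 16 * (2 ^+ n)^-1 <= odd_part (2 ^ n) <= pi ^+ 2 / 8.
Proof.
have p0 := pi_gt0 R.
pose c : R := (pi / 2 ^+ n.+2) ^+ 2.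
have c0 : 0 < c by rewrite exprn_gt0 // divr_gt0 // exprn_gt0.
have e k : ((2 * k%:R + 1) ^+ 2)^-1 = c * ((odd_angle n k) ^+ 2)^-1.
  rewrite /odd_angle exprMn -/c; move: c c0 => d d0.
  by rewrite [(_ * d)^-1]invfM mulrCA mulfV ?mulr1 // gt_eqF.
have -> : odd_part (2 ^ n) = c * \sum_(k < 2 ^ n) ((odd_angle n k) ^+ 2)^-1.
  by rewrite mulr_sumr; apply: eq_bigr => k _; rewrite e.
have u : \sum_(k < 2 ^ n) ((odd_angle n k) ^+ 2)^-1 <= sin_sum n.
  by apply: ler_sum => k _; have /inv_sqr_bounds/andP[] := odd_angle_bounds (ltn_ord k).
have l : sin_sum n - 2 ^+ n <= \sum_(k < 2 ^ n) ((odd_angle n k) ^+ 2)^-1.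
  have -> : 2 ^+ n = \sum_(k < 2 ^ n) (1 : R) by rewrite sumr_const card_ord -natrX.
  rewrite -sumrB; apply: ler_sum => k _.
  by have /inv_sqr_bounds/andP[] := odd_angle_bounds (ltn_ord k).
rewrite sin_sumE in u l.
have t0 : 2 ^+ n != 0 :> R by rewrite expf_neq0.
have q : 4 ^+ n = 2 ^+ n * 2 ^+ n :> R by rewrite -exprMn; congr (_ ^+ _); lra.
have e1 : pi ^+ 2 / 8 = c * (2 * 4 ^+ n).
  by rewrite /c q !exprS; field.
have e2 : pi ^+ 2 / 16 * (2 ^+ n)^-1 = c * 2 ^+ n.
  by rewrite /c !exprS; field.
by rewrite e1 e2 -mulrBr !ler_pM2l ?l.
Qed.

Lemma zpart2_odd n : @zpart R 2 n.*2 = odd_part n + 4^-1 * zpart R 2 n.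
Proof.
elim: n => [|n IHn]; first by rewrite /zpart /odd_part !big_ord0 mulr0 addr0.
rewrite doubleS /zpart big_ord_recr big_ord_recr /= -/(zpart R 2 n.*2) IHn.
rewrite /odd_part big_ord_recr /= -/(odd_part n) /zpart [X in _ = _ + _ * X]big_ord_recr /=.
have -> : n.*2.+1%:R = 2 * n%:R + 1 :> R by rewrite -natr1 -mul2n natrM.
have -> : n.*2.+2%:R = 2 * n.+1%:R :> R by rewrite -doubleS -mul2n natrM.
rewrite -/(zpart R 2 n); have n1 : n.+1%:R != 0 :> R by rewrite pnatr_eq0.
have n2 : 2 * n%:R + 1 != 0 :> R by rewrite -[2]/(2%:R) -natrM natr1 pnatr_eq0.
by move: (n.+1%:R : R) n1 => x n1; field; rewrite n1 n2.
Qed.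

Lemma cvg_pow2 : (2 ^ n)%N @[n --> \oo] --> \oo.
Proof.
apply/cvgnyPge => A; near=> n; apply: leq_trans (ltnW (ltn_expl n (isT : (1 < 2)%N))).
by near: n; exact: nbhs_infty_ge.
Unshelve. all: by end_near. Qed.

Lemma zeta2 : zeta R 2 = pi ^+ 2 / 6.
Proof.
have c1 := cvg_comp _ _ cvg_pow2 (@cvg_zpart R 2 isT).
have c2 : zpart R 2 (2 ^ n.+1)%N @[n --> \oo] --> zeta R 2.
  by rewrite (cvg_shiftS (fun n => zpart R 2 (2 ^ n)%N)).
have c3 : odd_part (2 ^ n) @[n --> \oo] --> zeta R 2 - 4^-1 * zeta R 2.
  have -> : (fun n => odd_part (2 ^ n)) =
     (fun n => zpart R 2 (2 ^ n.+1) - 4^-1 * zpart R 2 (2 ^ n)).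
    by apply/funext => n; rewrite expnS mul2n zpart2_odd addrK.
  by apply: cvgB => //; apply: cvgM => //; exact: cvg_cst.
have c4 : odd_part (2 ^ n) @[n --> \oo] --> pi ^+ 2 / 8.
  apply: (@squeeze_cvgr _ _ _ _ (fun n => pi ^+ 2 / 8 - pi ^+ 2 / 16 * (2 ^+ n)^-1)
     (fun=> pi ^+ 2 / 8)).
  - by near=> n; exact: odd_part_bounds.
  - rewrite -[X in _ --> X]subr0; apply: cvgB; first exact: cvg_cst.
    rewrite -[X in _ --> X](mulr0 (pi ^+ 2 / 16)); apply: cvgM; first exact: cvg_cst.
    under eq_cvg do rewrite -exprVn.
    by apply: cvg_expr; rewrite ger0_norm ?invr_ge0 // invf_lt1 ?ltr1n.
  - exact: cvg_cst.
have : zeta R 2 - 4^-1 * zeta R 2 = pi ^+ 2 / 8 := @norm_cvg_unique R R^o _ _ _ _ c3 c4.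
move=> h; have -> : zeta R 2 = (zeta R 2 - 4^-1 * zeta R 2) * (4 / 3) by field.
by rewrite h; field.
Unshelve. all: by end_near. Qed.

Lemma zeta_even m : (0 < m)%N ->
  zeta R m.*2 = - (-1) ^+ m * ratr (beta m.*2) * (2 * pi) ^+ m.*2 / 2.
Proof.
pose e m : R := - (-1) ^+ m * ratr (beta m.*2) * (2 * pi) ^+ m.*2 / 2.
rewrite -/(e m); have [n] := ubnP m; elim: n => // n IHn in m *; rewrite ltnS.
case: m => [|[|m]] // mn _.
  rewrite zeta2 /e.
  have b2 : beta 2 = 12^-1.
    have := beta_rec (n := 2) isT; rewrite big_ord1 beta1 mul0r oppr0 add0r /= => h.
    by apply: (mulfI (_ : 3%:R != 0)) => //; rewrite h.
  by rewrite b2 fmorphV rmorph_nat; field.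
have m0 : m%:R + 5 / 2 != 0 :> R by rewrite gt_eqF // addr_gt0.
have r : \sum_(j < m.+1) e j.+1 * e (m.+1 - j)%N = (m%:R + 5 / 2) * e m.+2.
  have B := congr1 (@ratr R) (beta_even_rec (m := m.+2) isT).
  rewrite rmorphM rmorph_nat rmorphN rmorph_sum /= in B.
  have -> : (m%:R + 5 / 2) * e m.+2 = (m.+2.*2.+1%:R * ratr (beta m.+2.*2)) *
      (- (-1) ^+ m.+2 * (2 * pi) ^+ m.+2.*2 / 4).
    have -> : m.+2.*2.+1%:R = 2 * (m%:R + 5 / 2) :> R.
      by rewrite -natr1 -mul2n natrM -[m.+2%:R]natr1 -[m.+1%:R]natr1; field.
    by rewrite /e; field.
  rewrite B [RHS]mulNr mulr_suml -sumrN; apply: eq_bigr => j _.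
  have jm : (j <= m)%N by rewrite -ltnS.
  rewrite rmorphM /= subSS /e.
  have -> : (-1) ^+ m.+2 = (-1) ^+ j.+1 * (-1) ^+ (m.+1 - j) :> R.
    by rewrite -exprD; congr (_ ^+ _); lia.
  have -> : (2 * pi) ^+ m.+2.*2 = (2 * pi) ^+ j.+1.*2 * (2 * pi) ^+ (m.+1 - j).*2.
    by rewrite -exprD; congr (_ ^+ _); lia.
  by field.
apply: (mulfI m0); rewrite -r -zeta_even_rec; apply: eq_bigr => j _.
have jm := ltn_ord j.
by rewrite IHn ?IHn //; lia.
Qed.

End Basel.

(** * The coefficients of the associator *)

Section RealFunctions.
Variable R : realType.
Implicit Types (f g : R -> R) (F : set_system R).

Lemma cst_on_01 f : (forall z : R, 0 < z < 1 -> is_derive z 1 f 0) ->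
  forall x y : R, 0 < x < 1 -> 0 < y < 1 -> f x = f y.
Proof.
move=> df x y; wlog xy : x y / x < y.
  move=> H x01 y01; have [xy|yx|->] := ltgtP x y; [exact: H|exact/esym/H|by []].
move=> /andP[x0 x1] /andP[y0 y1].
have I z : x <= z <= y -> 0 < z < 1.
  by case/andP=> xz zy; rewrite (lt_le_trans x0 xz) (le_lt_trans zy y1).
have dI z : z \in `]x, y[%R -> is_derive z 1 f 0.
  by rewrite in_itv /= => /andP[/ltW xz /ltW zy]; apply/df/I; rewrite xz zy.
have cI : {within `[x, y], continuous f}.
  apply: derivable_within_continuous => z zxy.
  have dz : is_derive z 1 f 0 by apply/df/I; move: zxy; rewrite in_itv.
  exact: ex_derive.
have [c _] := @MVT R f (fun=> 0) x y xy dI cI.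
by rewrite mul0r => /eqP; rewrite subr_eq0 => /eqP.
Qed.

Definition inside01 F := \forall z \near F, 0 < z < 1.

Lemma inside01_right0 : inside01 (0:R)^'+.
Proof.
rewrite /inside01; near=> z; apply/andP; split; first by near: z; exact: nbhs_right_gt.
by near: z; apply: nbhs_right_lt; exact: ltr01.
Unshelve. all: by end_near. Qed.

Lemma inside01_left1 : inside01 (1:R)^'-.
Proof.
rewrite /inside01; near=> z; apply/andP; split; last by near: z; exact: nbhs_left_lt.
by near: z; apply: nbhs_left_gt; exact: ltr01.
Unshelve. all: by end_near. Qed.

(** Uniqueness for the KZ equation is used in this scalar form: a zero derivative and a limit at one
    end of the interval. *)
Lemma cst_eq_lim f F (l : R) : ProperFilter F -> inside01 F ->
  (forall z : R, 0 < z < 1 -> is_derive z 1 f 0) -> f z @[z --> F] --> l ->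
  forall z, 0 < z < 1 -> f z = l.
Proof.
move=> PF F01 df fl z z01.
have PF' : ProperFilter (f z @[z --> F]) by exact: fmap_proper_filter.
apply: (@norm_cvg_unique R R^o _ PF' (f z) l); last exact: fl.
by apply: cvg_near_cst; near=> y; apply: cst_on_01 => //; near: y; exact: F01.
Unshelve. all: by end_near. Qed.

Lemma cvg_eq_inside f g F (l : R) : Filter F -> inside01 F ->
  (forall z, 0 < z < 1 -> f z = g z) -> f z @[z --> F] --> l -> g z @[z --> F] --> l.
Proof.
move=> FF F01 fg; apply: cvg_trans; apply: near_eq_cvg.
by near=> z; apply: fg; near: z; exact: F01.
Unshelve. all: by end_near. Qed.

Lemma is_derive_seq_sum (I : Type) (r : seq I) (h dh : I -> R -> R) (z : R) :
  (forall i, is_derive z 1 (h i) (dh i z)) ->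
  is_derive z 1 (fun t => \sum_(i <- r) h i t) (\sum_(i <- r) dh i z).
Proof.
move=> hd; elim: r => [|i r IHr].
  rewrite big_nil; under eq_fun do rewrite big_nil.
  exact: is_derive_cst.
rewrite big_cons; under eq_fun do rewrite big_cons.
exact: is_deriveD.
Qed.

Lemma is_derive_mul f g (z df dg d : R) : is_derive z 1 f df -> is_derive z 1 g dg ->
  d = df * g z + f z * dg -> is_derive z 1 (fun t => f t * g t) d.
Proof.
move=> hf hg dE; have H := @is_deriveM R R^o f g z 1 df dg hf hg.
apply: (is_derive_eq H); rewrite dE addrC; congr (_ + _); exact: mulrC.
Qed.

Lemma is_derive_sub f g (z df dg d : R) : is_derive z 1 f df -> is_derive z 1 g dg ->
  d = df - dg -> is_derive z 1 (fun t => f t - g t) d.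
Proof. by move=> hf hg ->; exact: is_deriveB. Qed.

End RealFunctions.

(** * Group-likeness of the solutions of the KZ equation *)

Section KZGroupLike.
Variable R : realType.
Implicit Types (G : R -> ncseries R) (F : set_system R).
Local Notation x0 := (letter R false).
Local Notation x1 := (letter R true).

Lemma letter_powE x n w : nccoef (letter R x ^+ n) w = (w == nseq n x)%:R.
Proof.
elim: n w => [|n IHn] [|y w] //.
  by rewrite nccoefX_nil expr0n.
rewrite exprS -[LHS]/(nccoef (ncL y (letter R x * letter R x ^+ n)) w).
rewrite ncL_letterM /= eqseq_cons; case: eqP => //= _.
Qed.

Lemma ncexp_letterE (t : R) x : ncexp (t *: letter R x) =
  NCSeries (fun w => if all (pred1 x) w then t ^+ size w / (size w)`!%:R else 0).
Proof.
apply: ncseriesP => w; rewrite /=.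
under eq_bigr => n _ do rewrite exprZn nccoefZ letter_powE.
have [/all_pred1P wx|wx] := boolP (all _ w).
  rewrite big_ord_recr /= -wx eqxx mulr1 big1 ?add0r 1?mulrC // => n _.
  case: eqP => [wn|_]; rewrite ?mulr0 //.
  by have := ltn_ord n; rewrite {2}wn size_nseq ltnn.
rewrite big1 // => n _; case: eqP => [wn|_]; rewrite ?mulr0 //.
by case/negP: wx; rewrite wn; apply/all_pred1P; rewrite size_nseq.
Qed.

Lemma glike_exp_letter (t : R) x : glike (ncexp (t *: letter R x)).
Proof.
split; first exact: ncexp_nil.
move=> u v; rewrite ncexp_letterE (sh_power x (fun n => t ^+ n / n`!%:R)) /=.
case: (all _ u) => /=; rewrite ?mul0r //; case: (all _ v); rewrite ?mulr0 //.
set m := size u; set n := size v.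
have f0 k : (k`!)%:R != 0 :> R by rewrite pnatr_eq0 -lt0n fact_gt0.
rewrite -mulr_natr -(bin_fact (leq_addr n m)) addKn !natrM exprD; field.
by rewrite !f0 pnatr_eq0 -lt0n bin_gt0 leq_addr.
Qed.

Lemma ncinv_pow (s : R) x : ncinv (ncpow s (letter R x)) = ncexp ((- ln s) *: letter R x).
Proof. by rewrite /ncpow ncexp_inv ?scaleNr //; apply/ncordZ/ncord_letter. Qed.

Definition kz_form (z : R) (x : bool) : R := if x then (z - 1)^-1 else z^-1.

Lemma KZ_deriv G : KZ_solution G -> forall z : R, 0 < z < 1 -> forall w,
  is_derive z 1 (fun t => nccoef (G t) w)
    (if w is x :: w' then kz_form z x * nccoef (G z) w' else 0).
Proof.
move=> KZ z z01 w; apply: (is_derive_eq (KZ z z01 w)).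
case: w => [|x w]; first by rewrite nccoefM_nil /= !mulr0 addr0 mul0r.
rewrite -[LHS]/(nccoef (ncL x _) w) mulrDl -!scalerAl ncLD !ncLZ !ncL_letterM.
by case: x; rewrite /= ?mulr0 ?add0r ?addr0.
Qed.

Section Solution.
(** Treats both end points at once: F is 0+ with s z = z, or 1- with s z = 1 - z. *)
Variables (G : R -> ncseries R) (F : set_system R) (s : R -> R) (y : bool).
Hypotheses (KZ : KZ_solution G) (PF : ProperFilter F) (F01 : inside01 F).
Hypothesis asym : forall w,
  nccoef (G z * ncinv (ncpow (s z) (letter R y))) w @[z --> F] --> nccoef (1 : ncseries R) w.

Lemma KZ_nil (z : R) : 0 < z < 1 -> nccoef (G z) [::] = 1.
Proof.
move: z; apply: (cst_eq_lim PF F01) => [z z01|]; first exact: (KZ_deriv KZ z01 [::]).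
have A := @asym [::]; rewrite nccoef1 eqxx in A.
apply: (cvg_eq_inside _ F01 _ A) => z _.
by rewrite nccoefM_nil ncinv_nil mulr1.
Qed.

Lemma KZ_sh_deriv (z : R) u v : 0 < z < 1 -> is_derive z 1 (fun t => sh (G t) u v)
  (\sum_(w <- shuffle u v) (if w is x :: w' then kz_form z x * nccoef (G z) w' else 0)).
Proof.
move=> z01; exact: (@is_derive_seq_sum R _ (shuffle u v) (fun w t => nccoef (G t) w)
  (fun w z => if w is x :: w' then kz_form z x * nccoef (G z) w' else 0) z
  (fun w => KZ_deriv KZ z01 w)).
Qed.

Lemma KZ_sh_cons_deriv (z : R) x x' u v : 0 < z < 1 -> is_derive z 1 (fun t => sh (G t) (x :: u) (x' :: v))
  (kz_form z x * sh (G z) u (x' :: v) + kz_form z x' * sh (G z) (x :: u) v).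
Proof.
move=> z01; apply: (is_derive_eq (KZ_sh_deriv _ _ z01)).
by rewrite shuffle_cons big_cat !big_map /= /sh !mulr_sumr.
Qed.

Lemma cvg_sh (H : R -> ncseries R) (h : ncseries R) u v :
  (forall w, nccoef (H z) w @[z --> F] --> nccoef h w) ->
  sh (H z) u v @[z --> F] --> sh h u v.
Proof. by move=> Hh; apply: cvg_big => //; exact: add_continuous. Qed.

Lemma KZ_glike (z : R) : 0 < z < 1 -> glike (G z).
Proof.
move=> z01; split; first exact: KZ_nil.
suff D u v : forall z : R, 0 < z < 1 -> shdef (G z) u v = 0.
  by move=> u v; apply/eqP; rewrite -subr_eq0; apply/eqP/D.
move=> {z01}z; have [n] := ubnP (size u + size v); elim: n => // n IHn in u v z *; rewrite ltnS => uvn.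
case: u uvn => [|x u] uvn z01.
  by rewrite /shdef sh0s KZ_nil // mul1r subrr.
case: v uvn => [|x' v] uvn.
  by rewrite /shdef shs0 KZ_nil // mulr1 subrr.
move: z z01; apply: (cst_eq_lim PF F01) => [z z01|].
  apply: is_derive_sub (KZ_sh_cons_deriv _ _ _ _ z01) _ _.
    apply: is_derive_mul (KZ_deriv KZ z01 (x :: u)) (KZ_deriv KZ z01 (x' :: v)) _.
    exact: erefl.
  have E1 := IHn u (x' :: v) z uvn z01.
  have E2 : shdef (G z) (x :: u) v = 0 by apply: IHn => //; move: uvn => /=; lia.
  move/eqP: E1; rewrite subr_eq0 => /eqP ->.
  move/eqP: E2; rewrite subr_eq0 => /eqP ->.
  by rewrite /=; ring.
(* Coefficients of G may diverge logarithmically at the end point. The asymptotic factor removes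
   this and, by [shdef_mulr], leaves the defect unchanged. *)
pose H (z : R) := G z * ncinv (ncpow (s z) (letter R y)).
have -> : 0 = shdef (1 : ncseries R) (x :: u) (x' :: v) :> R.
  by rewrite /shdef (glike1 R).2 subrr.
apply: (@cvg_eq_inside R (fun z : R => shdef (H z) (x :: u) (x' :: v))) => // [z z01|].
  rewrite /H ncinv_pow shdef_mulr //; first exact: glike_exp_letter.
  by move=> u' v' lt; apply: IHn => //; apply: leq_trans uvn.
apply: cvgB; first exact: cvg_sh.
by apply: cvgM; apply: asym.
Qed.

End Solution.

Lemma glike_associator (Phi : ncseries R) : drinfeld_associator Phi -> glike Phi.
Proof.
move=> [G0 [G1 [KZ0 KZ1 as0 as1 PhiE]]].
have h01 : 0 < (2^-1 : R) < 1 by rewrite invr_gt0 ltr0n invf_lt1 ?ltr0n // ltr1n.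
have g0 : glike (G0 2^-1).
  exact: (@KZ_glike G0 (0:R)^'+ id false KZ0 _ (inside01_right0 R) as0).
have g1 : glike (G1 2^-1).
  exact: (@KZ_glike G1 (1:R)^'- (fun z => 1 - z) true KZ1 _ (inside01_left1 R) as1).
rewrite (PhiE _ h01); apply: (glike_cancel _ g1).
  by rewrite nccoefM_nil ncinv_nil (glike_nil g0) mulr1.
by rewrite mulrA ncmulxV ?(glike_nil g1) // mul1r.
Qed.

End KZGroupLike.

(** * Limits of logarithms at the end points *)

Section LimitsAtOne.
Variable R : realType.

Lemma cvg_ln_left1 : ln z @[z --> (1:R)^'-] --> (0 : R).
Proof. by rewrite -(ln1 R); apply: cvg_at_left_filter; apply: continuous_ln. Qed.

Lemma cvg_ln_left1X n : ln z ^+ n @[z --> (1:R)^'-] --> (0 ^+ n : R).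
Proof.
exact: (@cvg_comp _ _ _ (@ln R) (fun t => t ^+ n) _ _ _ cvg_ln_left1
  (@exprn_continuous R n 0)).
Qed.

Lemma cvg_1B (a : R) : (1 - z) @[z --> a] --> 1 - a.
Proof. by apply: cvgB; [exact: cvg_cst|exact: cvg_id]. Qed.

Lemma cvg_ln1B_right0 : ln (1 - z) @[z --> (0:R)^'+] --> (0 : R).
Proof.
rewrite -[X in _ --> X](ln1 R) -{2}(subr0 1); apply: cvg_at_right_filter.
apply: (cvg_comp _ _ (@cvg_1B 0)); apply: continuous_ln.
by rewrite subr0.
Qed.

(** Near 1 one has |ln z| <= 2(1 - z) and |ln(1 - z)| <= 2/sqrt(1 - z), whence the majorant 4 sqrt(1
    - z). *)
Lemma cvg_ln_ln1B : ln z * ln (1 - z) @[z --> (1:R)^'-] --> (0 : R).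
Proof.
apply/norm_cvg0P.
have c4 : 4 * Num.sqrt (1 - z) @[z --> (1:R)^'-] --> (0 : R).
  rewrite -(mulr0 4) -(sqrtr0 R) -(subrr 1); apply: cvgM; first exact: cvg_cst.
  apply: cvg_at_left_filter; apply: (cvg_comp _ _ (@cvg_1B 1)).
  exact: sqrt_continuous.
apply: (squeeze_cvgr _ (cvg_cst 0) c4).
near=> z.
have z1 : z < 1 by near: z; exact: nbhs_left_lt.
have zh : 2^-1 < z by near: z; apply: nbhs_left_gt; rewrite invf_lt1 ?ltr1n.
have z0 : 0 < z by apply: lt_trans zh; rewrite invr_gt0.
rewrite normr_ge0 /= normrM.
have u0 : 0 < 1 - z by rewrite subr_gt0.
have s0 : 0 < Num.sqrt (1 - z) by rewrite sqrtr_gt0.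
have su : Num.sqrt (1 - z) ^+ 2 = 1 - z by rewrite sqr_sqrtr // ltW.
have l1 : `|ln z| <= 2 * (1 - z).
  rewrite ler0_norm ?(ln_le0 (ltW z1)) // -lnV ?posrE //.
  have := @le_ln1Dx R (z^-1 - 1); have -> : 1 + (z^-1 - 1) = z^-1 by ring.
  move=> h.
  have h0 : -1 < z^-1 - 1 by rewrite ltrBrDl subrr invr_gt0.
  apply: (le_trans (h h0)).
  have -> : z^-1 - 1 = (1 - z) / z by field; rewrite gt_eqF.
  rewrite mulrC ler_pM2r // -[2]invrK lef_pV2 ?posrE ?invr_gt0 //; exact: ltW.
have l2 : `|ln (1 - z)| <= 2 / Num.sqrt (1 - z).
  have le1 : 1 - z <= 1 by rewrite gerBl ltW.
  have lE : ln (1 - z) = 2 * ln (Num.sqrt (1 - z)) by rewrite -{1}su lnXn // mulr_natl.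
  rewrite ler0_norm ?ln_le0 // lE -mulrN ler_pM2l //.
  rewrite -lnV ?posrE //; apply: ltW; apply: ln_sublinear.
  by rewrite invr_gt0.
apply: (le_trans (ler_pM (normr_ge0 _) (normr_ge0 _) l1 l2)).
move: s0 su; move: (Num.sqrt (1 - z)) => r r0 <-.
have -> : 2 * r ^+ 2 * (2 / r) = 4 * r by field; rewrite gt_eqF.
by [].
Unshelve. all: by end_near. Qed.

End LimitsAtOne.

(** * Bounds for polylogarithms by integration *)

Section Monotone.
Variable R : realType.

Lemma nonneg_of_derive (f df : R -> R) (b : R) : 0 < b <= 1 ->
  (forall z, 0 < z < b -> is_derive z 1 f (df z)) ->
  (forall z, 0 < z < b -> 0 <= df z) ->
  f z @[z --> (0:R)^'+] --> (0 : R) ->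
  forall z, 0 < z < b -> 0 <= f z.
Proof.
move=> /andP[b0 b1] fd dpos f0 z /andP[z0 zb].
apply: (@ler_cvg_to _ _ _ _ f (fun=> f z) _ _ f0 (cvg_cst _)).
near=> y.
have y0 : 0 < y by near: y; exact: nbhs_right_gt.
have yz : y < z by near: y; exact: nbhs_right_lt.
have I x : y <= x <= z -> 0 < x < b.
  by case/andP=> yx xz; rewrite (lt_le_trans y0 yx) (le_lt_trans xz zb).
have d x : x \in `]y, z[%R -> is_derive x 1 f (df x).
  by rewrite in_itv /= => /andP[/ltW yx /ltW xz]; apply/fd/I; rewrite yx xz.
have c : {within `[y, z], continuous f}.
  apply: derivable_within_continuous => x xI.
  have dx : is_derive x 1 f (df x) by apply/fd/I; move: xI; rewrite in_itv.
  exact: ex_derive.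
have [x] := @MVT R f df y z yz d c; rewrite in_itv /= => /andP[yx xz] e.
rewrite -subr_ge0 e mulr_ge0 ?subr_ge0 ?(ltW yz) //.
by apply: dpos; apply: I; rewrite !ltW.
Unshelve. all: by end_near. Qed.

(* Partial sums of Li_s. *)
Definition lipart (s n : nat) (z : R) : R := \sum_(k < n) z ^+ k.+1 / k.+1%:R ^+ s.

Lemma is_derive_pow (k : nat) (z : R) : is_derive z 1 (fun t : R => t ^+ k.+1) (k.+1%:R * z ^+ k).
Proof.
elim: k => [|k IHk].
  rewrite expr0 mulr1; under eq_fun do rewrite expr1; exact: is_derive_id.
under eq_fun do rewrite exprS.
apply: (is_derive_mul (is_derive_id z 1) IHk).
by rewrite mul1r mulrCA -exprS -[k.+2%:R]natr1 mulrDl mul1r addrC.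
Qed.

Lemma div_pow_cancel (y : R) k s : y / k.+1%:R ^+ s = k.+1%:R * y / k.+1%:R ^+ s.+1.
Proof. by rewrite exprS invfM mulrACA divff ?mul1r // pnatr_eq0. Qed.

Lemma is_derive_lipart s n (z : R) :
  is_derive z 1 (lipart s.+1 n) (\sum_(k < n) z ^+ k / k.+1%:R ^+ s).
Proof.
rewrite /lipart.
under eq_fun do rewrite -(big_mkord xpredT (fun k => _ ^+ k.+1 / k.+1%:R ^+ s.+1)).
rewrite -(big_mkord xpredT (fun k => z ^+ k / k.+1%:R ^+ s)).
apply: (@is_derive_seq_sum R _ _ (fun k t => t ^+ k.+1 / k.+1%:R ^+ s.+1)
  (fun k z => z ^+ k / k.+1%:R ^+ s)) => k.
apply: (is_derive_mul (is_derive_pow k z) (is_derive_cst _ _ _)).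
have k0 : k.+1%:R != 0 :> R by rewrite pnatr_eq0.
rewrite /cst mulr0 addr0; exact: div_pow_cancel.
Qed.

Lemma cvg_pow_right0 (c : R) k : z ^+ k.+1 * c @[z --> (0:R)^'+] --> (0 : R).
Proof.
apply: cvg_at_right_filter.
have h : z ^+ k.+1 * c @[z --> (0:R)] --> 0 ^+ k.+1 * c.
  by apply: cvgM; [exact: exprn_continuous|exact: cvg_cst].
by rewrite expr0n mul0r in h.
Qed.

Lemma cvg_lipart_right0 s n : lipart s n z @[z --> (0:R)^'+] --> (0 : R).
Proof.
have s0 : \sum_(k < n) (0 : R) = 0 by rewrite big1.
rewrite -[X in _ --> X]s0.
apply: cvg_big => [|k _]; first exact: add_continuous.
exact: (@cvg_pow_right0 (k.+1%:R ^+ s)^-1 k).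
Qed.

Lemma lipart_left1 s n : lipart s n z @[z --> (1:R)^'-] --> zpart R s n.
Proof.
apply: cvg_big => [|k _]; first exact: add_continuous.
rewrite -[X in _ --> X]mul1r; apply: cvgM; last exact: cvg_cst.
by rewrite -[X in _ --> X](expr1n R k.+1); apply: cvg_at_left_filter; exact: exprn_continuous.
Qed.

(* Integrates Li_(s+1)' = Li_s / z. *)
Lemma lipart_step s N (b c : R) (f D : R -> R) : 0 < b <= 1 ->
  f z @[z --> (0:R)^'+] --> (0 : R) ->
  (forall z, 0 < z < b -> is_derive z 1 f (D z)) ->
  (forall z, 0 < z < b -> 0 <= D z - \sum_(k < N) z ^+ k / k.+1%:R ^+ s <=
     z ^+ N * (c / N.+1%:R ^+ s)) ->
  forall z, 0 < z < b -> 0 <= f z - lipart s.+1 N z <= z ^+ N.+1 * (c / N.+1%:R ^+ s.+1).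
Proof.
move=> b01 f0 fd Db z zb.
have N0 : N.+1%:R != 0 :> R by rewrite pnatr_eq0.
have d1 y : 0 < y < b -> is_derive y 1 (fun t => f t - lipart s.+1 N t)
    (D y - \sum_(k < N) y ^+ k / k.+1%:R ^+ s).
  by move=> yb; exact: (is_derive_sub (fd y yb) (is_derive_lipart s N y) erefl).
have l1 : (f z - lipart s.+1 N z) @[z --> (0:R)^'+] --> (0 : R).
  by rewrite -[X in _ --> X](subrr 0); apply: cvgB => //; exact: cvg_lipart_right0.
apply/andP; split.
  move: z zb; apply: (nonneg_of_derive b01 d1 _ l1) => z zb.
  by case/andP: (Db z zb).
rewrite -subr_ge0; move: z zb; apply: (@nonneg_of_derive _
  (fun y => y ^+ N * (c / N.+1%:R ^+ s) - (D y - \sum_(k < N) y ^+ k / k.+1%:R ^+ s)) _ b01).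
- move=> z zb; apply: (is_derive_sub _ (d1 z zb) erefl).
  apply: (is_derive_mul (is_derive_pow N z) (is_derive_cst _ _ _)).
  rewrite /cst mulr0 addr0 mulrCA -[RHS]mulrCA; congr (c * _); exact: div_pow_cancel.
- by move=> z zb; rewrite subr_ge0; case/andP: (Db z zb).
- rewrite -[X in _ --> X](subrr 0); apply: cvgB; last exact: l1.
  exact: cvg_pow_right0.
Qed.

End Monotone.

(** * Coefficients of G_0, G_1 and Phi at x_0^n and x_0^n x_1 *)

Section Associator.
Variable R : realType.
Variables (G0 G1 : R -> ncseries R) (Phi : ncseries R).
Hypotheses (KZ0 : KZ_solution G0) (KZ1 : KZ_solution G1).
Hypotheses (as0 : asymptotic0 G0) (as1 : asymptotic1 G1).
Hypothesis PhiE : forall z : R, 0 < z < 1 -> Phi = ncinv (G1 z) * G0 z.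

Let pr0 : ProperFilter (0:R)^'+ := at_right_proper_filter 0.
Let pl1 : ProperFilter (1:R)^'- := at_left_proper_filter 1.
Let in0 := inside01_right0 R.
Let in1 := inside01_left1 R.

Let G0_glike z : 0 < z < 1 -> glike (G0 z).
Proof. exact: (@KZ_glike R G0 (0:R)^'+ id false KZ0 _ in0 as0). Qed.
Let G1_glike z : 0 < z < 1 -> glike (G1 z).
Proof. exact: (@KZ_glike R G1 (1:R)^'- (fun z => 1 - z) true KZ1 _ in1 as1). Qed.

Let G1Phi z : 0 < z < 1 -> G0 z = G1 z * Phi.
Proof.
by move=> z01; rewrite (PhiE z01) mulrA ncmulxV ?mul1r // (glike_nil (G1_glike z01)).
Qed.

Lemma nccoefM_letter (f g : ncseries R) x : nccoef (f * g) [:: x] =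
  nccoef f [::] * nccoef g [:: x] + nccoef f [:: x] * nccoef g [::].
Proof. by rewrite nccoefM big_ord_recl big_ord1. Qed.

Lemma ncexp_letter_coef (t : R) x y :
  nccoef (ncexp (t *: letter R y)) [:: x] = if x == y then t else 0.
Proof. by rewrite ncexp_letterE /= andbT; case: eqP => // _; rewrite expr1 divr1. Qed.

Lemma ncexp_letter_nil (t : R) y : nccoef (ncexp (t *: letter R y)) [::] = 1.
Proof. exact: ncexp_nil. Qed.

Let as0_coef w : nccoef (G0 z * ncexp ((- ln z) *: letter R false)) w @[z --> (0:R)^'+] -->
  nccoef (1 : ncseries R) w.
Proof. by have := @as0 w; under eq_cvg do rewrite ncinv_pow. Qed.

Let as1_coef w : nccoef (G1 z * ncexp ((- ln (1 - z)) *: letter R true)) w @[z --> (1:R)^'-] -->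
  nccoef (1 : ncseries R) w.
Proof. by have := @as1 w; under eq_cvg do rewrite ncinv_pow. Qed.

Let G0_x0 z : 0 < z < 1 -> nccoef (G0 z) [:: false] = ln z.
Proof.
move=> z01; apply/eqP; rewrite -subr_eq0; apply/eqP; move: z z01.
apply: (cst_eq_lim pr0 in0) => [z z01|].
  apply: (is_derive_sub (KZ_deriv KZ0 z01 [:: false])).
    by apply: is_derive1_ln; case/andP: z01.
  by rewrite (glike_nil (G0_glike z01)) mulr1 subrr.
apply: (cvg_eq_inside _ in0 _ (@as0_coef [:: false])) => z z01.
by rewrite nccoefM_letter ncexp_letter_coef ncexp_letter_nil (glike_nil (G0_glike z01)) mulr1 mul1r addrC.
Qed.

Let G1_x0 z : 0 < z < 1 -> nccoef (G1 z) [:: false] = ln z.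
Proof.
move=> z01; apply/eqP; rewrite -subr_eq0; apply/eqP; move: z z01.
apply: (cst_eq_lim pl1 in1) => [z z01|].
  apply: (is_derive_sub (KZ_deriv KZ1 z01 [:: false])).
    by apply: is_derive1_ln; case/andP: z01.
  by rewrite (glike_nil (G1_glike z01)) mulr1 subrr.
rewrite -[X in _ --> X]subr0; apply: cvgB; last exact: cvg_ln_left1.
apply: (cvg_eq_inside _ in1 _ (@as1_coef [:: false])) => z z01.
by rewrite nccoefM_letter ncexp_letter_coef ncexp_letter_nil (glike_nil (G1_glike z01)) mulr1 mulr0 add0r.
Qed.

Let is_derive_ln1B (z : R) : 0 < z < 1 -> is_derive z 1 (fun t : R => ln (1 - t)) (z - 1)^-1.
Proof.
move=> /andP[z0 z1]; have u0 : 0 < 1 - z by rewrite subr_gt0.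
have d1 := is_derive1_ln u0.
have d2 : is_derive z 1 (fun t : R => 1 - t) (-1).
  by apply: (is_derive_sub (is_derive_cst _ _ _) (is_derive_id _ _)); rewrite sub0r.
have H := @is_derive1_comp R (@ln R) (fun t : R => 1 - t) z _ _ d1 d2.
apply: (is_derive_eq H).
by rewrite mulrN1 -invrN opprB.
Qed.

Let G0_x1 z : 0 < z < 1 -> nccoef (G0 z) [:: true] = ln (1 - z).
Proof.
move=> z01; apply/eqP; rewrite -subr_eq0; apply/eqP; move: z z01.
apply: (cst_eq_lim pr0 in0) => [z z01|].
  apply: (is_derive_sub (KZ_deriv KZ0 z01 [:: true]) (is_derive_ln1B z01)).
  by rewrite (glike_nil (G0_glike z01)) mulr1 subrr.
rewrite -[X in _ --> X]subr0; apply: cvgB; last exact: cvg_ln1B_right0.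
apply: (cvg_eq_inside _ in0 _ (@as0_coef [:: true])) => z z01.
by rewrite nccoefM_letter ncexp_letter_coef ncexp_letter_nil (glike_nil (G0_glike z01)) mulr1 mulr0 add0r.
Qed.

Let G1_x1 z : 0 < z < 1 -> nccoef (G1 z) [:: true] = ln (1 - z).
Proof.
move=> z01; apply/eqP; rewrite -subr_eq0; apply/eqP; move: z z01.
apply: (cst_eq_lim pl1 in1) => [z z01|].
  apply: (is_derive_sub (KZ_deriv KZ1 z01 [:: true]) (is_derive_ln1B z01)).
  by rewrite (glike_nil (G1_glike z01)) mulr1 subrr.
apply: (cvg_eq_inside _ in1 _ (@as1_coef [:: true])) => z z01.
by rewrite nccoefM_letter ncexp_letter_coef ncexp_letter_nil (glike_nil (G1_glike z01)) mulr1 mul1r addrC.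
Qed.

Lemma sh_letter_power (f : ncseries R) x n :
  sh f [:: x] (nseq n x) = n.+1%:R * nccoef f (nseq n.+1 x).
Proof.
elim: n f => [|n IHn] f; first by rewrite shs0 mul1r.
rewrite sh_cons sh0s IHn /= -[n.+2%:R]nat1r mulrDl mul1r.
by [].
Qed.

(** Shuffling x with x^n gives n + 1 copies of x^(n+1). *)
Lemma glike_power (g : ncseries R) x n : glike g ->
  nccoef g (nseq n x) = nccoef g [:: x] ^+ n / n`!%:R.
Proof.
move=> [g1 gs]; elim: n => [|n IHn]; first by rewrite g1 expr0 divr1.
have n0 : n.+1%:R != 0 :> R by rewrite pnatr_eq0.
apply: (mulfI n0); rewrite -sh_letter_power gs IHn exprS factS natrM invfM.
by rewrite [RHS]mulrCA mulVKf // mulrA.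
Qed.

(** G_0 and G_1 agree on letters, with values ln z and ln(1 - z), so degree one of G_0 = G_1 Phi
    leaves nothing for Phi. *)
Let Phi_letter x : nccoef Phi [:: x] = 0.
Proof.
have h01 : 0 < (2^-1 : R) < 1 by rewrite invr_gt0 ltr0n invf_lt1 ?ltr0n // ltr1n.
have := congr1 (fun f => nccoef f [:: x]) (G1Phi h01).
have Phi1 : nccoef Phi [::] = 1 by rewrite (PhiE h01) nccoefM_nil ncinv_nil mul1r (glike_nil (G0_glike h01)).
rewrite nccoefM_letter Phi1 (glike_nil (G1_glike h01)) mul1r mulr1.
have -> : nccoef (G0 2^-1) [:: x] = nccoef (G1 2^-1) [:: x].
  by case: x; rewrite ?G0_x0 ?G1_x0 ?G0_x1 ?G1_x1.
by move=> /eqP; rewrite -subr_eq subrr => /eqP.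
Qed.

Let Phi_glike : glike Phi.
Proof. by apply: glike_associator; exists G0, G1. Qed.

Lemma associator_x0 n : nccoef Phi (nseq n false) = (n == 0%N)%:R.
Proof.
rewrite (glike_power _ _ Phi_glike) Phi_letter expr0n.
by case: n => [|n]; rewrite ?mul0r // divr1.
Qed.

(* The words x_0^n x_1; their coefficient in G_0 is - Li_(n+1). *)
Local Notation xw n := (rcons (nseq n false) true).

Let ncR_exp_false (t : R) : ncR true (ncexp (t *: letter R false)) = 0.
Proof.
apply: ncseriesP => w; rewrite ncexp_letterE /= all_rcons.
by rewrite andbC andbF.
Qed.

(** The asymptotic factor at 0 involves x_0 alone, so it does not affect words x_0^n x_1 ending in
    x_1. *)
Let G0_xw_cvg n : nccoef (G0 z) (xw n) @[z --> (0:R)^'+] --> (0 : R).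
Proof.
have := @as0_coef (xw n).
have -> : nccoef (1 : ncseries R) (xw n) = 0 by case: n.
move=> h; apply: (cvg_eq_inside _ in0 _ h) => z z01.
rewrite -[LHS]/(nccoef (ncR true _) _) ncRM ncR_exp_false mulr0 add0r.
by rewrite ncexp_letter_nil scale1r.
Qed.

(** On ]0, b[ the remainder of the geometric series is at most z^N/(1 - b); each integration against
    dz/z divides this bound by N + 1, as it does the first omitted term. *)
Let G0_xw_bounds n N (b : R) : 0 < b < 1 -> forall z, 0 < z < b ->
  0 <= - nccoef (G0 z) (xw n) - lipart n.+1 N z <=
  z ^+ N.+1 * ((1 - b)^-1 / N.+1%:R ^+ n.+1).
Proof.
move=> /andP[b0 b1]; have bb : 0 < b <= 1 by rewrite b0 ltW.
have sub z : 0 < z < b -> 0 < z < 1 by case/andP=> -> /lt_trans ->.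
have N0 : N.+1%:R != 0 :> R by rewrite pnatr_eq0.
elim: n => [|n IHn].
  apply: (@lipart_step _ 0 N b (1 - b)^-1 (fun z => - nccoef (G0 z) (xw 0)) (fun z => (1 - z)^-1) bb).
  - rewrite -[X in _ --> X]oppr0; apply: cvgN; exact: G0_xw_cvg.
  - move=> z zb; have z01 := sub _ zb.
    apply: (is_derive_eq (is_deriveN (KZ_deriv KZ0 z01 [:: true]))).
    by rewrite (glike_nil (G0_glike z01)) mulr1 -invrN opprB.
  - move=> z zb; have /andP[_ z1] := sub _ zb; case/andP: (zb) => z0 zltb.
    have u0 : 0 < 1 - z by rewrite subr_gt0.
    have -> : (1 - z)^-1 - \sum_(k < N) z ^+ k / k.+1%:R ^+ 0 = z ^+ N * (1 - z)^-1.
      apply: (mulIf (lt0r_neq0 u0)); rewrite mulrBl mulVf ?lt0r_neq0 //.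
      rewrite divfK ?lt0r_neq0 //.
      under eq_bigr do rewrite expr0 divr1.
      by rewrite -[1 - z]opprB mulrN opprK mulrC -subrX1 addrC subrK.
    rewrite expr0 divr1 mulr_ge0 ?exprn_ge0 ?invr_ge0 ?(ltW z0) ?(ltW u0) //=.
    by rewrite ler_pM2l ?exprn_gt0 // lef_pV2 ?posrE ?subr_gt0 // lerD2l lerN2 ltW.
apply: (@lipart_step _ n.+1 N b (1 - b)^-1 (fun z => - nccoef (G0 z) (xw n.+1))
  (fun z => - nccoef (G0 z) (xw n) / z) bb).
- rewrite -[X in _ --> X]oppr0; apply: cvgN; exact: G0_xw_cvg.
- move=> z zb; have z01 := sub _ zb.
  apply: (is_derive_eq (is_deriveN (KZ_deriv KZ0 z01 (xw n.+1)))).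
  by rewrite /= mulNr mulrC.
- move=> z zb; case/andP: (zb) => z0 zltb; case/andP: (IHn z zb) => h0 h1.
  have e : \sum_(k < N) z ^+ k / k.+1%:R ^+ n.+1 = lipart n.+1 N z / z.
    rewrite /lipart mulr_suml; apply: eq_bigr => k _.
    by rewrite [RHS]mulrAC; congr (_ / _); rewrite exprSr mulfK // lt0r_neq0.
  rewrite e -mulrBl divr_ge0 ?(ltW z0) //= ler_pdivrMr // mulrAC -exprSr.
  exact: h1.
Qed.

Let G1_x0n n (z : R) : 0 < z < 1 -> nccoef (G1 z) (nseq n false) = ln z ^+ n / n`!%:R.
Proof. by move=> z01; rewrite (glike_power _ _ (G1_glike z01)) G1_x0. Qed.

Let cvg_ln_pow n : ln z ^+ n / n`!%:R @[z --> (1:R)^'-] --> ((n == 0%N)%:R : R).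
Proof.
have -> : (n == 0%N)%:R = 0 ^+ n / n`!%:R :> R.
  by rewrite expr0n; case: n => [|n]; rewrite ?mul0r // divr1.
by apply: cvgM; [exact: cvg_ln_left1X|exact: cvg_cst].
Qed.

Let nccoef_xwM (f g : ncseries R) n : nccoef (f * g) (xw n) =
  \sum_(i < n.+1) nccoef f (nseq i false) * nccoef g (xw (n - i))
  + nccoef g [::] * nccoef f (xw n).
Proof.
rewrite -[LHS]/(nccoef (ncR true _) _) ncRM nccoefD; congr (_ + _).
rewrite nccoefM size_nseq; apply: eq_bigr => i _.
by rewrite take_nseq ?drop_nseq // -ltnS.
Qed.

Let G1_xw_cvg n : (0 < n)%N -> nccoef (G1 z) (xw n) @[z --> (1:R)^'-] --> (0 : R).
Proof.
case: n => // n _; have h1 := @as1_coef (xw n.+1).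
(* The asymptotic factor adds - ln(1 - z) times the coefficient of x_0^(n+1). One of the n + 1
   factors ln z absorbs the divergence of ln(1 - z), which is impossible for the word x_1 alone. *)
have h2 : (ln z ^+ n / n.+1`!%:R) * (ln z * ln (1 - z)) @[z --> (1:R)^'-] -->
    (0 ^+ n / n.+1`!%:R) * (0 : R).
  apply: cvgM; last exact: cvg_ln_ln1B.
  by apply: cvgM; [exact: cvg_ln_left1X|exact: cvg_cst].
have h : nccoef (G1 z * ncexp ((- ln (1 - z)) *: letter R true)) (xw n.+1) +
    ln z ^+ n / n.+1`!%:R * (ln z * ln (1 - z)) @[z --> (1:R)^'-] --> (0 : R).
  by rewrite -[X in _ --> X](addr0 0) -{2}(mulr0 (0 ^+ n / n.+1`!%:R)); exact: cvgD h1 h2.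
apply: (cvg_eq_inside _ in1 _ h) => z z01.
rewrite nccoef_xwM ncexp_letter_nil mul1r big_ord_recr big1 ?add0r => [|i _].
  rewrite -[nat_of_ord ord_max]/n.+1 subnn -[xw 0]/[:: true] ncexp_letter_coef eqxx G1_x0n // exprSr.
  by move: (nccoef (G1 z) (xw n.+1)) => y /=; ring.
rewrite -[nat_of_ord (widen_ord _ _)]/(nat_of_ord i) subSn; last by rewrite -ltnS.
by rewrite ncexp_letterE /= mulr0.
Qed.

Let G0_xw_left1 n : (0 < n)%N ->
  nccoef (G0 z) (xw n) @[z --> (1:R)^'-] --> nccoef Phi (xw n).
Proof.
move=> n0.
have h : \sum_(i < n.+1) ln z ^+ i / i`!%:R * nccoef Phi (xw (n - i)) + nccoef Phi [::] * nccoef (G1 z) (xw n)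
   @[z --> (1:R)^'-] --> \sum_(i < n.+1) (i == 0%N :> nat)%:R * nccoef Phi (xw (n - i)) + nccoef Phi [::] * 0.
  apply: cvgD; last by apply: cvgM; [exact: cvg_cst|exact: G1_xw_cvg].
  apply: cvg_big => [|i _]; first exact: add_continuous.
  by apply: cvgM; [exact: cvg_ln_pow|exact: cvg_cst].
move: h; rewrite mulr0 addr0 big_ord_recl mul1r subn0 big1 => [|i _]; last by rewrite mul0r.
rewrite addr0 => h; apply: (cvg_eq_inside _ in1 _ h) => z z01.
rewrite (G1Phi z01) nccoef_xwM; congr (_ + _).
by apply: eq_bigr => i _; rewrite G1_x0n.
Qed.

Let lipart_le_zeta s N (z : R) : (1 < s)%N -> 0 < z < 1 -> lipart s N z <= zeta R s.
Proof.
move=> s1 /andP[z0 z1]; apply: le_trans (zpart_le_zeta R N s1).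
apply: ler_sum => k _; rewrite -[leRHS]mul1r ler_pM2r ?invr_gt0 ?exprn_gt0 ?ltr0n //.
by apply: exprn_ile1; apply: ltW.
Qed.

Let G0_xw_le_zeta n (z : R) : (0 < n)%N -> 0 < z < 1 -> - nccoef (G0 z) (xw n) <= zeta R n.+1.
Proof.
move=> n0 /andP[z0 z1]; set L := - _.
(* Any point strictly between z and 1 serves: for fixed b the remainder vanishes as N grows. *)
pose b : R := (z + 1) / 2.
have b01 : 0 < b < 1 by rewrite /b; apply/andP; split; lra.
have zb : 0 < z < b by rewrite z0 /= /b; lra.
have c0 : 0 < (1 - b)^-1 by rewrite invr_gt0 subr_gt0; case/andP: b01.
have h N : L <= zeta R n.+1 + (1 - b)^-1 * N.+1%:R^-1.
  have /andP[_] := G0_xw_bounds n N b01 zb; rewrite -/L lerBlDl => /le_trans; apply.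
  apply: lerD; first by apply: lipart_le_zeta; rewrite ?z0.
  have N1 : 1 <= N.+1%:R :> R by rewrite ler1n.
  rewrite mulrCA ler_pM2l //; apply: (@le_trans _ _ (N.+1%:R ^+ n.+1)^-1).
    by rewrite ler_piMl ?invr_ge0 ?exprn_ge0 // exprn_ile1 // ltW.
  by rewrite lef_pV2 ?posrE ?exprn_gt0 // ler_eXnr.
have c : zeta R n.+1 + (1 - b)^-1 * N.+1%:R^-1 @[N --> \oo] --> zeta R n.+1 + (1 - b)^-1 * 0.
  apply: cvgD; first exact: cvg_cst.
  apply: cvgM; [exact: cvg_cst|exact: cvg_harmonic].
rewrite mulr0 addr0 in c.
by apply: (ler_cvg_to (cvg_cst L) c); near=> N; exact: h.
Unshelve. all: by end_near. Qed.

(** The limits z -> 1 and N -> oo are exchanged through two inequalities, as the polylogarithm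
    series has nonnegative terms: its value is at most zeta(n+1) for every z, and it dominates every
    partial sum. *)
Lemma associator_xw n : nccoef Phi (xw n) = if n == 0%N then 0 else - zeta R n.+1.
Proof.
case: n => [|n]; first exact: Phi_letter.
apply: (can_inj opprK); rewrite opprK.
have c : - nccoef (G0 z) (xw n.+1) @[z --> (1:R)^'-] --> - nccoef Phi (xw n.+1).
  by apply: cvgN; exact: G0_xw_left1.
apply/eqP; rewrite eq_le; apply/andP; split.
  apply: (ler_cvg_to c (cvg_cst _)).
  by near=> z; apply: G0_xw_le_zeta => //; near: z; exact: in1.
have cz := @cvg_zpart R n.+2 isT.
apply: (@ler_cvg_to _ _ _ _ (zpart R n.+2) (fun=> - nccoef Phi (xw n.+1)) _ _ cz (cvg_cst _)).
near=> N; apply: (ler_cvg_to (@lipart_left1 R n.+2 N) c).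
near=> z; have z01 : 0 < z < 1 by near: z; exact: in1.
pose b : R := (z + 1) / 2; case/andP: (z01) => z0 z1.
have b01 : 0 < b < 1 by rewrite /b; apply/andP; split; lra.
have zb : 0 < z < b by rewrite z0 /= /b; lra.
by have /andP[] := G0_xw_bounds n.+1 N b01 zb; rewrite subr_ge0.
Unshelve. all: by end_near. Qed.

End Associator.

(** * Euler's formula in complex form and assembly of the two components *)

Section Final.
Variable R : realType.
Local Notation C := (R[i]).

(** For even n, (2 pi i)^n = (-1)^(n/2) (2 pi)^n matches the sign in Euler's formula; for odd n > 1
    the Bernoulli number vanishes. *)
Lemma zeta_key (zeta_even : forall m, (0 < m)%N ->
    zeta R m.*2 = - (-1) ^+ m * ratr (beta m.*2) * (2 * pi) ^+ m.*2 / 2) n : (1 < n)%N ->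
  ratr (bernoulli_num n) / n`!%:R * (2 * pii R) ^+ n / 2 + (zeta R n)%:C%C =
  if odd n then (zeta R n)%:C%C else 0.
Proof.
move=> n1.
have -> : ratr (bernoulli_num n) / n`!%:R = (ratr (beta n))%:C%C :> C.
  by rewrite beta_bernoulli // fmorph_rat fmorph_div rmorph_nat.
case: ifP => on; first by rewrite beta_odd // rmorph0 rmorph0 !mul0r add0r.
have nE : n = n./2.*2 by rewrite -[LHS]odd_double_half on add0n.
have m0 : (0 < n./2)%N by move: n1 on; case: n {nE} => [|[|n]].
rewrite {2 3}nE zeta_even // -nE; set m := n./2.
have -> : (2 * pii R) ^+ n = ((-1) ^+ m * (2 * pi) ^+ n : R)%:C%C.
  have -> : 2 * pii R = (2 * pi : R)%:C%C * 'i%C by rewrite /pii rmorphM rmorph_nat mulrA.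
  rewrite exprMn [RHS]rmorphM [X in _ = _ * X]rmorphXn mulrC; congr (_ * _).
  by rewrite nE -mul2n exprM sqr_i rmorphXn rmorphN1.
have -> : 2 = (2 : R)%:C%C :> C by rewrite rmorph_nat.
rewrite -fmorphV -!rmorphM -rmorphD -[RHS](rmorph0 (real_complex R)); congr (_%:C%C); ring.
Qed.

(** The algebraic half: analysis enters only through these hypotheses on Phi and on the even zeta
    values. *)
Theorem theorem5p2_of (Phi : ncseries R) (Phi_glike : glike Phi)
  (Phi0 : forall n, nccoef Phi (nseq n false) = (n == 0%N)%:R)
  (Phi1 : forall n, nccoef Phi (rcons (nseq n false) true) =
    if n == 0%N then 0 else - zeta R n.+1)
  (zeta_even : forall m, (0 < m)%N ->
    zeta R m.*2 = - (-1) ^+ m * ratr (beta m.*2) * (2 * pi) ^+ m.*2 / 2) :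
  let tpi := 2 * pii R in
  let c := cseries (R[i]) in
  let U := varU (R[i]) in
  let V := varV (R[i]) in
  unique (D1_component (nclog (A_oo Phi)))
    (constUV tpi * (inU c - constUV (tpi / 4) * V + inV (odd_zeta_series R 0))) /\
  unique (D1_component (nclog (B_oo Phi)))
    (- constUV tpi * (inV (fps_scalevar tpi c)
                  + U * inU c * inV (fps_scalevar tpi c))
     + U * inV (odd_zeta_series R 1)).
Proof.
move=> tpi c U V.
have g := glike_to_C Phi_glike.
have P0 n : nccoef (to_C Phi) (nseq n false) = (n == 0%N)%:R.
  by rewrite /= Phi0 rmorph_nat.
have P1 n : nccoef (to_C Phi) (rcons (nseq n false) true) =
    if n == 0%N then 0 else - (zeta R n.+1)%:C%C.
  by rewrite /= Phi1; case: eqP; rewrite ?rmorph0 ?rmorphN.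
have key := zeta_key zeta_even.
split.
  exact: (A_component g P0 P1 (erefl tpi) key).
exact: (B_component g P0 P1 key).
Qed.

End Final.

Theorem theorem5p2 (R : realType) (Phi : ncseries R)
    (hPhi : drinfeld_associator Phi) :
  let tpi := 2 * pii R in
  let c := cseries (R[i]) in
  let U := varU (R[i]) in
  let V := varV (R[i]) in
  unique (D1_component (nclog (A_oo Phi)))
    (constUV tpi * (inU c - constUV (tpi / 4) * V + inV (odd_zeta_series R 0))) /\
  unique (D1_component (nclog (B_oo Phi)))
    (- constUV tpi * (inV (fps_scalevar tpi c)
                  + U * inU c * inV (fps_scalevar tpi c))
     + U * inV (odd_zeta_series R 1)).
Proof.
case: (hPhi) => G0 [G1 [KZ0 KZ1 as0 as1 PhiE]]; apply: theorem5p2_of.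
- exact: glike_associator.
- exact: (associator_x0 KZ0 KZ1 as0 as1 PhiE).
- exact: (associator_xw KZ0 KZ1 as0 as1 PhiE).
- exact: zeta_even.
Qed.
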